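(* Let $\eta=\eta(\varepsilon)$ satisfy either $\eta=\mathcal O(\sqrt\varepsilon)$ or $\eta=\mathcal O(\varepsilon)$ as $\varepsilon\to0$. Let $f^\varepsilon$ be smooth solutions, in a region of $(x,t)$-space, of the rescaled mean-field model $$\varepsilon(\partial_tf+\omega\cdot\nabla_xf)+K_2\eta^2\big[\nabla_\omega\cdot(P_{\omega^\perp}\ell_f\,f)-m_f\,\Delta_\omega f\big]=Q(f)+\mathcal O(\eta^4),$$ and suppose that this is a ''disordered region'', i.e. the solution locally converges to a stable uniform distribution: writing $\rho^\varepsilon=\int_{\mathbb S}f^\varepsilon\,d\omega$ and $f^\varepsilon=\rho^\varepsilon+\varepsilon f_1^\varepsilon$, one has $f_1^\varepsilon=\mathcal O(1)$ and $\rho^\varepsilon=\mathcal O(1)$ (together with all their derivatives), and $\rho^\varepsilon$ stays below $\rho_c$, uniformly away from it. Then, as $\varepsilon\to0$, the (formal) first order approximation of $f^\varepsilon$ is $$f^\varepsilon(x,\omega,t)=\rho^\varepsilon(x,t)-\varepsilon\,\frac{n\,\omega\cdot\nabla_x\rho^\varepsilon(x,t)}{(n-1)\,n\,\tau_0\left(1-\frac{\rho^\varepsilon(x,t)}{\rho_c}\right)},$$ where $\rho^\varepsilon$ satisfies the diffusion equation $$\partial_t\rho^\varepsilon=\frac{\varepsilon}{(n-1)\,n\,\tau_0}\,\nabla_x\cdot\left(\frac1{1-\frac{\rho^\varepsilon}{\rho_c}}\,\nabla_x\rho^\varepsilon\right);$$ that is, the first identity holds up to an error $\mathcal O(\varepsilon^2)$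 and the second one up to the $x$-divergence of a vector field that is $\mathcal O(\varepsilon^2)$.
   Context: Let $n\ge2$, $\mathbb S$ the unit sphere of $\mathbb R^n$ with uniform probability measure $d\omega$; $x\in\mathbb R^n$, $\omega\in\mathbb S$, $t>0$. $\nabla_\omega\cdot$ and $\Delta_\omega$ are the divergence and Laplace–Beltrami operator on $\mathbb S$; $P_{\omega^\perp}=\mathrm{Id}-\omega\otimes\omega$. The functions $\nu,\tau$ on $[0,\infty)$ (independent of $\varepsilon$) are as smooth as needed, $\nu\ge0$, $\tau>0$, with $r\mapsto\nu(r)/r$ and $\tau$ Lipschitz and bounded; $\tau_0=\tau(0)$; $k=\nu/\tau$ is increasing; $\rho_c=\lim_{r\to0}\frac{n\,r}{k(r)}$ (so that $\nu'(0)=n\tau_0/\rho_c$). For $f(x,\omega,t)$, put $J_f(x,t)=\int_{\mathbb S}f\,\omega\,d\omega$, $\Omega_f=J_f/|J_f|$, $$Q(f)=-\nu(|J_f|)\nabla_\omega\cdot(P_{\omega^\perp}\Omega_f\,f)+\tau(|J_f|)\Delta_\omega f,$$ $$\ell_f=\frac{\nu(|J_f|)}{|J_f|}P_{\Omega_f^\perp}\Delta_xJ_f+(\Omega_f\cdot\Delta_xJ_f)\,\nu'(|J_f|)\,\Omega_f,\qquad m_f=(\Omega_f\cdot\Delta_xJ_f)\,\tau'(|J_f|).$$ $K_2=\frac1{2n}\int_{\mathbb R^n}K(|\xi|)|\xi|^2d\xi$ is a fixed positive constant, where $K$ is the observation kernel, with $\int K(|\xi|)\,d\xi=1$. The rescaled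 model is the expansion in the interaction range $\eta$ of the kinetic equation $\varepsilon(\partial_tf+\omega\cdot\nabla_xf)+\nu(|\mathcal J_f|)\nabla_\omega\cdot(P_{\omega^\perp}\frac{\mathcal J_f}{|\mathcal J_f|}f)=\tau(|\mathcal J_f|)\Delta_\omega f$ with $\mathcal J_f=K_\eta*J_f$ (convolution in $x$), $K_\eta(x)=\eta^{-n}K(x/\eta)$; in particular the $\mathcal O(\eta^4)$ remainder has zero integral over $\omega\in\mathbb S$, so that mass is conserved: $\partial_t\int_{\mathbb S} f\,d\omega+\nabla_x\cdot J_f=0$. All $\mathcal O(\cdot)$ are uniform in the region as $\varepsilon\to0$. *)

(* Defs.v *)
From HB Require Import structures.
From mathcomp Require Import all_boot all_order all_algebra.
From mathcomp Require Import all_classical all_reals all_analysis.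

Set Implicit Arguments.
Unset Strict Implicit.
Unset Printing Implicit Defensive.

Import Order.TTheory GRing.Theory Num.Theory.
Import numFieldNormedType.Exports.

Local Open Scope classical_set_scope.
Local Open Scope ring_scope.

Section euclidean.
Variables (R : realType) (n : nat).
Implicit Types (u v w x : 'rV[R]_n).

Definition dot u v : R := \sum_i u 0 i * v 0 i.

(* The library norm on ['rV[R]_n] is the sup norm; it induces the same
   topology. *)
Definition enorm v : R := Num.sqrt (dot v v).

Definition sphere : set 'rV[R]_n := [set w | enorm w = 1].

(* Equal to 0 at [v = 0]. *)
Definition normalize v : 'rV[R]_n := (enorm v)^-1 *: v.

(* The matrix Id - w (x) w applied to v. *)
Definition perp w v : 'rV[R]_n := v - dot w v *: w.

Definition partial (i : 'I_n) (g : 'rV[R]_n -> R) x : R :=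
  'D_(delta_mx 0 i : 'rV[R]_n) g x.

Definition grad (g : 'rV[R]_n -> R) x : 'rV[R]_n := \row_i partial i g x.

Definition div (A : 'rV[R]_n -> 'rV[R]_n) x : R :=
  \sum_i partial i (fun y => A y 0 i) x.

Definition laplacian (g : 'rV[R]_n -> R) x : R :=
  \sum_i partial i (partial i g) x.

Definition vlaplacian (A : 'rV[R]_n -> 'rV[R]_n) x : 'rV[R]_n :=
  \row_i laplacian (fun y => A y 0 i) x.

(* Divergence of a tangent field and Laplace-Beltrami operator on the unit
   sphere: the Euclidean operators applied, at w on the sphere, to the
   extension that is homogeneous of degree 0. Only the values on the sphere
   of the argument are used. *)
Definition sdiv (A : 'rV[R]_n -> 'rV[R]_n) w : R := div (A \o normalize) w.

Definition slaplacian (g : 'rV[R]_n -> R) w : R :=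
  laplacian (g \o normalize) w.

Definition rVborel := g_sigma_algebraType (@open 'rV[R]_n).

(* The uniform probability on the sphere is the unique Borel probability
   carried by the sphere and invariant under the orthogonal group. *)
Definition uniform_on_sphere (sigma : probability rVborel R) : Prop :=
  sigma sphere = 1%E /\
  forall (O : 'M[R]_n) (A : set rVborel), O *m O^T = 1%:M -> measurable A ->
    sigma [set w : rVborel | A ((w : 'rV[R]_n) *m O)] = sigma A.

(* Lebesgue measure is the unique Borel measure with these values on boxes. *)
Definition is_lebesgue (lam : {measure set rVborel -> \bar R}) : Prop :=
  forall a b : 'rV[R]_n, (forall i, a 0 i <= b 0 i) ->
    lam [set x : rVborel | forall i, a 0 i <= (x : 'rV[R]_n) 0 i < b 0 i] =
    (\prod_i (b 0 i - a 0 i))%:E.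

Definition kernel_moment (lam : {measure set rVborel -> \bar R})
    (K : R -> R) : R :=
  (2 * n%:R)^-1 *
  Rintegral lam setT (fun xi => K (enorm xi) * enorm xi ^+ 2).

End euclidean.

Section smoothness.
Variables (R : realType) (V : normedModType R).

Definition iter_derive (vs : seq V) (g : V -> R) : V -> R :=
  foldr (fun v h => 'D_v h) g vs.

(* C^oo on the open set D: the iterated directional derivatives of all orders
   are Frechet differentiable at every point of D. *)
Definition smooth_on (D : set V) (g : V -> R) : Prop :=
  forall (vs : seq V) (p : V), D p -> differentiable (iter_derive vs g) p.

(* g e = O(b e) as e -> 0+, uniformly on D. *)
Definition unifO (D : set V) (g : R -> V -> R) (b : R -> R) : Prop :=
  exists C : R, \forall e \near 0^'+, forall p, D p -> `|g e p| <= C * b e.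

Definition unifO1_derivatives (D : set V) (g : R -> V -> R) : Prop :=
  forall vs : seq V, unifO D (fun e => iter_derive vs (g e)) (fun=> 1).

End smoothness.

(* Functions of (x, omega, t) are curried; omega ranges over ['rV[R]_n] but
   only unit vectors matter. The coefficients nu and tau live on [0, +oo[; they
   are represented by extensions to R, so that their (one-sided) derivatives at
   0 are the ordinary derivatives of the extensions. *)
Section model.
Variables (R : realType) (n : nat) (sigma : probability (rVborel R n) R).
Implicit Types (f : 'rV[R]_n -> 'rV[R]_n -> R -> R) (x w : 'rV[R]_n) (t : R).
Implicit Types (U : set ('rV[R]_n * R)).

Definition density f x t : R := Rintegral sigma (@sphere R n) (fun w => f x w t).

Definition flux f x t : 'rV[R]_n :=
  \row_i Rintegral sigma (@sphere R n) (fun w => f x w t * (w : 'rV[R]_n) 0 i).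

(* Omega_f = J_f / |J_f|; by convention 0 where the flux vanishes, so that
   [mcoef] below is 0 there and [nu |J_f| Omega_f] is unambiguous (nu 0 = 0). *)
Definition direction f x t : 'rV[R]_n := normalize (flux f x t).

(* r |-> nu(r) / r, continuously extended to r = 0. *)
Definition slope (nu : R -> R) (r : R) : R :=
  if r == 0 then derive1 nu 0 else nu r / r.

Definition collision (nu tau : R -> R) f x w t : R :=
  - nu (enorm (flux f x t)) *
      sdiv (fun w => f x w t *: perp w (direction f x t)) w
  + tau (enorm (flux f x t)) * slaplacian (fun w => f x w t) w.

Definition flux_laplacian f x t : 'rV[R]_n := vlaplacian (fun y => flux f y t) x.

(* Where the flux vanishes this is nu'(0) times the Laplacian of the flux, the
   continuous extension of the formula. *)
Definition ell (nu : R -> R) f x t : 'rV[R]_n :=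
  let J := flux f x t in
  let Om := direction f x t in
  let DJ := flux_laplacian f x t in
  slope nu (enorm J) *: perp Om DJ + (dot Om DJ * derive1 nu (enorm J)) *: Om.

Definition mcoef (tau : R -> R) f x t : R :=
  dot (direction f x t) (flux_laplacian f x t) * derive1 tau (enorm (flux f x t)).

Definition transport f x w t : R :=
  derive1 (fun s => f x w s) t + dot w (grad (fun y => f y w t) x).

Definition nonlocal (nu tau : R -> R) f x w t : R :=
  sdiv (fun w => f x w t *: perp w (ell nu f x t)) w
  - mcoef tau f x t * slaplacian (fun w => f x w t) w.

(* A function of (x, omega, t), extended to all omega <> 0 by homogeneity of
   degree 0 in omega. Smoothness and derivatives of functions on the product
   of the region with the sphere are those of this extension. *)
Definition deg0 f (p : 'rV[R]_n * 'rV[R]_n * R) : R :=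
  f p.1.1 (normalize p.1.2) p.2.

Definition region_punctured U : set ('rV[R]_n * 'rV[R]_n * R) :=
  [set p | U (p.1.1, p.2) /\ p.1.2 != 0].

Definition region_sphere U : set ('rV[R]_n * 'rV[R]_n * R) :=
  [set p | U (p.1.1, p.2) /\ sphere p.1.2].

(* The corrector f_1 of f = rho + e f_1. *)
Definition corrector (e : R) f x w t : R := (f x w t - density f x t) / e.

End model.

(* Main.v *)
Require Import Defs.
From HB Require Import structures.
From mathcomp Require Import all_boot all_order all_algebra.
From mathcomp Require Import all_classical all_reals all_analysis measurable_realfun.
From mathcomp Require Import ring lra.

(* Write f = rho + e f_1. The flux of f is e J, where J is the flux of f_1, and
   integrating the model over the sphere gives d_t rho = - e div J, which is O(e).
   Every other term of the model divided by e is O(e), except for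

     tau 0 Lap f_1 = w . B,   B = grad rho - (n - 1) nu'(0) rho J,

   Lap being the Laplace-Beltrami operator. As w . B is an eigenfunction of Lap
   for the eigenvalue 1 - n, the function h = f_1 + w . B / ((n - 1) tau 0) has
   mean 0 and Lap h = O(e) uniformly, hence h = O(e) uniformly. Taking fluxes,
   J = - B / (n (n - 1) tau 0) + O(e), and nu'(0) = n tau 0 / rhoc lets one solve
   for J (here rho < rhoc is used):

     J = - grad rho / ((n - 1) n tau 0 (1 - rho / rhoc)) + O(e).

   The sup-norm bound on h avoids regularity theory on the sphere: the averages
   of h against the zonal densities proportional to (1 + w . a)^N satisfy a
   recurrence in N whose increments are controlled by Lap h. *)

Set Implicit Arguments.
Unset Strict Implicit.
Unset Printing Implicit Defensive.

Import Order.TTheory GRing.Theory Num.Theory.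
Import numFieldNormedType.Exports.

Local Open Scope classical_set_scope.
Local Open Scope ring_scope.

(** No charts or surface measure are available: [sigma] is known only through its invariance, and
    the spherical operators act on degree-0 extensions. The fields [angular i j] link the two. They
    generate rotations, so invariance of [sigma] differentiates into integration by parts; they are
    tangent to the sphere, so they may be applied to any extension, for instance to w . a itself;
    and at unit vectors half the sum of their squares is the Laplacian of a degree-0 function. As
    for the orders, ell_f and m_f are linear in the Laplacian of the flux, hence O(e). Both regimes
    of eta give eta^2 = O(e), so the nonlocal bracket and the remainder eta^4 both enter the model
    at O(e^2). The obstacle is a circularity: B contains J, the flux of the unknown f_1. J is left
    inside B until the bound on h has been averaged against w; this yields a linear equation for J
    with coefficient 1 - rho / rhoc, which is bounded away from 0. Mass conservation holds exactly
    at each small e. The error in the diffusion equation is therefore an exact divergence, and no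
    derivative of an error term has to be estimated. *)

Section sphere_basics.
Context {R : realType} {n : nat}.
Implicit Types (u v w x : 'rV[R]_n).

Lemma dotC u v : dot u v = dot v u.
Proof. by apply: eq_bigr => i _; rewrite mulrC. Qed.

Lemma dotDl u v w : dot (u + v) w = dot u w + dot v w.
Proof.
by rewrite /dot -big_split /=; apply: eq_bigr => i _; rewrite mxE mulrDl.
Qed.

Lemma dotZl (c : R) u v : dot (c *: u) v = c * dot u v.
Proof. by rewrite /dot mulr_sumr; apply: eq_bigr => i _; rewrite mxE mulrA. Qed.

Lemma dotDr u v w : dot u (v + w) = dot u v + dot u w.
Proof. by rewrite dotC dotDl !(dotC u). Qed.

Lemma dotZr (c : R) u v : dot u (c *: v) = c * dot u v.
Proof. by rewrite dotC dotZl dotC. Qed.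

Lemma dot0r u : dot u 0 = 0.
Proof. by rewrite -(scale0r (0 : 'rV[R]_n)) dotZr mul0r. Qed.

Lemma dot_subsqr u v : dot (u - v) (u - v) = dot u u - 2 * dot u v + dot v v.
Proof.
rewrite -(scaleN1r v) !dotDl !dotDr !dotZl !dotZr (dotC v u).
move: (dot u u) (dot u v) (dot v v) => *; ring.
Qed.

Lemma dot_ge0 u : 0 <= dot u u.
Proof. by apply: sumr_ge0 => i _; rewrite -expr2 sqr_ge0. Qed.

Lemma dot_eq0 u : (dot u u == 0) = (u == 0).
Proof.
apply/idP/eqP => [|->]; last by rewrite dot0r.
rewrite psumr_eq0 => [/allP h|i _]; last by rewrite -expr2 sqr_ge0.
apply/rowP => i; rewrite mxE; apply/eqP; move: (h i).
by rewrite mem_index_enum mulf_eq0 orbb => /(_ erefl).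
Qed.

Lemma enorm_ge0 u : 0 <= enorm u. Proof. exact: sqrtr_ge0. Qed.

Lemma enorm_sqr u : enorm u ^+ 2 = dot u u.
Proof. by rewrite sqr_sqrtr // dot_ge0. Qed.

Lemma enorm_eq0 u : (enorm u == 0) = (u == 0).
Proof. by rewrite -sqrf_eq0 enorm_sqr dot_eq0. Qed.

Lemma enormZ (c : R) u : enorm (c *: u) = `|c| * enorm u.
Proof.
by rewrite /enorm dotZl dotZr mulrA -expr2 sqrtrM ?sqr_ge0// sqrtr_sqr.
Qed.

Lemma sphereP w : sphere w <-> dot w w = 1.
Proof.
split=> [h|h]; first by rewrite -enorm_sqr h expr1n.
by rewrite /sphere /= /enorm h sqrtr1.
Qed.

Lemma sphere_neq0 w : sphere w -> w != 0.
Proof. by move=> wS; rewrite -enorm_eq0 wS oner_eq0. Qed.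

Lemma normalize_sphere w : w != 0 -> sphere (normalize w).
Proof.
rewrite -enorm_eq0 => w0.
by rewrite /sphere /= enormZ ger0_norm ?invr_ge0 ?enorm_ge0 // mulVf.
Qed.

Lemma normalize_id w : sphere w -> normalize w = w.
Proof. by move=> wS; rewrite /normalize wS invr1 scale1r. Qed.

Lemma normalizeZ (c : R) w : 0 < c -> normalize (c *: w) = normalize w.
Proof.
move=> c0; rewrite /normalize enormZ gtr0_norm // scalerA invfM.
by rewrite mulrAC mulVf ?mul1r // gt_eqF.
Qed.

Lemma sqr_coord_le u i : u 0 i ^+ 2 <= dot u u.
Proof.
rewrite /dot (bigD1 i) //= -expr2 lerDl sumr_ge0 // => j _.
by rewrite -expr2 sqr_ge0.
Qed.

Lemma coord_le_enorm u i : `|u 0 i| <= enorm u.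
Proof. by rewrite -sqrtr_sqr ler_wsqrtr // sqr_coord_le. Qed.

Lemma enorm_le_sum u : enorm u <= \sum_i `|u 0 i|.
Proof.
rewrite -(ler_pXn2r (ltn0Sn 1)) ?nnegrE ?enorm_ge0 ?sumr_ge0 //.
rewrite enorm_sqr [leRHS]expr2 mulr_suml /dot; apply: ler_sum => i _.
rewrite -expr2 -real_normK ?num_real // expr2.
by apply: ler_wpM2l => //; rewrite (bigD1 i) //= lerDl sumr_ge0.
Qed.

Lemma coord_sphere_le1 w i : sphere w -> `|w 0 i| <= 1.
Proof. by move=> <-; exact: coord_le_enorm. Qed.

Lemma coordwise_continuous i w : {for w, continuous (fun w : 'rV[R]_n => w 0 i)}.
Proof. exact: coord_continuous. Qed.

Lemma sumr_continuous (T : topologicalType) (I : Type) (r : seq I)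
    (F : I -> T -> R) (x : T) :
  (forall i, {for x, continuous (F i)}) ->
  {for x, continuous (fun y => \sum_(i <- r) F i y)}.
Proof.
move=> cF; elim: r => [|i r IH].
  rewrite (_ : (fun y => _) = cst 0); first exact: cst_continuous.
  by apply/funext => y; rewrite big_nil.
rewrite (_ : (fun y => _) = (fun y => F i y + \sum_(j <- r) F j y)).
  by apply: continuousD; [exact: cF | exact: IH].
by apply/funext => y; rewrite big_cons.
Qed.

Lemma rV_continuous (T : topologicalType) m (F : T -> 'rV[R]_m) (x : T) :
  (forall i, {for x, continuous (fun y => F y 0 i)}) -> {for x, continuous F}.
Proof.
move=> cF; apply/cvgrPdist_lt => e e0.
have h : \forall y \near x, forall i, `|F x 0 i - F y 0 i| < e.
  apply: filter_forall => i.
  by have /cvgrPdist_lt := cF i; apply.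
near=> y; rewrite [ltLHS]/Num.Def.normr /= mx_normrE; apply/bigmax_ltP; split => //.
have hy : forall i, `|F x 0 i - F y 0 i| < e by near: y.
by move=> [i j] _ /=; rewrite ord1 !mxE.
Unshelve. all: by end_near. Qed.

Lemma mulmx_rV_continuous (O : 'M[R]_n) :
  continuous (fun w : 'rV[R]_n => w *m O).
Proof.
move=> w; apply: rV_continuous => i.
rewrite (_ : (fun y => _) = fun y : 'rV[R]_n => \sum_j y 0 j * O j i); last first.
  by apply/funext => y; rewrite mxE.
apply: sumr_continuous => j; apply: continuousM; first exact: coordwise_continuous.
exact: cst_continuous.
Qed.

Lemma dot_continuous v : continuous (dot v).
Proof.
move=> w; apply: sumr_continuous => i; apply: continuousM.
  exact: cst_continuous.
exact: coordwise_continuous.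
Qed.

Lemma sqdot_continuous : continuous (fun w : 'rV[R]_n => dot w w).
Proof.
move=> w; apply: sumr_continuous => i.
by apply: continuousM; exact: coordwise_continuous.
Qed.

Lemma sphereE : @sphere R n = (fun w => dot w w) @^-1` [set 1].
Proof. by apply/seteqP; split => w /sphereP. Qed.

Lemma closed_sphere : closed (@sphere R n).
Proof.
rewrite sphereE; apply: closed_comp => [w _|]; first exact: sqdot_continuous.
exact: closed_eq.
Qed.

Lemma norm_le_enorm w : `|w| <= enorm w.
Proof.
rewrite [leLHS]/Num.Def.normr /= mx_normrE; apply/bigmax_leP; split.
  exact: enorm_ge0.
by move=> [i j] _ /=; rewrite ord1 coord_le_enorm.
Qed.

Lemma compact_sphere : compact (@sphere R n).
Proof.
apply: bounded_closed_compact; last exact: closed_sphere.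
exists 1; split=> // M M1 w wS; apply: (le_trans (norm_le_enorm w)).
by rewrite wS ltW.
Qed.

Lemma open_neq0 : open [set w : 'rV[R]_n | w != 0].
Proof.
rewrite (_ : [set w | _] = (fun w => dot w w) @^-1` [set r | r != 0]).
  apply: open_comp => [w _|]; first exact: sqdot_continuous.
  exact: open_neq.
by apply/seteqP; split => w /=; rewrite dot_eq0.
Qed.

Lemma near_neq0 w : w != 0 -> \forall y \near w, y != 0.
Proof. by move=> w0; apply: open_nbhs_nbhs; split; [exact: open_neq0|]. Qed.

Lemma measurable_open (A : set (rVborel R n)) : open (A : set 'rV[R]_n) ->
  measurable A.
Proof. by move=> oA; exact: sub_sigma_algebra. Qed.

Lemma measurable_sphere : measurable (@sphere R n : set (rVborel R n)).
Proof.
rewrite -[X in measurable X]setCK; apply: measurableC; apply: measurable_open.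
exact/closed_openC/closed_sphere.
Qed.

(** A tube-lemma argument: joint continuity at each [(p, w)] gives a product neighbourhood on which
    [H] varies little, and compactness of the sphere makes the neighbourhood of [p] independent of
    [w]. *)
Lemma uniform_continuity_on_sphere (T : topologicalType)
    (H : T -> 'rV[R]_n -> R) (p : T) :
  (forall w, sphere w -> {for (p, w), continuous (fun q => H q.1 q.2)}) ->
  forall e, 0 < e ->
  \forall q \near p, forall w, sphere w -> `|H q w - H p w| < e.
Proof.
move=> cH e e0.
have /compact_near_coveringP cov := compact_sphere.
apply: (cov T (nbhs p) (fun q w => `|H q w - H p w| < e)) => w wS.
have e2 : 0 < e / 2 by rewrite divr_gt0.
have /(_ w wS) := cH; rewrite /prop_for /continuous_at /=.
move=> /cvgrPdist_lt/(_ _ e2) near_pw.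
have [[A B]/= [Ap Bw] AB] := near_pw.
exists (B, A); first by split.
move=> [w' q] [/= Bw' Aq] /=.
have h1 := AB (q, w') (conj Aq Bw').
have h2 := AB (p, w') (conj (nbhs_singleton Ap) Bw').
rewrite /= in h1 h2; rewrite [e]splitr.
rewrite (_ : _ - _ = (H p w - H p w') - (H p w - H q w')); last by ring.
by rewrite (le_lt_trans (ler_normB _ _)) // ltrD.
Qed.

End sphere_basics.

(** * Averages over the sphere of functions continuous off the origin *)

Section mean.
Context {R : realType} {n : nat} (sigma : probability (rVborel R n) R).
Hypothesis sigma_uniform : uniform_on_sphere sigma.
Implicit Types (g h : 'rV[R]_n -> R).

(** The origin is excluded because degree-0 extensions are in general discontinuous there. This
    class is stable under the operations used below and guarantees integrability on the sphere,
    which linearity of [mean] requires. *)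
Definition cont0 g := forall w : 'rV[R]_n, w != 0 -> {for w, continuous g}.

Definition mean g : R := Rintegral sigma (@sphere R n) g.

Lemma cont0P g : cont0 g <->
  (forall w : 'rV[R]_n, w != 0 -> {for w, continuous g}).
Proof. by []. Qed.

(** Preimages of open intervals are open within the open set of nonzero vectors; the result is then
    restricted to the sphere. *)
Lemma measurable_fun_cont0 g : cont0 g ->
  measurable_fun (@sphere R n : set (rVborel R n)) (g : rVborel R n -> R).
Proof.
move=> cg; have m0 : measurable ([set w | w != 0] : set (rVborel R n)).
  by apply: measurable_open; exact: open_neq0.
apply: (measurable_funS m0); first by move=> w; exact: sphere_neq0.
apply: (measurability _ (RGenOpens.measurableE R)).
move=> _ [_ [a [b ->] <-]]; apply: measurable_open.
rewrite openE => w [/= w0 gw]; rewrite /interior.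
have := cg w w0; rewrite /prop_for /continuous_at => /(_ `]a, b[%classic) cgw.
have ab : nbhs (g w) `]a, b[%classic.
  by apply: open_nbhs_nbhs; split => //; exact: interval_open.
by apply: filterI; [exact: near_neq0 | exact: cgw].
Qed.

Lemma bounded_cont0 g : cont0 g ->
  exists2 M : R, 0 <= M & forall w, sphere w -> `|g w| <= M.
Proof.
move=> cg.
(* The extreme value theorem needs a nonempty set, and the sphere is empty when n = 0. *)
have [-> |/set0P [w0 w0S]] := eqVneq (@sphere R n) set0; first by exists 0.
have [||c cS cmax] := @compact_EVT_max _ R (fun w => `|g w|) (@sphere R n) _
    compact_sphere.
- by exists w0.
- apply: continuous_in_subspaceT => w /set_mem wS.
  apply: continuous_comp; [exact/cg/sphere_neq0 | exact: norm_continuous].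
exists `|g c| => // w wS.
by apply: cmax; rewrite inE.
Qed.

Lemma integrable_cont0 g : cont0 g ->
  sigma.-integrable (@sphere R n) (EFin \o g).
Proof.
move=> cg; apply: measurable_bounded_integrable.
- exact: measurable_sphere.
- by rewrite (le_lt_trans (probability_le1 _ measurable_sphere)) // ltry.
- exact: measurable_fun_cont0.
have [M M0 gM] := bounded_cont0 cg.
exists M; split => [|N MN w wS]; first exact: num_real.
by apply: (le_trans (gM w wS)); exact: ltW.
Qed.

Lemma eq_mean g h : (forall w, sphere w -> g w = h w) -> mean g = mean h.
Proof. by move=> gh; apply: eq_Rintegral => w /set_mem; exact: gh. Qed.

Lemma densityE (f : 'rV[R]_n -> 'rV[R]_n -> R -> R) x t :
  density sigma f x t = mean (fun w => f x w t).
Proof. by []. Qed.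

Lemma fluxE (f : 'rV[R]_n -> 'rV[R]_n -> R -> R) x t i :
  flux sigma f x t 0 i = mean (fun w => f x w t * w 0 i).
Proof. by rewrite mxE. Qed.

Lemma meanD g h : cont0 g -> cont0 h ->
  mean (fun w => g w + h w) = mean g + mean h.
Proof.
by move=> cg ch; apply: RintegralD;
  [exact: measurable_sphere | exact: integrable_cont0..].
Qed.

Lemma meanZ (c : R) g : cont0 g -> mean (fun w => c * g w) = c * mean g.
Proof.
by move=> cg; apply: RintegralZl;
  [exact: measurable_sphere | exact: integrable_cont0].
Qed.

Lemma cont0D g h : cont0 g -> cont0 h -> cont0 (fun w => g w + h w).
Proof.
by move=> cg ch w w0; apply: continuousD; [exact: cg | exact: ch].
Qed.

Lemma cont0M g h : cont0 g -> cont0 h -> cont0 (fun w => g w * h w).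
Proof.
by move=> cg ch w w0; apply: continuousM; [exact: cg | exact: ch].
Qed.

Lemma cont0_cst (c : R) : cont0 (fun=> c).
Proof. by move=> w w0; exact: cst_continuous. Qed.

Lemma cont0Z (c : R) g : cont0 g -> cont0 (fun w => c * g w).
Proof. by move=> cg; apply: cont0M => //; exact: cont0_cst. Qed.

Lemma cont0N g : cont0 g -> cont0 (fun w => - g w).
Proof. by move=> cg w w0; apply: continuousN; exact: cg. Qed.

Lemma cont0B g h : cont0 g -> cont0 h -> cont0 (fun w => g w - h w).
Proof. by move=> cg ch; apply: cont0D => //; exact: cont0N. Qed.

Lemma cont0_coord i : cont0 (fun w => w 0 i).
Proof. by move=> w w0; exact: coordwise_continuous. Qed.

Lemma cont0_sum (I : Type) (r : seq I) (F : I -> 'rV[R]_n -> R) :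
  (forall i, cont0 (F i)) -> cont0 (fun w => \sum_(i <- r) F i w).
Proof. by move=> cF w w0; apply: sumr_continuous => i; exact: cF. Qed.

Lemma cont0_dot v : cont0 (fun w => dot w v).
Proof.
rewrite (_ : (fun w => _) = dot v); last by apply/funext => w; rewrite dotC.
by move=> w _; exact: dot_continuous.
Qed.

Lemma mean_sum (I : Type) (r : seq I) (F : I -> 'rV[R]_n -> R) :
  (forall i, cont0 (F i)) ->
  mean (fun w => \sum_(i <- r) F i w) = \sum_(i <- r) mean (F i).
Proof.
move=> cF; elim: r => [|i r IH].
  rewrite big_nil -[RHS](mul0r (mean (cst 0))) -meanZ; last exact: cont0_cst.
  by apply: eq_mean => w _; rewrite big_nil mul0r.
rewrite big_cons -IH -meanD //; last exact: cont0_sum.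
by apply: eq_mean => w _; rewrite big_cons.
Qed.

Lemma meanN g : cont0 g -> mean (fun w => - g w) = - mean g.
Proof.
move=> cg; rewrite -mulN1r -meanZ //.
by apply: eq_mean => w _; rewrite mulN1r.
Qed.

Lemma meanB g h : cont0 g -> cont0 h ->
  mean (fun w => g w - h w) = mean g - mean h.
Proof.
by move=> cg ch; rewrite meanD ?meanN //; exact: cont0N.
Qed.

Lemma cont0_BZ (c d : R) g h : cont0 g -> cont0 h ->
  cont0 (fun w => c * g w - d * h w).
Proof. by move=> cg ch; apply: cont0B; exact: cont0Z. Qed.

Lemma mean_BZ (c d : R) g h : cont0 g -> cont0 h ->
  mean (fun w => c * g w - d * h w) = c * mean g - d * mean h.
Proof. by move=> cg ch; rewrite meanB ?meanZ //; exact: cont0Z. Qed.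

Lemma mean_cst (c : R) : mean (fun=> c) = c.
Proof.
rewrite /mean Rintegral_cst; last exact: measurable_sphere.
have /= -> := proj1 sigma_uniform; exact: mulr1.
Qed.

Lemma le_mean g h : cont0 g -> cont0 h -> (forall w, sphere w -> g w <= h w) ->
  mean g <= mean h.
Proof.
by move=> cg ch gh; apply: le_Rintegral => //;
  [exact: measurable_sphere | exact: integrable_cont0..].
Qed.

Lemma mean_norm_le (M : R) g : cont0 g -> (forall w, sphere w -> `|g w| <= M) ->
  `|mean g| <= M.
Proof.
move=> cg gM; rewrite ler_norml -[M in - M]mean_cst -[M in _ && (_ <= M)]mean_cst.
rewrite -meanN; last exact: cont0_cst.
apply/andP; split; apply: le_mean => //; try exact: cont0_cst;
  by move=> w /gM; rewrite ler_norml => /andP[].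
Qed.

Lemma dot_mulmx (O : 'M[R]_n) u v : O *m O^T = 1%:M ->
  dot (u *m O) (v *m O) = dot u v.
Proof.
have dotE a b : dot a b = (a *m b^T) 0 0.
  by rewrite mxE; apply: eq_bigr => i _; rewrite mxE.
by move=> OO; rewrite !dotE trmx_mul mulmxA -(mulmxA u) OO mulmx1.
Qed.

(** Change of variables: the image of [sigma] under [w *m O] is [sigma] itself by [sigma_uniform],
    and an orthogonal map preserves the sphere. *)
Lemma mean_mulmx (O : 'M[R]_n) g : O *m O^T = 1%:M -> cont0 g ->
  mean (fun w => g (w *m O)) = mean g.
Proof.
move=> OO cg; pose phi (w : rVborel R n) : rVborel R n := (w : 'rV[R]_n) *m O.
have mphi : measurable_fun setT phi.
  apply: (@measurability _ _ _ _ _ phi open erefl) => _ [A oA <-].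
  rewrite setTI; apply: measurable_open.
  by apply: open_comp => // w _; exact: mulmx_rV_continuous.
have phiS : phi @^-1` (@sphere R n) = @sphere R n.
  by apply/seteqP; split => w /=; rewrite /phi => /sphereP h; apply/sphereP;
    rewrite ?dot_mulmx // -h ?dot_mulmx.
have mS := @measurable_sphere R n.
(* [g] is only known to be measurable on the sphere; extending it by 0 gives a function measurable
   everywhere, as the push-forward formula asks. *)
pose g' : rVborel R n -> \bar R :=
  (EFin \o g : rVborel R n -> \bar R) \_ (@sphere R n : set (rVborel R n)).
have mg' : measurable_fun setT g'.
  apply/(measurable_restrictT _ mS).
  by apply/measurable_EFinP; exact: measurable_fun_cont0.
have eqg' : (\int[sigma]_(w in @sphere R n) (g w)%:E
           = \int[sigma]_(w in @sphere R n) g' w)%E.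
  by apply: eq_integral => w wS; rewrite /g' patchE wS.
have eqgO : (\int[sigma]_(w in @sphere R n) (g ((w : 'rV[R]_n) *m O))%:E
           = \int[sigma]_(w in @sphere R n) (g' \o phi) w)%E.
  apply: eq_integral => w wS; rewrite /g' /= patchE.
  by rewrite ifT // inE; move: wS; rewrite inE -{1}phiS.
rewrite /mean /Rintegral eqg' eqgO; congr fine.
rewrite -[in LHS]phiS -integral_pushforward //.
- apply: eq_measure_integral => A mA _; rewrite /pushforward.
  by case: sigma_uniform => _; apply.
- rewrite phiS; apply: (eq_integrable mS (EFin \o (fun w : 'rV_n => g (w *m O)))).
    move=> w wS /=; rewrite /g' patchE ifT // inE.
    by move: wS; rewrite inE -{1}phiS.
  apply: integrable_cont0 => w w0; apply: continuous_comp.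
    exact: mulmx_rV_continuous.
  apply: cg; apply: contra_neq w0 => wO.
  by apply/eqP; rewrite -dot_eq0 -(dot_mulmx w w OO) wO dot0r.
Qed.

End mean.

(** * Partial and angular derivatives, and the class of C^1 functions off the origin *)

Section partial_calculus.
Context {R : realType} {n : nat}.
Implicit Types (f g : 'rV[R]_n -> R) (w : 'rV[R]_n) (i j : 'I_n).

Lemma partialD i f g w : differentiable f w -> differentiable g w ->
  partial i (fun y => f y + g y) w = partial i f w + partial i g w.
Proof. by move=> df dg; apply: deriveD; exact: diff_derivable. Qed.

Lemma partialN i f w : differentiable f w ->
  partial i (fun y => - f y) w = - partial i f w.
Proof. by move=> df; apply: deriveN; exact: diff_derivable. Qed.

Lemma partialB i f g w : differentiable f w -> differentiable g w ->
  partial i (fun y => f y - g y) w = partial i f w - partial i g w.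
Proof. by move=> df dg; apply: deriveB; exact: diff_derivable. Qed.

Lemma partialM i f g w : differentiable f w -> differentiable g w ->
  partial i (fun y => f y * g y) w = f w * partial i g w + g w * partial i f w.
Proof. by move=> df dg; apply: deriveM; exact: diff_derivable. Qed.

Lemma partialX i (k : nat) f w : differentiable f w ->
  partial i (fun y => f y ^+ k) w = k%:R * f w ^+ k.-1 * partial i f w.
Proof.
move=> df; rewrite /partial -[X in derive X]exprfctE.
by rewrite deriveX ?mulr_natl//; exact: diff_derivable.
Qed.

Lemma partial_cst i (c : R) w : partial i (fun=> c) w = 0.
Proof. exact: derive_cst. Qed.

Lemma partial_sum i m (F : 'I_m -> 'rV[R]_n -> R) w :
  (forall k, differentiable (F k) w) ->
  partial i (fun y => \sum_k F k y) w = \sum_k partial i (F k) w.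
Proof.
move=> dF; rewrite /partial -derive_sum; last by move=> k; exact: diff_derivable.
by congr derive; apply/funext => y; rewrite fct_sumE.
Qed.

Lemma differentiable_sumr m (F : 'I_m -> 'rV[R]_n -> R) w :
  (forall k, differentiable (F k) w) ->
  differentiable (fun y => \sum_k F k y) w.
Proof.
move=> dF; rewrite (_ : (fun y => _) = \sum_k F k).
  exact: differentiable_sum.
by apply/funext => y; rewrite fct_sumE.
Qed.

Lemma differentiable_coord0 (k : 'I_n) w : differentiable (fun y : 'rV[R]_n => y 0 k) w.
Proof. exact: differentiable_coord. Qed.

Lemma partial_coord i (k : 'I_n) w : partial i (fun y : 'rV[R]_n => y 0 k) w = (i == k)%:R.
Proof.
have /matrixP /(_ 0 k) := @derive_id _ _ w (delta_mx 0 i : 'rV[R]_n).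
by rewrite derive_mx ?mxE ?eqxx 1?eq_sym; [|exact: derivable_id].
Qed.

Lemma near_eq_partial i f g w : (\forall y \near w, f y = g y) ->
  partial i f w = partial i g w.
Proof.
move=> fg; apply: near_eq_derive => //.
Qed.

Lemma derive_dot_grad f w v : differentiable f w ->
  'D_v f w = dot v (grad f w).
Proof.
move=> df; rewrite deriveE // {1}(row_sum_delta v) linear_sum.
apply: eq_bigr => i _; rewrite linearZ /= mxE -deriveE //.
Qed.

Lemma differentiable_dotr v w : differentiable (fun y : 'rV[R]_n => dot y v) w.
Proof.
apply: differentiable_sumr => k; apply: differentiableM => //.
exact: differentiable_coord0.
Qed.

Lemma partial_dotr i v w : partial i (fun y : 'rV[R]_n => dot y v) w = v 0 i.
Proof.
rewrite /dot partial_sum.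
  rewrite (bigD1 i) //= partialM //; last exact: differentiable_coord0.
  rewrite partial_coord eqxx partial_cst mulr0 add0r mulr1 big1 ?addr0 // => k ki.
  rewrite partialM //; last exact: differentiable_coord0.
  by rewrite partial_coord partial_cst eq_sym (negPf ki) !mulr0 addr0.
by move=> k; apply: differentiableM => //; exact: differentiable_coord0.
Qed.

(** Differentiability serves the chain and product rules, continuity of the partials their
    integration. Nothing is said of second derivatives, which is why [C1_0 (angular i j g)] recurs
    as a separate hypothesis. *)
Definition C1_0 g := forall w : 'rV[R]_n, w != 0 ->
  differentiable g w /\ forall i, {for w, continuous (partial i g)}.

Lemma C1_0_intro g : (forall w : 'rV[R]_n, w != 0 -> differentiable g w) ->
  (forall i (w : 'rV[R]_n), w != 0 -> {for w, continuous (partial i g)}) -> C1_0 g.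
Proof. by move=> dg cg w w0; split => [|i]; [exact: dg | exact: cg]. Qed.

Lemma C1_0_diff g w : C1_0 g -> w != 0 -> differentiable g w.
Proof. by move=> cg w0; have [] := cg w w0. Qed.

Lemma C1_0_cont g : C1_0 g -> cont0 g.
Proof. by move=> cg w w0; apply: differentiable_continuous; exact: C1_0_diff. Qed.

Lemma C1_0_partial g i : C1_0 g -> cont0 (partial i g).
Proof. by move=> cg w w0; have [_] := cg w w0; apply. Qed.

(** The formulas for derivatives of sums and products hold only off the origin, so continuity has to
    be transferred between functions that may differ at 0. *)
Lemma cont0_near (g h : 'rV[R]_n -> R) : (forall w, w != 0 -> g w = h w) ->
  cont0 g -> cont0 h.
Proof.
move=> gh cg w w0; have := cg w w0; rewrite /prop_for /continuous_at -gh //.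
apply: cvg_trans; apply: (@near_eq_cvg _ _ (nbhs w)).
near=> y; apply: gh; near: y; exact: near_neq0.
Unshelve. all: by end_near.
Qed.

Lemma C1_0D f g : C1_0 f -> C1_0 g -> C1_0 (fun y => f y + g y).
Proof.
move=> cf cg w w0; split; first by apply: differentiableD; exact: C1_0_diff.
move=> i; move: w w0; apply: (cont0_near (g := fun y => partial i f y + partial i g y)).
  by move=> y y0; rewrite partialD //; exact: C1_0_diff.
by apply: cont0D; exact: C1_0_partial.
Qed.

Lemma C1_0M f g : C1_0 f -> C1_0 g -> C1_0 (fun y => f y * g y).
Proof.
move=> cf cg w w0; split; first by apply: differentiableM; exact: C1_0_diff.
move=> i; move: w w0.
apply: (cont0_near (g := fun y => f y * partial i g y + g y * partial i f y)).
  by move=> y y0; rewrite partialM //; exact: C1_0_diff.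
by apply: cont0D; apply: cont0M; solve [exact: C1_0_partial | exact: C1_0_cont].
Qed.

Lemma C1_0_cst (c : R) : C1_0 (fun=> c).
Proof.
move=> w w0; split; first exact: differentiable_cst.
move=> i; move: w w0; apply: (cont0_near (g := fun=> 0)).
  by move=> y y0; rewrite partial_cst.
exact: cont0_cst.
Qed.

Lemma C1_0Z (c : R) g : C1_0 g -> C1_0 (fun y => c * g y).
Proof. by move=> cg; apply: C1_0M => //; exact: C1_0_cst. Qed.

Lemma C1_0N g : C1_0 g -> C1_0 (fun y => - g y).
Proof.
move=> cg; rewrite (_ : (fun y => _) = fun y => -1 * g y); first exact: C1_0Z.
by apply/funext => y; rewrite mulN1r.
Qed.

Lemma C1_0B f g : C1_0 f -> C1_0 g -> C1_0 (fun y => f y - g y).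
Proof. by move=> cf cg; exact: (C1_0D cf (C1_0N cg)). Qed.

Lemma C1_0X k g : C1_0 g -> C1_0 (fun y => g y ^+ k).
Proof.
move=> cg; elim: k => [|k IH]; first exact: C1_0_cst.
rewrite (_ : (fun y => _) = fun y => g y * g y ^+ k); first exact: C1_0M.
by apply/funext => y; rewrite exprS.
Qed.

Lemma C1_0_coord (k : 'I_n) : C1_0 (fun y => y 0 k).
Proof.
move=> w w0; split; first exact: differentiable_coord0.
move=> i; move: w w0; apply: (cont0_near (g := fun=> (i == k)%:R)).
  by move=> y y0; rewrite partial_coord.
exact: cont0_cst.
Qed.

Lemma C1_0_dotr v : C1_0 (fun y => dot y v).
Proof.
move=> w w0; split; first exact: differentiable_dotr.
move=> i; move: w w0; apply: (cont0_near (g := fun=> v 0 i)).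
  by move=> y y0; rewrite partial_dotr.
exact: cont0_cst.
Qed.

(* The generator of the rotations in the (i, j) coordinate plane. *)
Definition angular i j g w : R :=
  w 0 i * partial j g w - w 0 j * partial i g w.

Lemma angularE i j g w :
  angular i j g w = w 0 i * partial j g w - w 0 j * partial i g w.
Proof. by []. Qed.

Lemma cont0_angular i j g : C1_0 g -> cont0 (angular i j g).
Proof.
by move=> cg; apply: cont0B; apply: cont0M;
  solve [exact: cont0_coord | exact: C1_0_partial].
Qed.

(* Twice the Laplace-Beltrami operator. *)
Definition angular2 g w : R := \sum_i \sum_j angular i j (angular i j g) w.

Lemma angular2E g w : angular2 g w = \sum_i \sum_j angular i j (angular i j g) w.
Proof. by []. Qed.

Lemma cont0_angular2 g : (forall i j, C1_0 (angular i j g)) ->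
  cont0 (angular2 g).
Proof.
by move=> cg; do 2![apply: cont0_sum => ?]; exact: cont0_angular.
Qed.

Lemma angularM i j f g w : differentiable f w -> differentiable g w ->
  angular i j (fun y => f y * g y) w =
  f w * angular i j g w + g w * angular i j f w.
Proof.
move=> df dg; rewrite /angular !partialM //.
move: (w 0 i) (w 0 j) (f w) (g w) (partial i f w) (partial j f w)
  (partial i g w) (partial j g w) => *; ring.
Qed.

Lemma angularD i j f g w : differentiable f w -> differentiable g w ->
  angular i j (fun y => f y + g y) w = angular i j f w + angular i j g w.
Proof.
by move=> df dg; rewrite /angular !partialD // !mulrDr opprD addrACA.
Qed.

Lemma angularZ i j (c : R) g w : differentiable g w ->
  angular i j (fun y => c * g y) w = c * angular i j g w.
Proof.
move=> dg; rewrite angularM //.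
by rewrite /angular !partial_cst !mulr0 subr0 mulr0 addr0.
Qed.

End partial_calculus.

(** * Rotations in a coordinate plane and their generator *)

Section rotations.
Context {R : realType} {n : nat}.
Implicit Types (g : 'rV[R]_n -> R) (w : 'rV[R]_n) (i j k : 'I_n).

(** The rotation of angle t in the (i, j) plane, written as a perturbation of the identity so that
    one formula with Kronecker deltas covers all coordinates. For i = j it is not orthogonal, hence
    the condition [i != j] below. *)
Definition rotmx i j (t : R) : 'M[R]_n :=
  1%:M + (cos t - 1) *: (delta_mx i i + delta_mx j j)
       + sin t *: (delta_mx i j - delta_mx j i).

Lemma mulmx_rotmxE i j t w k : (w *m rotmx i j t) 0 k =
  w 0 k + (cos t - 1) * (w 0 i * (k == i)%:R + w 0 j * (k == j)%:R)
        + sin t * (w 0 i * (k == j)%:R - w 0 j * (k == i)%:R).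
Proof.
have h a b : (w *m delta_mx a b) 0 k = w 0 a * (k == b)%:R.
  rewrite mxE (bigD1 a) //= big1 ?addr0 => [|c ca]; first by rewrite mxE eqxx.
  by rewrite mxE (negPf ca) mulr0.
rewrite /rotmx !mulmxDr mulmx1 -!scalemxAr !mulmxDr mulmxN.
by rewrite !mxE -!h !mxE.
Qed.

Lemma rotmx0 i j : rotmx i j 0 = 1%:M.
Proof. by rewrite /rotmx cos0 sin0 subrr !scale0r !addr0. Qed.

(** It is enough that [dot] be preserved, tested on basis vectors. Only the coordinates i and j
    change, and there cos^2 + sin^2 = 1 concludes. *)
Lemma rotmx_orthogonal i j t : i != j -> rotmx i j t *m (rotmx i j t)^T = 1%:M.
Proof.
move=> ij; have ji : j != i by rewrite eq_sym.
have dot_rot u v : dot (u *m rotmx i j t) (v *m rotmx i j t) = dot u v.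
  rewrite /dot (bigD1 i) //= (bigD1 j) //= [RHS](bigD1 i) //= [in RHS](bigD1 j) //=.
  rewrite !addrA; congr (_ + _); last first.
    apply: eq_bigr => k /andP[ki kj]; rewrite !mulmx_rotmxE.
    by rewrite (negPf ki) (negPf kj) !mulr0 addr0 subr0 !mulr0 !addr0.
  rewrite !mulmx_rotmxE !eqxx (negPf ij) (negPf ji) !mulr0 !mulr1 !addr0 !add0r.
  rewrite !subr0.
  transitivity ((u 0 i * v 0 i + u 0 j * v 0 j) * (cos t ^+ 2 + sin t ^+ 2)).
    by move: (cos t) (sin t) (u 0 i) (u 0 j) (v 0 i) (v 0 j) => *; ring.
  by rewrite cos2Dsin2 mulr1.
apply/matrixP => a b.
transitivity (dot ('e_a *m rotmx i j t) ('e_b *m rotmx i j t)).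
  by rewrite -!rowE mxE; apply: eq_bigr => k _; rewrite !mxE.
rewrite dot_rot mxE /dot (bigD1 a) //= big1 ?addr0 => [|k ka].
  by rewrite !mxE !eqxx mul1r.
by rewrite !mxE (negPf ka) andbF mul0r.
Qed.

(** The velocity of the orbit at angle t is the generating field taken at the rotated point: its
    coordinate j moves at the speed of coordinate i, its coordinate i at minus the speed of
    coordinate j, in the sense of their current values. The chain rule then produces [angular]. *)
Lemma derive_rotation i j g w t : i != j -> C1_0 g -> w *m rotmx i j t != 0 ->
  is_derive t 1 (fun s => g (w *m rotmx i j s)) (angular i j g (w *m rotmx i j t)).
Proof.
move=> ij cg wt0; pose c (s : R) := w *m rotmx i j s.
have cE k : is_derive t 1 (fun s => c s 0 k)
    (- sin t * (w 0 i * (k == i)%:R + w 0 j * (k == j)%:R)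
     + cos t * (w 0 i * (k == j)%:R - w 0 j * (k == i)%:R)).
  rewrite /c; under eq_fun do rewrite mulmx_rotmxE.
  apply: is_derive_eq.
  rewrite !scaler0 !add0r subr0 /GRing.scale /=.
move: (cos t) (sin t) (w 0 i) (w 0 j) (_ == _)%:R (_ == _)%:R => *; ring.
have dc : differentiable c t.
  by apply/derivable1_diffP/derivable_mxP => a k; rewrite ord1; case: (cE k).
have dg : differentiable g (c t) := C1_0_diff cg wt0.
split; first by apply/derivable1_diffP/differentiable_comp.
rewrite deriveE; last exact: differentiable_comp.
rewrite diff_comp //= -deriveE // -deriveE // derive_dot_grad //.
have cder k : ('D_1 c t) 0 k = 'D_1 (fun s => c s 0 k) t.
  by rewrite derive_mx ?mxE //; apply/derivable_mxP => a l; rewrite ord1; case: (cE l).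
(* Only coordinates i and j have nonzero velocity. *)
rewrite /dot (bigD1 i) //= (bigD1 j) 1?eq_sym //= big1 ?addr0 => [|k /andP[ki kj]]; last first.
  by rewrite cder (@derive_val _ _ _ _ _ _ _ (cE k)) (negPf ki) (negPf kj) !mulr0 addr0 subr0 !mulr0 addr0 mul0r.
rewrite !cder !(@derive_val _ _ _ _ _ _ _ (cE _)) !mxE /angular !mulmx_rotmxE !eqxx.
rewrite [j == i]eq_sym (negPf ij) !(mulr0, mulr1, addr0, add0r, subr0).
move: (w 0 i) (w 0 j) (cos t) (sin t) (partial i _ _) (partial j _ _) => *; ring.
Qed.

End rotations.

Lemma MVT_cc (R : realType) (f df : R -> R) (a b : R) : a < b ->
  (forall x, x \in `[a, b]%R -> is_derive x 1 f (df x)) ->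
  exists2 c, c \in `]a, b[%R & f b - f a = df c * (b - a).
Proof.
move=> ab fd.
have fd' x : x \in `]a, b[%R -> is_derive x 1 f (df x).
  by move=> xab; apply: fd; exact: subset_itv_oo_cc.
have cf : {within `[a, b], continuous f}.
  by apply: derivable_within_continuous => x /fd; case.
by have [c cab ->] := MVT ab fd' cf; exists c.
Qed.

(** * Integration by parts on the sphere *)

Section angular_mean.
Context {R : realType} {n : nat} (sigma : probability (rVborel R n) R).
Hypothesis sigma_uniform : uniform_on_sphere sigma.
Implicit Types (g : 'rV[R]_n -> R) (w : 'rV[R]_n) (i j k : 'I_n).

Lemma rotmx_neq0 i j t w : i != j -> w != 0 -> w *m rotmx i j t != 0.
Proof.
move=> ij; apply: contra_neq => wO; apply/eqP; rewrite -dot_eq0.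
by rewrite -(dot_mulmx w w (rotmx_orthogonal t ij)) wO dot0r.
Qed.

Lemma rotmx_continuous i j :
  continuous (fun q : R * 'rV[R]_n => q.2 *m rotmx i j q.1).
Proof.
move=> q; apply: rV_continuous => k.
rewrite (_ : (fun y => _) = fun y : R * 'rV[R]_n => y.2 0 k
    + (cos y.1 - 1) * (y.2 0 i * (k == i)%:R + y.2 0 j * (k == j)%:R)
    + sin y.1 * (y.2 0 i * (k == j)%:R - y.2 0 j * (k == i)%:R)); last first.
  by apply/funext => y; rewrite mulmx_rotmxE.
have c2 l : {for q, continuous (fun y : R * 'rV[R]_n => y.2 0 l)}.
  apply: (@continuous_comp _ _ _ snd (fun w : 'rV[R]_n => w 0 l)).
    exact: cvg_snd.
  exact: coord_continuous.
have c1 (f : R -> R) : continuous f ->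
    {for q, continuous (fun y : R * 'rV[R]_n => f y.1)}.
  move=> cf; apply: (@continuous_comp _ _ _ fst f); first exact: cvg_fst.
  exact: cf.
have cc := c1 _ (@continuous_cos R); have cs := c1 _ (@continuous_sin R).
have cst_c (c : R) : {for q, continuous (fun=> c)} by exact: cst_continuous.
have c2M l c : {for q, continuous (fun y : R * 'rV[R]_n => y.2 0 l * c)}.
  by apply: continuousM; [exact: c2 | exact: cst_c].
apply: continuousD; last first.
  by apply: continuousM; [exact: cs | apply: continuousB; exact: c2M].
apply: continuousD; first exact: c2.
apply: continuousM; last by apply: continuousD; exact: c2M.
by apply: continuousB; [exact: cc | exact: cst_c].
Qed.

(* The measure is invariant under the rotations in the (i, j) plane; this is
   the derivative of that invariance at the identity. *)
Lemma mean_angular0 i j g : C1_0 g -> mean sigma (angular i j g) = 0.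
Proof.
move=> cg; have [->|ij] := eqVneq i j.
  rewrite -[RHS](mean_cst sigma_uniform); apply: eq_mean => w _.
  by rewrite /angular subrr.
pose H (t : R) (w : 'rV[R]_n) := angular i j g (w *m rotmx i j t).
have H0 w : H 0 w = angular i j g w by rewrite /H rotmx0 mulmx1.
have cH w : sphere w -> {for (0, w), continuous (fun q => H q.1 q.2)}.
  move=> wS; apply: (@continuous_comp _ _ _ (fun q : R * 'rV[R]_n => q.2 *m rotmx i j q.1)).
    exact: rotmx_continuous.
  by apply: cont0_angular => //=; exact/rotmx_neq0/sphere_neq0.
(* Over a small angle t, [g (w *m rotmx i j t) - g w] equals [t * angular i j g w] up to t e,
   uniformly in w. The difference has mean 0 by invariance, so the mean of [angular i j g] is at
   most e in absolute value. *)
suff small e : 0 < e -> `|mean sigma (angular i j g)| <= e.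
  apply/eqP; rewrite -normr_le0 leNgt; apply/negP => m0.
  by have := small _ (divr_gt0 m0 (ltr0Sn R 1)); lra.
move=> e0.
have [d /= d0 Hd] := uniform_continuity_on_sphere cH e0.
pose t := d / 2; have t0 : 0 < t by rewrite divr_gt0.
have diff_bound w : sphere w ->
    `|g (w *m rotmx i j t) - g w - t * angular i j g w| <= t * e.
  move=> wS; have w0 := sphere_neq0 wS.
  have [s s0t] := MVT_cc t0 (fun s _ => derive_rotation ij cg (rotmx_neq0 s ij w0)).
  rewrite rotmx0 mulmx1 => ->.
  rewrite subr0 mulrC -mulrBr normrM gtr0_norm // ler_pM2l //.
  have s_d : `|0 - s| < d.
    move: s0t; rewrite in_itv /= => /andP[s_gt0 st].
    rewrite sub0r normrN gtr0_norm //; apply: lt_trans st _.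
    by rewrite /t ltr_pdivrMr // ltr_pMr // ltr1n.
  by apply: ltW; have := Hd s s_d w wS; rewrite H0.
have cgt : cont0 (fun w => g (w *m rotmx i j t)).
  move=> w w0; apply: continuous_comp; first exact: mulmx_rV_continuous.
  by apply: (C1_0_cont cg); exact: rotmx_neq0.
have cgg := C1_0_cont cg; have ca := @cont0_angular _ _ i j _ cg.
have := mean_norm_le sigma_uniform (cont0B (cont0B cgt cgg) (@cont0Z _ _ t _ ca)) diff_bound.
rewrite (meanB _ (cont0B cgt cgg) (@cont0Z _ _ t _ ca)) (meanB _ cgt cgg) meanZ //.
rewrite (mean_mulmx sigma_uniform) ?rotmx_orthogonal // subrr sub0r normrN.
by rewrite normrM gtr0_norm // ler_pM2l.
Qed.

(** [angular] is a derivation, and the angular derivative of the product has mean 0. *)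
Lemma mean_angular_parts i j (f g : 'rV[R]_n -> R) : C1_0 f -> C1_0 g ->
  mean sigma (fun w => f w * angular i j g w) =
  - mean sigma (fun w => g w * angular i j f w).
Proof.
move=> cf cg; apply/eqP; rewrite -subr_eq0 opprK -meanD; first last.
- by apply: cont0M; [exact: C1_0_cont | exact: cont0_angular].
- by apply: cont0M; [exact: C1_0_cont | exact: cont0_angular].
apply/eqP; rewrite -(@mean_angular0 i j _ (C1_0M cf cg)); apply: eq_mean => w wS.
by rewrite angularM //; apply: C1_0_diff => //; exact: sphere_neq0.
Qed.

End angular_mean.

Local Opaque angular angular2 mean cont0 C1_0.


(** * A bound on the sup norm by the Laplacian, for functions of mean zero *)

Section sup_estimate.
Context {R : realType} {n : nat} (sigma : probability (rVborel R n) R).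
Hypothesis n_ge2 : (2 <= n)%N.
Hypothesis sigma_uniform : uniform_on_sphere sigma.
Implicit Types (g : 'rV[R]_n -> R) (w a : 'rV[R]_n) (i j k : 'I_n).
Local Notation mean := (mean sigma).

(** One integration by parts on each side leads to the same expression, minus the sum of the means
    of [angular i j f] times [angular i j g]. *)
Lemma mean_mul_angular2 (f g : 'rV[R]_n -> R) : C1_0 f -> C1_0 g ->
  (forall i j, C1_0 (angular i j f)) -> (forall i j, C1_0 (angular i j g)) ->
  mean (fun w => f w * angular2 g w) = mean (fun w => g w * angular2 f w).
Proof.
have mE (u v : 'rV[R]_n -> R) : C1_0 u -> C1_0 v ->
    (forall i j, C1_0 (angular i j v)) ->
    mean (fun w => u w * angular2 v w) =
    \sum_i \sum_j mean (fun w => u w * angular i j (angular i j v) w).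
  move=> cu cv cvv.
  have cuv i j : cont0 (fun w => u w * angular i j (angular i j v) w).
    exact: (cont0M (C1_0_cont cu) (cont0_angular (cvv i j))).
  transitivity (mean (fun w => \sum_i \sum_j u w * angular i j (angular i j v) w)).
    apply: eq_mean => w _; rewrite angular2E mulr_sumr.
    by apply: eq_bigr => i _; rewrite mulr_sumr.
  rewrite mean_sum => [|i]; last by apply: cont0_sum => j; exact: cuv.
  by apply: eq_bigr => i _; rewrite mean_sum // => j; exact: cuv.
move=> cf cg cff cgg; have h1 := mE f g cf cg cgg; have h2 := mE g f cg cf cff.
apply: (etrans h1); apply: (etrans _ (esym h2)).
apply: eq_bigr => i _; apply: eq_bigr => j _.
apply: (etrans (mean_angular_parts sigma_uniform i j cf (cgg i j))).
apply: (etrans _ (esym (mean_angular_parts sigma_uniform i j cg (cff i j)))).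
by apply: (congr1 -%R); apply: eq_mean => w _; rewrite mulrC.
Qed.

Lemma angular_dotr i j a w :
  angular i j (fun y => dot y a) w = w 0 i * a 0 j - w 0 j * a 0 i.
Proof. by rewrite angularE !partial_dotr. Qed.

(** Lagrange's identity, doubled because each pair of indices is counted twice. At unit [w] and [a]
    this is twice the squared tangential gradient of w . a. *)
Lemma sum_sqr_angular_dotr a w : \sum_i \sum_j (w 0 i * a 0 j - w 0 j * a 0 i) ^+ 2
  = 2 * (dot w w * dot a a - dot w a ^+ 2).
Proof.
have dd (u v u' v' : 'rV[R]_n) :
    \sum_i \sum_j (u 0 i * v 0 i) * (u' 0 j * v' 0 j) = dot u v * dot u' v'.
  by rewrite /dot mulr_suml; apply: eq_bigr => i _; rewrite mulr_sumr.
have sum3 (F G H : 'I_n -> 'I_n -> R) :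
    \sum_i \sum_j (F i j + G i j - 2 * H i j) =
    \sum_i \sum_j F i j + \sum_i \sum_j G i j - 2 * \sum_i \sum_j H i j.
  rewrite mulr_sumr -big_split -sumrB; apply: eq_bigr => i _.
  by rewrite mulr_sumr -big_split -sumrB.
transitivity (\sum_i \sum_j ((w 0 i * w 0 i) * (a 0 j * a 0 j)
   + (a 0 i * a 0 i) * (w 0 j * w 0 j)
   - 2 * ((w 0 i * a 0 i) * (w 0 j * a 0 j)))).
  by apply: eq_bigr => i _; apply: eq_bigr => j _;
    move: (w 0 i) (w 0 j) (a 0 i) (a 0 j) => *; ring.
rewrite sum3 !dd.
by move: (dot w w) (dot a a) (dot w a) => *; ring.
Qed.

(** Linear forms restrict to spherical harmonics of degree 1, of eigenvalue 1 - n; the 2 is that of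
    [angular2]. *)
Lemma angular2_dotr a w : angular2 (fun y => dot y a) w = 2 * (1 - n%:R) * dot w a.
Proof.
pose ak (k : 'I_n) : R := a 0 k.
have h i j : angular i j (angular i j (fun y => dot y a)) w =
    ((i == j)%:R * (w 0 i * a 0 j) + (i == j)%:R * (w 0 j * a 0 i))
    - (w 0 i * a 0 i + w 0 j * a 0 j).
  have -> : angular i j (fun y => dot y a) =
      (fun y => y 0 i * ak j - y 0 j * ak i).
    by apply/funext => y; rewrite angular_dotr.
  have dk (k l : 'I_n) : differentiable (fun y : 'rV[R]_n => y 0 k * ak l) w.
    by apply: differentiableM => //; exact: differentiable_coord0.
  rewrite angularE !partialB // !partialM //; try exact: differentiable_coord0.
  rewrite !partial_coord !partial_cst !eqxx [j == i]eq_sym /ak !mulr0 !add0r !mulr1.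
  by move: (w 0 i) (w 0 j) (a 0 i) (a 0 j) (_ == _)%:R => *; ring.
rewrite angular2E; under eq_bigr => i _ do under eq_bigr => j _ do rewrite h.
under eq_bigr => i _.
  rewrite big_split /= sumrN !big_split /=.
  rewrite (bigD1 i) //= eqxx mul1r big1 ?addr0; last first.
    by move=> j ji; rewrite eq_sym (negPf ji) mul0r.
  rewrite [X in _ + X - _](bigD1 i) //= eqxx mul1r big1 ?addr0; last first.
    by move=> j ji; rewrite eq_sym (negPf ji) mul0r.
  rewrite sumr_const card_ord -/(dot w a).
  over.
rewrite big_split /= sumrN !big_split /= sumr_const card_ord sumrMnl.
rewrite -/(dot w a) -[dot w a *+ n]mulr_natr.
by move: (dot w a) (n%:R : R) => *; ring.
Qed.

(** * The zonal densities centred at a point of the sphere *)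

Section kernel.
Variable a : 'rV[R]_n.
Hypothesis aS : sphere a.

(** It vanishes at -a for N > 0 and concentrates at a as N grows. Powers of 1 + w . a are chosen
    because the Laplacian of one of them involves only that power and the preceding one. *)
Definition zonal (N : nat) w : R := (1 + dot w a) ^+ N.

Lemma C1_0_onedot : C1_0 (fun w => 1 + dot w a).
Proof. by apply: C1_0D; [exact: C1_0_cst | exact: C1_0_dotr]. Qed.

Lemma C1_0_zonal N : C1_0 (zonal N).
Proof. exact: C1_0X C1_0_onedot. Qed.

Lemma angular_zonal i j N w : angular i j (zonal N) w =
  N%:R * zonal N.-1 w * angular i j (fun y => dot y a) w.
Proof.
have d1 : differentiable (fun y => 1 + dot y a) w.
  by apply: differentiableD => //; exact: differentiable_dotr.
rewrite !angularE /zonal !partialX // !partialD //; try exact: differentiable_dotr.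
rewrite !partial_cst !add0r !partial_dotr.
move: (_%:R : R) (_ ^+ _) (w 0 i) (w 0 j) (a 0 i) (a 0 j) => *; ring.
Qed.

Lemma C1_0_angular_dotr i j : C1_0 (angular i j (fun y => dot y a)).
Proof.
rewrite (_ : angular _ _ _ = fun w => w 0 i * a 0 j - w 0 j * a 0 i).
  by apply: C1_0B; apply: C1_0M; solve [exact: C1_0_coord | exact: C1_0_cst].
by apply/funext => w; rewrite angular_dotr.
Qed.
(** The chain rule gives a multiple of the Laplacian of w . a plus a multiple of its squared
    gradient 1 - (w . a)^2 = (1 + w . a)(1 - w . a). The first factor restores the power lost by
    differentiation, and w . a = (1 + w . a) - 1 expresses the rest in consecutive powers. *)
Lemma angular2_zonal N w : sphere w -> angular2 (zonal N.+1) w =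
  2 * N.+1%:R * ((2 * N%:R + n%:R - 1) * zonal N w - (N%:R + n%:R - 1) * zonal N.+1 w).
Proof.
move=> wS; have w0 := sphere_neq0 wS.
have h i j : angular i j (angular i j (zonal N.+1)) w =
    N.+1%:R * (zonal N w * angular i j (angular i j (fun y => dot y a)) w
      + N%:R * zonal N.-1 w * (w 0 i * a 0 j - w 0 j * a 0 i) ^+ 2).
  transitivity (angular i j
     (fun y => N.+1%:R * zonal N y * angular i j (fun y => dot y a) y) w).
    rewrite (_ : angular i j (zonal N.+1) = fun y =>
      N.+1%:R * zonal N y * angular i j (fun y => dot y a) y) //.
    by apply/funext => y; rewrite angular_zonal.
  rewrite angularM; last 2 first.
  - by apply: differentiableM => //; exact: (C1_0_diff (C1_0_zonal _) w0).
  - exact: (C1_0_diff (C1_0_angular_dotr i j) w0).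
  rewrite angularZ; last exact: (C1_0_diff (C1_0_zonal _) w0).
  rewrite angular_zonal // angular_dotr.
  by move: (angular _ _ _ w) (zonal N w) (zonal N.-1 w) (w 0 i * _ - _) => *; ring.
rewrite angular2E.
under eq_bigr => i _ do under eq_bigr => j _ do rewrite h.
under eq_bigr => i _ do rewrite -mulr_sumr big_split /= -!mulr_sumr.
rewrite -mulr_sumr big_split /= -!mulr_sumr -angular2E.
rewrite sum_sqr_angular_dotr angular2_dotr.
have /sphereP -> := wS; have /sphereP -> := aS.
(* At N = 0 the truncated predecessor breaks the power identity, but the coefficient N is then 0. *)
have kk : N%:R * zonal N.-1 w * (1 + dot w a) = N%:R * zonal N w.
  by case: N {h} => [|N]; rewrite ?mul0r // /zonal exprSr mulrA.
rewrite [X in _ = 2 * _ * (_ - _ * X)](_ : _ = zonal N w * (1 + dot w a)); last by rewrite /zonal exprSr.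
transitivity (2 * N.+1%:R * (zonal N w * ((1 - n%:R) * dot w a)
   + N%:R * zonal N.-1 w * (1 + dot w a) * (1 - dot w a))).
  by move: (zonal N w) (zonal N.-1 w) (dot w a) (n%:R : R) => *; ring.
rewrite kk.
by move: (zonal N w) (dot w a) (n%:R : R) => *; ring.
Qed.

Lemma C1_0_angular_zonal i j N : C1_0 (angular i j (zonal N)).
Proof.
rewrite (_ : angular i j (zonal N) =
  fun w => N%:R * zonal N.-1 w * angular i j (fun y => dot y a) w).
  apply: (@C1_0M _ _ (fun w => N%:R * zonal N.-1 w)); last exact: C1_0_angular_dotr.
  by apply: C1_0Z; exact: C1_0_zonal.
by apply/funext => w; rewrite angular_zonal.
Qed.

Lemma cont0_zonal N : cont0 (zonal N).
Proof. exact: (C1_0_cont (C1_0_zonal N)). Qed.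

Lemma sphere_dot_le1 w : sphere w -> -1 <= dot w a <= 1.
Proof.
move=> /sphereP wS; move: aS => /sphereP aa.
have := dot_ge0 (w + (-1) *: a); have := dot_ge0 (w + a).
rewrite !dotDl !dotDr !dotZl !dotZr wS aa (dotC a w).
by move: (dot w a) => s h1 h2; apply/andP; split; lra.
Qed.

Lemma zonal_ge0 N w : sphere w -> 0 <= zonal N w.
Proof.
by move=> /sphere_dot_le1 /andP[h _]; rewrite exprn_ge0 // -lerBlDl sub0r.
Qed.

Local Notation I N := (mean (zonal N)).

(** Integrate [angular2_zonal]: a sum of angular derivatives has mean 0. *)
Lemma mean_zonal_rec N : (2 * N%:R + n%:R - 1) * I N = (N%:R + n%:R - 1) * I N.+1.
Proof.
have h : mean (angular2 (zonal N.+1)) = 0.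
  transitivity (mean (fun w => \sum_i \sum_j angular i j (angular i j (zonal N.+1)) w)).
    by apply: eq_mean => w _; rewrite angular2E.
  have ca i j := @cont0_angular _ _ i j _ (C1_0_angular_zonal i j N.+1).
  rewrite mean_sum => [|i]; last exact: (cont0_sum (ca i)).
  rewrite big1 // => i _; rewrite mean_sum // big1 // => j _.
  exact: (mean_angular0 sigma_uniform i j (C1_0_angular_zonal i j N.+1)).
move: h; rewrite (eq_mean _ (@angular2_zonal N)).
rewrite meanZ; last by apply: cont0_BZ; exact: cont0_zonal.
rewrite mean_BZ; try exact: cont0_zonal.
move/eqP; rewrite mulf_eq0 => /orP[|]; last by rewrite subr_eq0 => /eqP.
by rewrite mulf_eq0 !pnatr_eq0.
Qed.

Lemma n2 : 2 <= n%:R :> R. Proof. by rewrite ler_nat. Qed.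

(** By the recurrence, starting from I 0 = 1; both coefficients are positive because n >= 2. *)
Lemma mean_zonal_gt0 N : 0 < I N.
Proof.
elim: N => [|N IH].
  rewrite (@eq_mean _ _ _ _ (fun=> 1)) ?(mean_cst sigma_uniform) //.
have N0 : 0 <= N%:R :> R := ler0n _ _; have := n2.
move: (mean_zonal_rec N) IH; move: (I N) (I N.+1) (N%:R : R) N0 (n%:R : R).
move=> x y p p0 m xy x0 m2.
have : 0 < (2 * p + m - 1) * x by apply: mulr_gt0 => //; lra.
by rewrite xy pmulr_rgt0 //; lra.
Qed.

Local Notation A g M := (mean (fun w => zonal M w * g w) / I M).

(** Symmetry moves [angular2] from [g] onto [zonal N.+1], where it yields the powers N and N + 1.
    The recurrence between their masses turns this combination into the difference of the normalized
    averages, times 2 (N + 1)(N + n - 1) I(N + 1); the left side is at most 2 e I(N + 1). *)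
Lemma zonal_average_step g (e : R) N : C1_0 g -> (forall i j, C1_0 (angular i j g)) ->
  (forall w, sphere w -> `|angular2 g w| <= 2 * e) ->
  `|A g N - A g N.+1| <= e / (N.+1%:R * (N%:R + n%:R - 1)).
Proof.
move=> cg cgg ge.
have cA M : cont0 (fun w => zonal M w * g w).
  by apply: cont0M; [exact: cont0_zonal | exact: C1_0_cont cg].
have cAg : cont0 (fun w => zonal N.+1 w * angular2 g w).
  by apply: cont0M; [exact: cont0_zonal | exact: cont0_angular2].
have e1 : mean (fun w => zonal N.+1 w * angular2 g w) =
    2 * N.+1%:R * (N%:R + n%:R - 1) * I N.+1 * (A g N - A g N.+1).
  apply: (etrans (mean_mul_angular2 (C1_0_zonal _) cg (fun i j => C1_0_angular_zonal i j _) cgg)).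
  transitivity (mean (fun w => 2 * N.+1%:R * ((2 * N%:R + n%:R - 1) * (zonal N w * g w)
      - (N%:R + n%:R - 1) * (zonal N.+1 w * g w)))).
    apply: eq_mean => w wS; rewrite angular2_zonal //.
    move: (g w) (zonal _ w) (zonal _ w) (n%:R : R) => *; ring.
  rewrite meanZ; last by apply: cont0_BZ; exact: cA.
  rewrite mean_BZ //.
  have I0 M : I M != 0 by rewrite gt_eqF // mean_zonal_gt0.
  (* The hypothesis relating x and y is the mass recurrence: it makes the two unnormalized
     coefficients equal after division by the masses. *)
  have alg (c x y p m X Y : R) : x != 0 -> y != 0 ->
      (2 * p + m - 1) * x = (p + m - 1) * y ->
      c * ((2 * p + m - 1) * X - (p + m - 1) * Y) =
      c * (p + m - 1) * y * (X / x - Y / y).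
    move=> x0 y0 h; rewrite -{1}(divfK x0 X) -{1}(divfK y0 Y).
    move: (X / x) (Y / y) => u v.
    transitivity (c * (u * ((2 * p + m - 1) * x) - (p + m - 1) * y * v)); first by ring.
    by rewrite h; ring.
  exact: alg (I0 N) (I0 N.+1) (mean_zonal_rec N).
have kle : `|mean (fun w => zonal N.+1 w * angular2 g w)| <= 2 * e * I N.+1.
  have cz : cont0 (zonal N.+1) by exact: cont0_zonal.
  rewrite ler_norml -mulNr -!meanZ //; apply/andP; split; apply: le_mean => //.
  - exact: cont0Z.
  - move=> w wS; rewrite mulrC; apply: ler_wpM2l; first exact: zonal_ge0.
    by have := ge w wS; rewrite ler_norml => /andP[].
  - exact: cont0Z.
  move=> w wS; rewrite mulrC; apply: ler_wpM2r; first exact: zonal_ge0.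
  by have := ge w wS; rewrite ler_norml => /andP[].
have p0 : 0 < N.+1%:R * (N%:R + n%:R - 1) :> R.
  apply: mulr_gt0 => //; rewrite subr_gt0 (lt_le_trans (ltr1n R 2)) //.
  by rewrite (le_trans n2) // lerDr.
rewrite ler_pdivlMr // -(ler_pM2r (mean_zonal_gt0 N.+1)) -(ler_pM2l (ltr0Sn R 1)).
rewrite [leRHS]mulrA; apply: (le_trans _ kle).
rewrite e1 normrM (_ : 2 * _ * _ * _ = 2 * (N.+1%:R * (N%:R + n%:R - 1)) * I N.+1); last first.
  by ring.
rewrite ger0_norm; last first.
  by apply: mulr_ge0; [apply: mulr_ge0 => //; exact: ltW | exact/ltW/mean_zonal_gt0].
by rewrite le_eqVlt; apply/orP; left; apply/eqP; ring.
Qed.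

(** The average at N = 0 is the mean, which is 0; summing the increments gives a telescoping bound,
    and this is the source of the factor 2 in [sup_estimate]. *)
Lemma zonal_average_bound g (e : R) N : C1_0 g ->
  (forall i j, C1_0 (angular i j g)) ->
  (forall w, sphere w -> `|angular2 g w| <= 2 * e) -> mean g = 0 ->
  `|A g N| <= 2 * e * (1 - N.+1%:R^-1).
Proof.
move=> cg cgg ge g0.
have e0 : 0 <= e.
  by have := le_trans (normr_ge0 _) (ge a aS); rewrite pmulr_rge0.
elim: N => [|N IH].
  rewrite invr1 subrr mulr0 (_ : mean _ = 0) ?mul0r ?normr0 //.
  rewrite -g0.
  by apply: eq_mean => w _; rewrite /zonal expr0 mul1r.
rewrite -[A g N.+1](subKr (A g N)) (le_trans (ler_normB _ _)) //.
apply: (le_trans (lerD IH (zonal_average_step N cg cgg ge))).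
have N0 : 0 <= N%:R :> R := ler0n _ _; have m2 := n2.
rewrite -[N.+2%:R]natr1 -[N.+1%:R]natr1; move: (N%:R : R) N0 (n%:R : R) m2 => x x0 m m2.
(* As n >= 2, x + 2 <= 2 (x + n - 1); the new bound is 2 e (1 / (x + 1) - 1 / (x + 2)), which
   telescopes. *)
have le1 : e / ((x + 1) * (x + m - 1)) <= e * (2 / ((x + 1) * (x + 2))).
  apply: ler_wpM2l => //; rewrite ler_pdivlMr; last by apply: mulr_gt0; lra.
  rewrite mulrC ler_pdivrMr; last by apply: mulr_gt0; lra.
  by rewrite mulrCA -subr_ge0 -mulrBr mulr_ge0 //; lra.
apply: (le_trans (lerD (lexx _) le1)).
rewrite le_eqVlt; apply/orP; left; apply/eqP; field.
by apply/andP; split; rewrite gt_eqF //; lra.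
Qed.

(** Since 1 - w . a = 2 - (1 + w . a), only two consecutive masses occur. The value measures
    concentration at a: the mean of 1 - w . a under the normalized density is of order 1 / N. *)
Lemma mean_zonal_one_minus N :
  mean (fun w => zonal N w * (1 - dot w a)) = I N * ((n%:R - 1) / (N%:R + n%:R - 1)).
Proof.
rewrite (@eq_mean _ _ _ _ (fun w => 2 * zonal N w - 1 * zonal N.+1 w)); last first.
  by move=> w _; rewrite /zonal exprSr; move: (_ ^+ _) => *; ring.
rewrite mean_BZ; try exact: cont0_zonal.
have N0 : 0 <= N%:R :> R := ler0n _ _; have m2 := n2.
move: (mean_zonal_rec N); move: (I N) (I N.+1) (N%:R : R) N0 (n%:R : R) m2.
move=> x y p p0 m m2 h; have d0 : p + m - 1 != 0 by rewrite gt_eqF //; lra.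
by apply: (mulfI d0); rewrite mulrBr !mul1r -h mulrC; field.
Qed.

(** A Korovkin-type argument: |g w - g a| is at most d near a by continuity, and elsewhere it is
    dominated by a multiple of 1 - w . a, whose average has just been computed. *)
Lemma zonal_average_cvg g (d : R) : C1_0 g -> 0 < d ->
  exists2 C : R, 0 <= C & forall N, `|A g N - g a| <= d + C / (N%:R + n%:R - 1).
Proof.
move=> cg d0; have a0 := sphere_neq0 aS.
have [M M0 gM] := bounded_cont0 (C1_0_cont cg).
have /cvgrPdist_le/(_ _ d0) := differentiable_continuous (C1_0_diff cg a0).
rewrite nearE => /nbhs_ballP[r /= r0 ball_r].
(* Away from a, 2 (1 - w . a) = |a - w|^2 >= r^2, so this c makes c (1 - w . a) at least 2 M, a
   bound for |g w - g a|. The ball of radius r is one of the sup norm, which the Euclidean norm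
   dominates. *)
pose c := 4 * M / r ^+ 2; have c0 : 0 <= c.
  by apply: divr_ge0; [exact: mulr_ge0 | exact: sqr_ge0].
have gw w : sphere w -> `|g w - g a| <= d + c * (1 - dot w a).
  move=> wS; have /andP[_ s1] := sphere_dot_le1 wS.
  have [war|rwa] := ltP `|a - w| r.
    have : `|g a - g w| <= d by apply: ball_r; rewrite -ball_normE.
    rewrite distrC => /le_trans; apply.
    by rewrite lerDl; apply: mulr_ge0 => //; rewrite subr_ge0.
  have : r ^+ 2 <= 2 * (1 - dot w a).
    have -> : 2 * (1 - dot w a) = enorm (a - w) ^+ 2.
      rewrite enorm_sqr dot_subsqr.
      have /sphereP -> := wS; have /sphereP -> := aS; rewrite (dotC a w); ring.
    rewrite ler_sqr ?nnegrE ?enorm_ge0 ?(ltW r0) //.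
    exact: le_trans rwa (norm_le_enorm _).
  move=> h; apply: (le_trans (ler_normB _ _)).
  apply: (le_trans (lerD (gM w wS) (gM a aS))).
  have r20 : 0 < r ^+ 2 by rewrite exprn_gt0.
  have : 2 * M <= c * (1 - dot w a).
    rewrite /c mulrAC ler_pdivlMr //.
    by have := ler_wpM2l (mulr_ge0 (ler0n R 2) M0) h; lra.
  by lra.
have n1 : 0 <= n%:R - 1 :> R by have := n2; lra.
exists (c * (n%:R - 1)) => [|N]; first exact: mulr_ge0.
have I0 := mean_zonal_gt0 N.
have cz : cont0 (zonal N) by exact: cont0_zonal.
have cgg := C1_0_cont cg.
have czg : cont0 (fun w => zonal N w * g w) by exact: cont0M.
have c1 : cont0 (fun w => zonal N w * (1 - dot w a)).
  by apply: cont0M => //; apply: cont0B; [exact: cont0_cst | exact: cont0_dot].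
have -> : A g N - g a = mean (fun w => 1 * (zonal N w * g w) - g a * zonal N w) / I N.
  by rewrite mean_BZ // mul1r mulrBl mulfK ?gt_eqF.
rewrite normrM [X in _ * X]gtr0_norm ?invr_gt0 // ler_pdivrMr //.
have -> : (d + c * (n%:R - 1) / (N%:R + n%:R - 1)) * I N =
    mean (fun w => d * zonal N w - (- c) * (zonal N w * (1 - dot w a))).
  rewrite mean_BZ // mean_zonal_one_minus.
  by rewrite mulrDl mulNr opprK -!mulrA [I N * _]mulrC !mulrA.
have cdz := @cont0_BZ _ _ d (- c) _ _ cz c1.
rewrite ler_norml -meanN //; apply/andP.
have ineq w : sphere w ->
   `|1 * (zonal N w * g w) - g a * zonal N w| <=
     d * zonal N w - - c * (zonal N w * (1 - dot w a)).
  move=> wS; rewrite mul1r [g a * _]mulrC -mulrBr normrM ger0_norm ?zonal_ge0 //.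
  apply: (le_trans (ler_wpM2l (zonal_ge0 N wS) (gw w wS))).
  by rewrite le_eqVlt; apply/orP; left; apply/eqP; ring.
by split; apply: le_mean => //; try exact: cont0N; try exact: cont0_BZ;
  move=> w /ineq; rewrite ler_norml => /andP[].
Qed.

End kernel.

(* The averages of [g] against the probability densities proportional to
   [(1 + w.a)^N] interpolate between the mean of [g] (N = 0) and [g a]
   (N to infinity); the increment at step N is a weighted mean of the Laplacian
   of [g], divided by N (N + n - 2). *)
Lemma sup_estimate g (e : R) a : C1_0 g -> (forall i j, C1_0 (angular i j g)) ->
  (forall w, sphere w -> `|angular2 g w| <= 2 * e) -> mean g = 0 ->
  sphere a -> `|g a| <= 2 * e.
Proof.
move=> cg cgg ge g0 aS; apply/ler_addgt0Pl => d d0.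
have e0 : 0 <= e.
  by have := le_trans (normr_ge0 _) (ge a aS); rewrite pmulr_rge0.
have [C C0 hC] := zonal_average_cvg aS cg (divr_gt0 d0 (ltr0Sn R 1)).
(* Any N > 2 C / d makes the second error at most d / 2, as N + n - 1 >= N. *)
have [N /andP[_ CN]] : exists N, 0 <= C / (d / 2) < N%:R.
  have [N] := Num.Theory.archi_boundP (divr_ge0 C0 (ltW (divr_gt0 d0 (ltr0Sn R 1)))).
  by exists (Num.bound (C / (d / 2))); apply/andP; split => //; apply: divr_ge0 => //; lra.
have := zonal_average_bound aS N cg cgg ge g0; have := hC N.
set x := mean _ / _ => h1 h2.
have q0 : 0 <= N.+1%:R^-1 :> R by rewrite invr_ge0.
have h3 : `|x| <= 2 * e.
  by apply: (le_trans h2); rewrite -[leRHS]mulr1 ler_wpM2l ?mulr_ge0 // gerBl.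
have h4 : C / (N%:R + n%:R - 1) <= d / 2.
  have := n2; have N0 : 0 <= N%:R :> R := ler0n _ _ => m2.
  rewrite ler_pdivrMr; last by lra.
  have d2 : 0 < d / 2 by rewrite divr_gt0.
  move: CN; rewrite ltr_pdivrMr // mulrC => CN; apply: (le_trans (ltW CN)).
  by rewrite ler_pM2l //; lra.
have -> : g a = x - (x - g a) by ring.
by apply: (le_trans (ler_normB _ _)); lra.
Qed.

End sup_estimate.

(** * Degree-0 functions: Euler's relation, Laplacian and tangential divergence *)

Section homogeneous.
Context {R : realType} {n : nat}.
Implicit Types (g : 'rV[R]_n -> R) (w v : 'rV[R]_n) (i j k : 'I_n).

Definition homogeneous0 g := forall (y : 'rV[R]_n) (c : R), 0 < c -> g (c *: y) = g y.

(** The difference quotient along the ray is 0 as soon as |h| < 1, since then h + 1 > 0. *)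
Lemma derive_radial g w : homogeneous0 g ->
  'D_w g w = 0.
Proof.
move=> hg; apply: cvg_lim => //.
apply: (@cvg_trans _ ((fun=> 0 : R) @ (0 : R)^')); last exact: cvg_cst.
apply: near_eq_cvg; near=> h => /=.
have h1 : 0 < h + 1.
  have : `|h| < 1 by near: h; apply: dnbhs0_lt.
  by rewrite ltr_norml => /andP[h1 _]; rewrite -ltrBlDr sub0r.
by rewrite -[X in h *: w + X]scale1r -scalerDl hg // subrr scaler0.
Unshelve. all: by end_near. Qed.

Lemma euler_homogeneous g w : homogeneous0 g ->
  differentiable g w -> \sum_i w 0 i * partial i g w = 0.
Proof.
move=> hg dg; apply: etrans (derive_radial w hg); rewrite derive_dot_grad //.
by apply: eq_bigr => i _; rewrite mxE.
Qed.

Lemma sum_delta_l (F : 'I_n -> R) i : \sum_j (i == j)%:R * F j = F i.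
Proof.
rewrite (bigD1 i) //= eqxx mul1r big1 ?addr0 // => j ji.
by rewrite eq_sym (negPf ji) mul0r.
Qed.

(** Expanding the squares of the angular fields leaves |w|^2 times the Laplacian, plus terms with
    radial derivatives; the latter vanish by Euler's relation and its first derivatives. *)
Lemma angular2_homogeneous g w : homogeneous0 g ->
  (forall y, y != 0 -> differentiable g y) ->
  (forall i y, y != 0 -> differentiable (partial i g) y) ->
  sphere w -> angular2 g w = 2 * laplacian g w.
Proof.
move=> hg dg dpg wS; have w0 := sphere_neq0 wS.
have dc (k : 'I_n) : differentiable (fun y : 'rV[R]_n => y 0 k) w.
  exact: differentiable_coord0.
have eul := euler_homogeneous hg (dg w w0).
(* Euler's relation differentiated in the direction j; it holds in a neighbourhood of w, so this is
   legitimate. *)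
have eul2 j : \sum_i w 0 i * partial j (partial i g) w = - partial j g w.
  have e : partial j (fun y : 'rV[R]_n => \sum_i y 0 i * partial i g y) w = 0.
    rewrite -[RHS](partial_cst j (0 : R) w); apply: near_eq_partial; near=> y.
    by apply: euler_homogeneous => //; apply: dg; near: y; exact: near_neq0.
  apply/eqP; rewrite -subr_eq0 opprK -[X in _ == X]e partial_sum; last first.
    by move=> i; apply: differentiableM => //; exact: dpg.
  have -> : \sum_i partial j (fun y : 'rV[R]_n => y 0 i * partial i g y) w =
     \sum_i (w 0 i * partial j (partial i g) w + (j == i)%:R * partial i g w).
    apply: eq_bigr => i _; rewrite partialM //; last exact: dpg.
    by rewrite partial_coord [partial i g w * _]mulrC.
  by rewrite big_split /= sum_delta_l.
(* One of the two terms of the square of [angular i j]; by antisymmetry the other one is [F j i], so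
   the double sum doubles. *)
pose F i j := w 0 i * partial j (fun y : 'rV[R]_n => y 0 i * partial j g y - y 0 j * partial i g y) w.
have FE i j : F i j = w 0 i * (w 0 i * partial j (partial j g) w)
    + (j == i)%:R * (w 0 i * partial j g w)
    - w 0 i * partial i g w - w 0 j * (w 0 i * partial j (partial i g) w).
  rewrite /F partialB; try (by apply: differentiableM => //; exact: dpg).
  rewrite !partialM //; try exact: dpg.
  rewrite !partial_coord eqxx mulr1.
  move: (w 0 i) (w 0 j) (partial j g w) (partial i g w) (_ == _)%:R
    (partial j _ w) (partial j _ w) => *; ring.
have sumF : \sum_i \sum_j F i j = laplacian g w.
  have -> : \sum_i \sum_j F i j = \sum_i \sum_j w 0 i * (w 0 i * partial j (partial j g) w)
      + \sum_i \sum_j (j == i)%:R * (w 0 i * partial j g w)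
      - \sum_i \sum_(j < n) w 0 i * partial i g w
      - \sum_i \sum_j w 0 j * (w 0 i * partial j (partial i g) w).
    rewrite -big_split -!sumrB; apply: eq_bigr => i _ /=.
    rewrite -big_split -!sumrB; apply: eq_bigr => j _ /=; exact: FE.
  have key (s1 s2 s3 s4 l : R) : s1 = l -> s2 = 0 -> s3 = 0 -> s4 = 0 ->
    s1 + s2 - s3 - s4 = l by move=> -> -> -> ->; rewrite !subr0 addr0.
  apply: key.
  - have /sphereP := wS; rewrite /dot /laplacian => ww.
    rewrite -[RHS]mul1r -ww mulr_suml; apply: eq_bigr => i _.
    by rewrite mulr_sumr; apply: eq_bigr => j _; rewrite mulrA.
  - apply: etrans eul; apply: eq_bigr => i _.
    rewrite -[RHS](sum_delta_l (fun j => w 0 i * partial j g w)).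
    by apply: eq_bigr => j _; rewrite eq_sym.
  - rewrite exchange_big /= big1 // => j _.
  - rewrite exchange_big /=; apply: etrans (_ : - (\sum_j w 0 j * partial j g w) = 0).
      by rewrite -sumrN; apply: eq_bigr => j _; rewrite -mulr_sumr eul2 mulrN.
    by rewrite eul oppr0.
have e : angular2 g w = \sum_i \sum_j (F i j + F j i).
  rewrite angular2E; apply: eq_bigr => i _; apply: eq_bigr => j _.
  have -> : angular i j g = fun y : 'rV[R]_n => y 0 i * partial j g y - y 0 j * partial i g y.
    by apply/funext => y; rewrite angularE.
  rewrite angularE /F; congr (_ + _); rewrite -mulrN; congr (_ * _).
  rewrite -partialN; first by congr (partial i _ w); apply/funext => y; rewrite opprB.
  by apply: differentiableB; apply: differentiableM => //; exact: dpg.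
have dbl (G : 'I_n -> 'I_n -> R) :
    \sum_i \sum_j (G i j + G j i) = 2 * \sum_i \sum_j G i j.
  under eq_bigr => i _ do rewrite big_split /=.
  by rewrite big_split /= [X in _ + X]exchange_big /= mulrDl mul1r.
by apply: (etrans e); apply: (etrans (dbl F)); apply: (congr1 ( *%R 2)).
Unshelve. all: by end_near. Qed.

Lemma differentiable_sqdot w : differentiable (fun y : 'rV[R]_n => dot y y) w.
Proof.
apply: differentiable_sumr => k.
by apply: differentiableM; exact: differentiable_coord0.
Qed.

Lemma partial_sqdot i w : partial i (fun y : 'rV[R]_n => dot y y) w = 2 * w 0 i.
Proof.
rewrite /dot partial_sum; last first.
  by move=> k; apply: differentiableM; exact: differentiable_coord0.
have -> : \sum_k partial i (fun y : 'rV[R]_n => y 0 k * y 0 k) w =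
    \sum_k (i == k)%:R * (2 * w 0 k).
  apply: eq_bigr => k _; rewrite partialM; try exact: differentiable_coord0.
  by rewrite partial_coord; move: (w 0 k) (_ == _)%:R => *; ring.
by rewrite sum_delta_l.
Qed.

Lemma differentiable_enorm w : w != 0 -> differentiable (@enorm R n) w.
Proof.
move=> w0; apply: differentiable_comp; first exact: differentiable_sqdot.
apply/derivable1_diffP.
have q0 : 0 < dot w w by rewrite lt_neqAle dot_ge0 andbT eq_sym dot_eq0.
by case: (is_derive1_sqrt q0).
Qed.

Lemma partial_enorm i w : sphere w -> partial i (@enorm R n) w = w 0 i.
Proof.
move=> wS; have /sphereP ww := wS.
have q0 : 0 < dot w w by rewrite ww.
have ds : differentiable (@Num.sqrt R) (dot w w).
  by apply/derivable1_diffP; case: (is_derive1_sqrt q0).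
rewrite /partial deriveE; last exact: (differentiable_enorm (sphere_neq0 wS)).
rewrite (diff_comp (differentiable_sqdot w) ds) /=.
have -> : 'd (fun y : 'rV[R]_n => dot y y) w 'e_i = 2 * w 0 i.
  by rewrite -partial_sqdot /partial deriveE //; exact: differentiable_sqdot.
rewrite diff1E // derive1E derive_sqrt // ww sqrtr1 mulr1.
by rewrite /GRing.scale /= mulrAC divff ?mul1r.
Qed.

Lemma differentiable_normalize k w : w != 0 ->
  differentiable (fun y : 'rV[R]_n => normalize y 0 k) w.
Proof.
move=> w0.
rewrite (_ : (fun y => _) = fun y : 'rV[R]_n => (enorm y)^-1 * y 0 k); last first.
  by apply/funext => y; rewrite mxE.
apply: differentiableM; last exact: differentiable_coord0.
by apply: differentiableV; [exact: differentiable_enorm | rewrite enorm_eq0].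
Qed.

(** The differential of the radial projection at a unit vector is the orthogonal projection onto the
    tangent space. *)
Lemma partial_normalize i k w : sphere w ->
  partial i (fun y : 'rV[R]_n => normalize y 0 k) w = (i == k)%:R - w 0 i * w 0 k.
Proof.
move=> wS; have w0 := sphere_neq0 wS.
have dn := differentiable_enorm w0.
have n0 : enorm w != 0 by rewrite enorm_eq0.
rewrite (_ : (fun y => _) = fun y : 'rV[R]_n => (enorm y)^-1 * y 0 k); last first.
  by apply/funext => y; rewrite mxE.
rewrite partialM; [|exact: differentiableV|exact: differentiable_coord0].
rewrite partial_coord {1}/partial deriveV //; last exact: diff_derivable.
rewrite -/(partial i (@enorm R n) w) partial_enorm // wS expr1n invr1 mul1r.
by rewrite scaleN1r mulrN mulrC.
Qed.

(** The degree-0 gradient is already tangent, so projecting [v] does not change its product with it;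
    the projected constant field itself has divergence -(n - 1) w . v. *)
Lemma sdiv_perp (phi : 'rV[R]_n -> R) v w : sphere w ->
  differentiable (phi \o @normalize R n) w ->
  sdiv (fun y => phi y *: perp y v) w =
  dot v (grad (phi \o @normalize R n) w) - (n%:R - 1) * (phi w * dot w v).
Proof.
move=> wS dphi; have w0 := sphere_neq0 wS.
have gw : (phi \o @normalize R n) w = phi w by rewrite /= normalize_id.
set g := phi \o @normalize R n in dphi gw *.
have eul : \sum_i w 0 i * partial i g w = 0.
  apply: euler_homogeneous => // y c c0.
  by rewrite /g /= normalizeZ.
(* The degree-0 extension of w . v, as it appears after composition with [normalize]. *)
pose s (y : 'rV[R]_n) : R := \sum_k v 0 k * normalize y 0 k.
have ds : differentiable s w.
  apply: differentiable_sumr => k; apply: differentiableM => //.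
  exact: differentiable_normalize.
have sw : s w = dot w v.
  by rewrite /s normalize_id // dotC.
have ps i : partial i s w = v 0 i - w 0 i * dot w v.
  rewrite /s partial_sum; last first.
    by move=> k; apply: differentiableM => //; exact: differentiable_normalize.
  rewrite (_ : dot w v = dot v w) /dot; last exact: dotC.
  rewrite -(sum_delta_l (fun k => v 0 k)) mulr_sumr -sumrB; apply: eq_bigr => k _.
  rewrite partialM //; last exact: differentiable_normalize.
  rewrite partial_cst partial_normalize // mulr0 addr0.
  move: (w 0 i) (w 0 k) (v 0 k) (_ == _)%:R => *; ring.
have dN k := differentiable_normalize k w0.
have dvs i : differentiable (fun y => v 0 i - s y * normalize y 0 i) w.
  by apply: differentiableB => //; exact: differentiableM.
rewrite /sdiv /div.
have term i : partial i (fun y => ((fun y => phi y *: perp y v) \o @normalize R n) y 0 i) w =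
   v 0 i * partial i g w - dot w v * (w 0 i * partial i g w)
   - phi w * dot w v * (1 - w 0 i * w 0 i)
   - phi w * (v 0 i * w 0 i - dot w v * (w 0 i * w 0 i)).
  rewrite (_ : (fun y => _) = fun y => g y * (v 0 i - s y * normalize y 0 i)); last first.
    by apply/funext => y; rewrite /g /= /perp !mxE; congr (_ * (_ - _ * _)); rewrite dotC.
  rewrite partialM // partialB //; last exact: differentiableM.
  rewrite partial_cst partialM // ps partial_normalize // eqxx normalize_id // sw gw.
  rewrite -[true%:R]/(1 : R).
  by move: (w 0 i) (v 0 i) (dot w v) (phi w) (partial i g w) => *; ring.
under eq_bigr => i _ do rewrite term.
rewrite !sumrB -!mulr_sumr eul mulr0 subr0 !sumrB sumr_const card_ord -mulr_sumr.
have /sphereP ww := wS; rewrite -/(dot w w) ww -/(dot v w) (dotC v w).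
rewrite [X in X - _ - _](_ : _ = dot v (grad g w)); last first.
  by apply: eq_bigr => i _; rewrite mxE.
by move: (dot _ _) (dot _ _) (phi w) (n%:R : R) => *; ring.
Qed.

(** The right-hand side is that of [sdiv_perp]: the divergence of a projected field is thus a sum of
    angular derivatives, which integrate to 0. *)
Lemma sum_angular_perp g v w : homogeneous0 g ->
  differentiable g w -> sphere w ->
  \sum_i \sum_j angular i j (fun y => g y * (y 0 i * v 0 j)) w =
  dot v (grad g w) - (n%:R - 1) * (g w * dot w v).
Proof.
move=> hg dg wS; have eul := euler_homogeneous hg dg.
have dc (k : 'I_n) : differentiable (fun y : 'rV[R]_n => y 0 k) w.
  exact: differentiable_coord0.
have term i j : angular i j (fun y => g y * (y 0 i * v 0 j)) w =
    (w 0 i * w 0 i) * (v 0 j * partial j g w)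
    - (w 0 j * v 0 j) * (w 0 i * partial i g w)
    + (j == i)%:R * (g w * (w 0 i * v 0 j)) - g w * (w 0 j * v 0 j).
  pose vk (k : 'I_n) : R := v 0 k.
  rewrite angularE -/(vk j) !partialM //; try exact: differentiableM.
  rewrite !partial_cst !partial_coord eqxx /vk !mulr0 !add0r !mulr1.
  move: (w 0 i) (w 0 j) (v 0 j) (g w) (_ == _)%:R (partial _ _ _) (partial _ _ _) => *.
  ring.
have -> : \sum_i \sum_j angular i j (fun y => g y * (y 0 i * v 0 j)) w =
   \sum_i \sum_j (w 0 i * w 0 i) * (v 0 j * partial j g w)
   - \sum_i \sum_j (w 0 j * v 0 j) * (w 0 i * partial i g w)
   + \sum_i \sum_j (j == i)%:R * (g w * (w 0 i * v 0 j))
   - \sum_(i < n) \sum_j g w * (w 0 j * v 0 j).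
  rewrite -!sumrB -big_split -sumrB; apply: eq_bigr => i _ /=.
  rewrite -!sumrB -big_split -sumrB; apply: eq_bigr => j _ /=; exact: term.
have -> : \sum_i \sum_j (w 0 i * w 0 i) * (v 0 j * partial j g w) = dot v (grad g w).
  have /sphereP := wS; rewrite /dot => ww.
  rewrite -[RHS]mul1r -ww mulr_suml; apply: eq_bigr => i _.
  by rewrite mulr_sumr; apply: eq_bigr => j _; rewrite mxE.
have -> : \sum_i \sum_j (w 0 j * v 0 j) * (w 0 i * partial i g w) = 0.
  rewrite exchange_big /= big1 // => j _.
  by rewrite -mulr_sumr eul mulr0.
have -> : \sum_i \sum_j (j == i)%:R * (g w * (w 0 i * v 0 j)) = g w * dot w v.
  rewrite /dot mulr_sumr; apply: eq_bigr => i _.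
  rewrite -[RHS](sum_delta_l (fun j => g w * (w 0 i * v 0 j))).
  by apply: eq_bigr => j _; rewrite eq_sym.
rewrite sumr_const card_ord -mulr_sumr -/(dot w v) -[_ *+ n]mulr_natl.
by move: (dot _ _) (dot _ _) (g w) (n%:R : R) => *; ring.
Qed.

End homogeneous.

(** * Divergence theorem and low-order moments of the uniform measure *)

Section moments.
Context {R : realType} {n : nat} (sigma : probability (rVborel R n) R).
Hypothesis sigma_uniform : uniform_on_sphere sigma.
Implicit Types (g : 'rV[R]_n -> R) (w v : 'rV[R]_n) (i j k : 'I_n).
Local Notation mean := (mean sigma).

Lemma mean_perp0 g v : homogeneous0 g -> C1_0 g ->
  mean (fun w => dot v (grad g w) - (n%:R - 1) * (g w * dot w v)) = 0.
Proof.
move=> hg cg.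
have cgv i j : C1_0 (fun y => g y * (y 0 i * v 0 j)).
  apply: C1_0M; first exact: cg.
  by apply: C1_0M; [exact: C1_0_coord | exact: C1_0_cst].
have ca i j : cont0 (angular i j (fun y => g y * (y 0 i * v 0 j))).
  exact: cont0_angular.
transitivity (mean (fun w => \sum_i \sum_j angular i j (fun y => g y * (y 0 i * v 0 j)) w)).
  apply: eq_mean => w wS; rewrite sum_angular_perp //.
  exact: C1_0_diff (sphere_neq0 wS).
rewrite mean_sum => [|i]; last by apply: cont0_sum => j; exact: ca.
rewrite big1 // => i _; rewrite mean_sum // big1 // => j _.
exact: (mean_angular0 sigma_uniform i j (cgv i j)).
Qed.

Lemma C1_0_angular i j g : C1_0 g -> (forall k, C1_0 (partial k g)) ->
  C1_0 (angular i j g).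
Proof.
move=> cg cpg.
rewrite (_ : angular i j g = fun w => w 0 i * partial j g w - w 0 j * partial i g w).
  by apply: C1_0B; apply: C1_0M; solve [exact: C1_0_coord | exact: cpg].
by apply/funext => w; rewrite angularE.
Qed.

Lemma mean_angular2 g : (forall i j, C1_0 (angular i j g)) ->
  mean (angular2 g) = 0.
Proof.
move=> cgg; have ca i j : cont0 (angular i j (angular i j g)) by exact: cont0_angular.
transitivity (mean (fun w => \sum_i \sum_j angular i j (angular i j g) w)).
  by apply: eq_mean => w _; rewrite angular2E.
rewrite mean_sum => [|i]; last by apply: cont0_sum => j; exact: ca.
rewrite big1 // => i _; rewrite mean_sum // big1 // => j _.
exact: (mean_angular0 sigma_uniform i j (cgg i j)).
Qed.

(** Invariance under the antipodal map. *)
Lemma mean_coord0 i : mean (fun w => w 0 i) = 0.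
Proof.
have cc : cont0 (fun w : 'rV[R]_n => w 0 i) by exact: cont0_coord.
have o1 : (- 1%:M : 'M[R]_n) *m (- 1%:M)^T = 1%:M.
  by rewrite linearN /= trmx1 mulmxN mulNmx opprK mulmx1.
have := mean_mulmx sigma_uniform o1 cc.
rewrite (@eq_mean _ _ _ _ (fun w => - w 0 i)); last first.
  by move=> w _; rewrite mulmxN mulmx1 mxE.
by rewrite meanN // => h; lra.
Qed.

(** All from [mean_angular0]: the angular derivative of w_i^2 is -2 w_i w_j, which kills
    off-diagonal moments; that of w_k w_l is w_k^2 - w_l^2, which equates the diagonal ones. Their
    sum is the mean of |w|^2 = 1. *)
Lemma mean_coord_coord i j : mean (fun w => w 0 i * w 0 j) = (i == j)%:R / n%:R.
Proof.
have dc (k : 'I_n) w : differentiable (fun y : 'rV[R]_n => y 0 k) w.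
  exact: differentiable_coord0.
have cc (k l : 'I_n) : C1_0 (fun w : 'rV[R]_n => w 0 k * w 0 l).
  by apply: C1_0M; exact: C1_0_coord.
have c0c (k l : 'I_n) : cont0 (fun w : 'rV[R]_n => w 0 k * w 0 l).
  exact: C1_0_cont.
have aE (k l p q : 'I_n) (w : 'rV[R]_n) : angular p q (fun y : 'rV[R]_n => y 0 k * y 0 l) w =
   w 0 p * (w 0 k * (q == l)%:R + w 0 l * (q == k)%:R)
   - w 0 q * (w 0 k * (p == l)%:R + w 0 l * (p == k)%:R).
  by rewrite angularE !partialM // !partial_coord.
have [->|ij] := eqVneq i j; last first.
  rewrite mul0r; have := mean_angular0 sigma_uniform i j (cc i i).
  rewrite (@eq_mean _ _ _ _ (fun w => (- 2) * (w 0 i * w 0 j))).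
    by rewrite meanZ // => /eqP; rewrite mulf_eq0 oppr_eq0 pnatr_eq0 => /eqP.
  move=> w _; rewrite aE eqxx [j == i]eq_sym (negPf ij).
  by rewrite -[true%:R]/(1 : R) -[false%:R]/(0 : R); move: (w 0 i) (w 0 j) => *; ring.
have same k l : mean (fun w => w 0 k * w 0 k) = mean (fun w => w 0 l * w 0 l).
  have [->//|kl] := eqVneq k l.
  have := mean_angular0 sigma_uniform k l (cc k l).
  rewrite (@eq_mean _ _ _ _ (fun w => w 0 k * w 0 k - w 0 l * w 0 l)).
    by rewrite meanB // => /eqP; rewrite subr_eq0 => /eqP.
  move=> w _; rewrite aE !eqxx [l == k]eq_sym (negPf kl).
  by rewrite -[true%:R]/(1 : R) -[false%:R]/(0 : R); move: (w 0 k) (w 0 l) => *; ring.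
have : \sum_k mean (fun w => w 0 k * w 0 k) = 1.
  rewrite -mean_sum // -[RHS](mean_cst sigma_uniform).
  by apply: eq_mean => w /sphereP.
under eq_bigr => k _ do rewrite (same k j).
rewrite sumr_const card_ord -[_ *+ n]mulr_natl -[true%:R]/(1 : R) => h.
have n0 : n%:R != 0 :> R.
  by apply/eqP => n0; move: h; rewrite n0 mul0r => /eqP; rewrite eq_sym oner_eq0.
by apply: (mulfI n0); rewrite h mul1r divff.
Qed.

Lemma mean_dot_coord v k : mean (fun w => dot w v * w 0 k) = v 0 k / n%:R.
Proof.
have c0c (i j : 'I_n) : cont0 (fun w : 'rV[R]_n => w 0 i * w 0 j).
  by apply: cont0M; exact: cont0_coord.
transitivity (mean (fun w => \sum_i v 0 i * (w 0 i * w 0 k))).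
  apply: eq_mean => w _; rewrite mulr_suml; apply: eq_bigr => i _.
  by move: (w 0 i) (w 0 k) (v 0 i) => *; ring.
rewrite mean_sum; last by move=> i; exact: cont0Z.
under eq_bigr => i _ do rewrite meanZ // mean_coord_coord.
have e i : v 0 i * ((i == k)%:R / n%:R) = (k == i)%:R * (v 0 i / n%:R).
  by rewrite eq_sym mulrCA.
under eq_bigr => i _ do rewrite e.
exact: (sum_delta_l (fun i => v 0 i / n%:R)).
Qed.

End moments.

(** * Tools on differentials, affine substitutions and [smooth_on] *)

Section differentiability.
Context {R : realType}.

Lemma differentiable_crit (V W : normedModType R) (f : V -> W) (x : V)
    (L : {linear V -> W}) : continuous L ->
  (forall e, 0 < e -> \forall h \near (0 : V), `|f (h + x) - f x - L h| <= e * `|h|) ->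
  differentiable f x /\ 'd f x = L :> (V -> W).
Proof.
move=> cL h.
have fL : f \o shift x = cst (f x) + L +o_ (0 : V) id.
  apply/eqaddoP => e e0; move: (h e e0); apply: filterS => y /= hy.
  by rewrite !fctE /= opprD addrA.
have dL : 'd f x = L :> (V -> W) by exact: diff_unique.
by split => //; apply/diff_locallyP; rewrite dL.
Qed.

Lemma near_eq_differentiable (V W : normedModType R) (f g : V -> W) (x : V) :
  (\forall y \near x, f y = g y) -> differentiable f x -> differentiable g x.
Proof.
move=> fg df; have [cd /eqaddoP hd] := (diff_locallyP x f).1 df.
have [//|] := @differentiable_crit V W g x ('d f x) cd.
move=> e e0; have := hd e e0.
have fgx := nbhs_singleton fg.
have fg0 : \forall h \near (0 : V), f (h + x) = g (h + x).
  rewrite (near_shift x 0); apply: filterS fg => z /=.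
  by rewrite sub0r subrK.
move=> he; near=> h0.
have <- : f (h0 + x) = g (h0 + x) by near: h0.
rewrite -fgx; have : `|(f \o shift x - (cst (f x) + 'd f x)) h0| <= e * `|h0| by near: h0.
by rewrite !fctE /= opprD addrA.
Unshelve. all: by end_near. Qed.

(** Both difference quotients are the same function of h, so no differentiability is involved. This
    identifies derivatives of slices with directional derivatives on the product space. *)
Lemma derive_affine (V V' W : normedModType R) (iota : V' -> V) (F : V -> W)
    (a v : V') (v' : V) :
  (forall h : R, iota (h *: v + a) = h *: v' + iota a) ->
  'D_v (F \o iota) a = 'D_v' F (iota a).
Proof.
move=> hi; rewrite /derive.
rewrite (_ : (fun h : R => h^-1 *: (((F \o iota) \o shift a) (h *: v) - (F \o iota) a)) =
  (fun h : R => h^-1 *: ((F \o shift (iota a)) (h *: v') - F (iota a)))) //.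
by apply/funext => h /=; rewrite hi.
Qed.

Lemma smooth_on_derive (V : normedModType R) (D : set V) (g : V -> R) (v : V) :
  smooth_on D g -> smooth_on D ('D_v g).
Proof.
move=> sg vs p Dp; have := sg (rcons vs v) p Dp.
by rewrite /iter_derive foldr_rcons.
Qed.

Lemma smooth_on_iter (V : normedModType R) (D : set V) (g : V -> R) vs :
  smooth_on D g -> smooth_on D (iter_derive vs g).
Proof.
move=> sg ws p Dp; have := sg (ws ++ vs) p Dp.
by rewrite /iter_derive foldr_cat.
Qed.

Lemma smooth_on_diff (V : normedModType R) (D : set V) (g : V -> R) p :
  smooth_on D g -> D p -> differentiable g p.
Proof. by move=> sg Dp; exact: (sg [::] p Dp). Qed.

(** The formula for iterated derivatives is known on [D] only; openness of [D] allows it to be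
    differentiated again. *)
Lemma smooth_on_lin (V : normedModType R) (D : set V) (f g : V -> R) (a b : R) :
  open D -> smooth_on D f -> smooth_on D g ->
  smooth_on D (fun p => a * f p + b * g p).
Proof.
move=> oD sf sg.
have dfg vs p : D p -> differentiable (fun p => a * iter_derive vs f p + b * iter_derive vs g p) p.
  move=> Dp; apply: differentiableD; apply: differentiableM => //.
    exact: sf.
  exact: sg.
have h vs : forall p, D p -> iter_derive vs (fun p => a * f p + b * g p) p
     = a * iter_derive vs f p + b * iter_derive vs g p.
  elim: vs => [|v vs IH] //= p Dp.
  rewrite (@near_eq_derive _ _ _ _ (fun p => a * iter_derive vs f p + b * iter_derive vs g p)); last first.
    by near=> q; apply: IH; near: q; exact: open_nbhs_nbhs.
  rewrite deriveD; last 2 first.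
  - by apply: diff_derivable; apply: differentiableM => //; exact: sf.
  - by apply: diff_derivable; apply: differentiableM => //; exact: sg.
  by congr (_ + _); apply: deriveZ; apply: diff_derivable; [exact: sf | exact: sg].
move=> vs p Dp; apply: near_eq_differentiable (dfg vs p Dp).
by near=> q; apply/esym/h; near: q; exact: open_nbhs_nbhs.
Unshelve. all: by end_near. Qed.

End differentiability.

(** * Passing between functions of (x, w, t) and their slices *)

Section slices.
Context {R : realType} {n : nat}.
Local Notation E := 'rV[R]_n.
Implicit Types (F : E * E * R -> R) (P : E * R -> R) (U : set (E * R)).
Implicit Types (x w u : E) (t : R).

Definition liftxt (v : E * R) : E * E * R := (v.1, 0, v.2).
(** Linear, hence applied to points and to directions alike. *)
Definition base (q : E * E * R) : E * R := (q.1.1, q.2).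

Lemma derive_slice_w F x w t u :
  'D_u (fun y => F (x, y, t)) w = 'D_((0, u, 0) : E * E * R) F (x, w, t).
Proof.
apply: (@derive_affine R (E * E * R)%type E R (fun y => (x, y, t))) => h.
by congr (_, _, _); rewrite /= ?scaler0 ?mulr0 ?add0r.
Qed.

Lemma partial_slice P x t i :
  partial i (fun y => P (y, t)) x = 'D_(('e_i, 0) : E * R) P (x, t).
Proof.
apply: (@derive_affine R (E * R)%type E R (fun y => (y, t))) => h.
by congr (_, _); rewrite /= ?scaler0 ?mulr0 ?add0r.
Qed.

Lemma derive1_slice P x t :
  derive1 (fun s => P (x, s)) t = 'D_((0, 1) : E * R) P (x, t).
Proof.
rewrite derive1E; apply: (@derive_affine R (E * R)%type R R (fun s => (x, s))) => h.
by congr (_, _); rewrite /= ?scaler0 ?add0r.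
Qed.

Lemma derive_base P (v q : E * E * R) :
  'D_v (P \o base) q = 'D_(base v) P (base q).
Proof. by apply: derive_affine => h; rewrite /base /=. Qed.

Lemma iter_derive_base P vs :
  iter_derive vs (P \o base) = iter_derive (map base vs) P \o base.
Proof.
elim: vs => [|v vs IH] //=; apply/funext => q.
by rewrite IH derive_base.
Qed.

Lemma differentiable_fstE (V W : normedModType R) (p : V * W) :
  differentiable (fst : V * W -> V) p.
Proof. by apply: linear_differentiable => // q; exact: cvg_fst. Qed.

Lemma differentiable_sndE (V W : normedModType R) (p : V * W) :
  differentiable (snd : V * W -> W) p.
Proof. by apply: linear_differentiable => // q; exact: cvg_snd. Qed.

Lemma differentiable_base (q : E * E * R) : differentiable base q.
Proof.
apply: differentiable_pair; last exact: differentiable_sndE.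
by apply: differentiable_comp; exact: differentiable_fstE.
Qed.

Lemma smooth_on_base U P : smooth_on U P ->
  smooth_on (region_punctured U) (P \o base).
Proof.
move=> sP vs q [Uq _]; rewrite iter_derive_base.
apply: differentiable_comp; first exact: differentiable_base.
exact: sP.
Qed.

Lemma differentiable_slice_w F x w t : differentiable F (x, w, t) ->
  differentiable (fun y => F (x, y, t)) w.
Proof.
move=> dF; apply: (@differentiable_comp _ _ _ _ (fun y : E => (x, y, t)) F) => //.
apply: differentiable_pair => //; exact: differentiable_pair.
Qed.

Lemma differentiable_slice_x P x t : differentiable P (x, t) ->
  differentiable (fun y => P (y, t)) x.
Proof.
move=> dP; apply: (@differentiable_comp _ _ _ _ (fun y : E => (y, t)) P) => //.
Qed.

Lemma open_region_punctured U : open U -> open (region_punctured U).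
Proof.
move=> oU; rewrite (_ : region_punctured U =
  base @^-1` U `&` (fun q : E * E * R => q.1.2) @^-1` [set w | w != 0]).
  apply: openI; apply: open_comp => //.
  - by move=> q _; apply: differentiable_continuous; exact: differentiable_base.
  - move=> q _; apply: (@continuous_comp _ _ _ fst snd); last exact: cvg_snd.
    exact: cvg_fst.
  - exact: open_neq0.
by [].
Qed.

Lemma C1_0_slice U F x t : smooth_on (region_punctured U) F -> U (x, t) ->
  C1_0 (fun w => F (x, w, t)).
Proof.
move=> sF Uxt; apply: C1_0_intro => [w w0|i w w0].
  by apply: differentiable_slice_w; exact: smooth_on_diff sF _.
rewrite (_ : partial i _ = fun y => 'D_((0, 'e_i, 0) : E * E * R) F (x, y, t)); last first.
  by apply/funext => y; exact: derive_slice_w.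
apply: differentiable_continuous.
apply: (@differentiable_slice_w ('D_((0, 'e_i, 0) : E * E * R) F)).
by apply: (smooth_on_diff (smooth_on_derive _ sF)); split.
Qed.

Lemma partial_slice_w F x t i : partial i (fun w => F (x, w, t)) =
  fun w => 'D_((0, 'e_i, 0) : E * E * R) F (x, w, t).
Proof. by apply/funext => w; exact: derive_slice_w. Qed.

Lemma C1_0_partial_slice U F x t i : smooth_on (region_punctured U) F -> U (x, t) ->
  C1_0 (partial i (fun w => F (x, w, t))).
Proof.
move=> sF Uxt; rewrite partial_slice_w.
exact: (C1_0_slice (smooth_on_derive _ sF) Uxt).
Qed.

Lemma coord_le_norm x i : `|x 0 i| <= `|x|.
Proof.
rewrite [leRHS]/Num.Def.normr /= mx_normrE.
by apply/bigmax_geP; right; exists (0, i).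
Qed.

Lemma base_decomp (v : E * R) :
  v = \sum_i v.1 0 i *: (('e_i, 0) : E * R) + v.2 *: ((0, 1) : E * R).
Proof.
case: v => x t /=.
have -> : \sum_i x 0 i *: (('e_i, 0) : E * R) = (x, 0).
  rewrite (_ : (x, 0) = (\sum_i x 0 i *: 'e_i, 0)); last by rewrite -row_sum_delta.
  elim: (index_enum _) => [|j s IH]; first by rewrite !big_nil.
  rewrite !big_cons IH; congr (_, _) => /=; by rewrite scaler0 addr0.
congr (_, _) => /=; first by rewrite scaler0 addr0.
by rewrite add0r /GRing.scale /= mulr1.
Qed.

Definition blift (b : option 'I_n) : E * R := if b is Some i then ('e_i, 0) else (0, 1).

Lemma lift_is_linear : linear liftxt.
Proof.
by move=> c u v; congr (_, _, _); rewrite /= scaler0 addr0.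
Qed.

HB.instance Definition _ := GRing.isLinear.Build R (E * R)%type (E * E * R)%type _ liftxt
  lift_is_linear.

(** Reduces all directions in (x, t) to the n + 1 basis ones, [None] standing for time, so that
    estimates uniform in the direction follow from finitely many. *)
Lemma derive_lift F q (v : E * R) : differentiable F q ->
  'D_(liftxt v) F q = \sum_i v.1 0 i * 'D_(liftxt (blift (Some i))) F q
    + v.2 * 'D_(liftxt (blift None)) F q.
Proof.
move=> dF; rewrite deriveE // {1}(base_decomp v) !linearD linear_sum /= linear_sum.
rewrite linearZ /= linearZ /= deriveE //; congr (_ + _).
by apply: eq_bigr => i _; rewrite linearZ /= linearZ /= deriveE.
Qed.

End slices.

(** * Differentiation under the integral over the sphere *)

Section mean_derivative.
Context {R : realType} {n : nat} (sigma : probability (rVborel R n) R).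
Hypothesis sigma_uniform : uniform_on_sphere sigma.
Local Notation E := 'rV[R]_n.
Local Notation mean := (mean sigma).
Variable U : set (E * R).
Hypothesis U_open : open U.
Variable c : E -> R.
Hypothesis cont_c : cont0 c.
Implicit Types (F : E * E * R -> R) (p v : E * R) (w : E).

(** The weight [c] is 1 for the density and a coordinate of w for the flux. *)
Definition avg F p : R := mean (fun w => F (p.1, w, p.2) * c w).

Lemma cont0_slice F p : smooth_on (region_punctured U) F -> U p ->
  cont0 (fun w => F (p.1, w, p.2)).
Proof.
by case: p => x t sF Up; apply: C1_0_cont; exact: C1_0_slice sF Up.
Qed.

Lemma cont0_slice_c F p : smooth_on (region_punctured U) F -> U p ->
  cont0 (fun w => F (p.1, w, p.2) * c w).
Proof. by move=> sF Up; apply: cont0M => //; exact: cont0_slice. Qed.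

Lemma smooth_on_lift F v : smooth_on (region_punctured U) F ->
  smooth_on (region_punctured U) ('D_(liftxt v) F).
Proof. exact: smooth_on_derive. Qed.

Lemma avg_derive_linear F p : smooth_on (region_punctured U) F -> U p ->
  linear (fun v => avg ('D_(liftxt v) F) p).
Proof.
move=> sF Up k u v; rewrite /avg.
have h a : cont0 (fun w => 'D_(liftxt a) F (p.1, w, p.2) * c w).
  exact: cont0_slice_c (smooth_on_lift a sF) Up.
rewrite -[k *: mean _]/(k * mean _) -meanZ // -meanD //; last exact: cont0Z.
apply: eq_mean => w wS.
have dF : differentiable F (p.1, w, p.2).
  apply: (smooth_on_diff sF); split; last exact: (sphere_neq0 wS).
  by case: p Up {h}.
have -> : 'D_(liftxt (k *: u + v)) F (p.1, w, p.2) =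
    k * 'D_(liftxt u) F (p.1, w, p.2) + 'D_(liftxt v) F (p.1, w, p.2).
  rewrite (deriveE (liftxt u) dF) (deriveE (liftxt v) dF) (deriveE (liftxt _) dF).
  by rewrite (lift_is_linear k u v) linearP.
by rewrite mulrDl mulrA.
Qed.

Lemma uniform_derive F p (b : option 'I_n) e : smooth_on (region_punctured U) F ->
  U p -> 0 < e -> \forall q \near p, forall w, sphere w ->
  `|'D_(liftxt (blift b)) F (q.1, w, q.2) - 'D_(liftxt (blift b)) F (p.1, w, p.2)| < e.
Proof.
move=> sF Up e0.
apply: (@uniform_continuity_on_sphere R n (E * R)%type
  (fun q w => 'D_(liftxt (blift b)) F (q.1, w, q.2))) => // w wS.
have dD : differentiable ('D_(liftxt (blift b)) F) (p.1, w, p.2).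
  apply: (smooth_on_diff (smooth_on_lift _ sF)); split; last exact: (sphere_neq0 wS).
  by case: p Up.
(* A permutation of the variables: the compactness lemma wants the parameters first and w last. *)
pose io (q : E * R * E) : E * E * R := (q.1.1, q.2, q.1.2).
have dio : differentiable io (p, w).
  apply: differentiable_pair.
    apply: differentiable_pair; last exact: differentiable_sndE.
    by apply: differentiable_comp; exact: differentiable_fstE.
  apply: (@differentiable_comp _ _ _ _ fst snd); first exact: differentiable_fstE.
  exact: differentiable_sndE.
apply: (@continuous_comp _ _ _ io ('D_(liftxt (blift b)) F)).
  exact: differentiable_continuous.
exact: differentiable_continuous.
Qed.

(** For each w, the mean value theorem along the segment from [p] to [h + p] compares the increment
    of [F] with its derivative at [p]. Continuity of the derivatives is uniform over the sphere, so
    the error stays o(|h|) after averaging. *)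
Lemma differentiable_avg F p : smooth_on (region_punctured U) F -> U p ->
  differentiable (avg F) p /\ forall v, 'D_v (avg F) p = avg ('D_(liftxt v) F) p.
Proof.
move=> sF Up.
pose L0 v := avg ('D_(liftxt v) F) p.
pose L : {linear (E * R)%type -> R} :=
  HB.pack L0 (GRing.isLinear.Build R (E * R)%type R _ L0 (avg_derive_linear sF Up)).
have [M M0 cM] := bounded_cont0 cont_c.
have dF q w : U q -> sphere w -> differentiable F (q.1, w, q.2).
  move=> Uq wS; apply: (smooth_on_diff sF); split; last exact: (sphere_neq0 wS).
  by case: q Uq.
have cL : continuous L.
  move=> v.
  have LE : (L : _ -> _) = fun v : E * R => \sum_i v.1 0 i * L0 (blift (Some i)) + v.2 * L0 (blift None).
    apply/funext => u; rewrite [in LHS](base_decomp u) linearD linear_sum.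
    congr (_ + _); last exact: linearZ.
    by apply: eq_bigr => i _; exact: linearZ.
  suff : {for v, continuous (fun u : E * R => \sum_i u.1 0 i * L0 (blift (Some i)) + u.2 * L0 (blift None))}.
    by rewrite -LE.
  apply: continuousD.
    apply: sumr_continuous => i; apply: continuousM; last exact: cst_continuous.
    apply: (@continuous_comp _ _ _ fst (fun x : E => x 0 i)); first exact: cvg_fst.
    exact: coord_continuous.
  by apply: continuousM; [exact: cvg_snd | exact: cst_continuous].
suff est e : 0 < e -> \forall h \near (0 : E * R),
    `|avg F (h + p) - avg F p - L h| <= e * `|h|.
  have [dP dE] := differentiable_crit cL est; split => // v.
  by rewrite deriveE // dE.
move=> e0.
(* There are n + 1 basis directions, and the weight is bounded by M; M + 1 keeps the denominator
   positive. *)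
pose e1 := e / ((n%:R + 1) * (M + 1)).
have n1 : 0 < n%:R + 1 :> R by rewrite ltr_wpDl.
have M1 : 0 < M + 1 by rewrite ltr_wpDl.
have e10 : 0 < e1 by rewrite divr_gt0 // mulr_gt0.
have nearU : \forall q \near p, U q by exact: open_nbhs_nbhs.
have nearD : \forall q \near p, forall b : option 'I_n, forall w, sphere w ->
  `|'D_(liftxt (blift b)) F (q.1, w, q.2) - 'D_(liftxt (blift b)) F (p.1, w, p.2)| < e1.
  exact: (@filter_forall _ _ (fun (b : option 'I_n) (q : E * R) => forall w, sphere w ->
    `|'D_(liftxt (blift b)) F (q.1, w, q.2) - 'D_(liftxt (blift b)) F (p.1, w, p.2)| < e1)
    (nbhs p) (nbhs_filter p) (fun b => uniform_derive b sF Up e10)).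
have [d /= d0 hd] := (nbhs_ballP p _).1 (filterI nearU nearD).
have dist (s : R) (h : E * R) : 0 <= s <= 1 -> `|h| < d -> ball p d (s *: h + p).
  move=> /andP[s0 s1] hh; rewrite -ball_normE /= opprD addrCA subrr addr0 normrN normrZ.
  rewrite ger0_norm //; apply: le_lt_trans hh; rewrite -[leRHS]mul1r.
  by apply: ler_wpM2r.
apply/(nbhs_ballP (0 : E * R)); exists d => //= h; rewrite -ball_normE /= sub0r normrN => hh.
have Uhp : U (h + p).
  by rewrite -[h]scale1r; apply: (proj1 (hd _ (dist 1 h _ hh))); rewrite ler01 lexx.
have pt w : sphere w -> `|F ((h + p).1, w, (h + p).2) - F (p.1, w, p.2)
     - 'D_(liftxt h) F (p.1, w, p.2)| <= (n%:R + 1) * e1 * `|h|.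
  move=> wS.
  pose q s := s *: h + p.
  pose phi s := F ((q s).1, w, (q s).2).
  have dphi (s : R) : s \in `[0, 1]%R -> is_derive s 1 phi ('D_(liftxt h) F ((q s).1, w, (q s).2)).
    rewrite in_itv /= => s01.
    have dFs := dF _ w (proj1 (hd _ (dist s h s01 hh))) wS.
    have dio : differentiable (fun s : R => ((q s).1, w, (q s).2)) s.
      have dq : differentiable q s by apply: differentiableD.
      have d1 := differentiable_comp dq (differentiable_fstE (q s)).
      have d2 := differentiable_comp dq (differentiable_sndE (q s)).
      by apply: differentiable_pair => //; exact: differentiable_pair.
    split; first by apply/derivable1_diffP; apply: differentiable_comp.
    apply: (@derive_affine R (E * E * R)%type R R (fun s => ((q s).1, w, (q s).2))) => k.
    rewrite /q /liftxt; congr (_, _, _) => /=; rewrite ?scaler0 ?add0r //.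
      by rewrite -[k%:A]/(k * 1) mulr1 scalerDl addrA.
    by rewrite -[k%:A]/(k * 1) mulr1 scalerDl addrA.
  have [s s01] := MVT_cc ltr01 dphi.
  rewrite /phi /q scale1r scale0r add0r subr0 mulr1 => ->.
  have s01' : 0 <= s <= 1 by move: s01; rewrite in_itv /= => /andP[/ltW -> /ltW ->].
  have [Uq Dq] := hd _ (dist s h s01' hh).
  rewrite (derive_lift h (dF _ w Uq wS)) (derive_lift h (dF _ w Up wS)).
  rewrite opprD addrACA -sumrB -mulrBr.
  apply: (le_trans (ler_normD _ _)); rewrite -mulrA mulrDl mul1r.
  have h1 : `|h.1| <= `|h| by rewrite [leRHS]prod_normE le_max lexx.
  have h2 : `|h.2| <= `|h| by rewrite [leRHS]prod_normE le_max lexx orbT.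
  apply: lerD; last first.
    by rewrite normrM mulrC; apply: ler_pM => //; apply/ltW/(Dq None).
  apply: (le_trans (ler_norm_sum _ _ _)).
  rewrite mulr_natl -[X in _ *+ X]card_ord -sumr_const; apply: ler_sum => i _.
  rewrite -mulrBr normrM mulrC; apply: ler_pM => //; first exact/ltW/(Dq (Some i)).
  exact: le_trans (coord_le_norm _ _) h1.
have cF := cont0_slice_c sF Up; have cFh := cont0_slice_c sF Uhp.
have cD := cont0_slice_c (smooth_on_lift h sF) Up.
rewrite /avg /L /= /L0 /avg -meanB // -meanB //; last exact: cont0B.
apply: mean_norm_le => //; first by apply: cont0B => //; exact: cont0B.
move=> w wS; rewrite -!mulrBl normrM.
apply: (le_trans (ler_pM _ _ (pt w wS) (le_trans (cM w wS) (ltW (ltr_pwDr ltr01 (lexx M)))))) => //.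
rewrite mulrAC; apply: ler_wpM2r => //; rewrite /e1 mulrAC mulrCA divff ?mulr1 //.
by rewrite gt_eqF // mulr_gt0.
Qed.

Lemma iter_derive_avg F vs p : smooth_on (region_punctured U) F -> U p ->
  iter_derive vs (avg F) p = avg (iter_derive (map liftxt vs) F) p.
Proof.
move=> sF; elim: vs p => [|v vs IH] p Up //=.
have sG := smooth_on_iter (map liftxt vs) sF.
rewrite -(proj2 (differentiable_avg sG Up)); apply: near_eq_derive.
by near=> q; apply: IH; near: q; exact: open_nbhs_nbhs.
Unshelve. all: by end_near. Qed.

Lemma smooth_on_avg F : smooth_on (region_punctured U) F -> smooth_on U (avg F).
Proof.
move=> sF vs p Up.
apply: near_eq_differentiable (proj1 (differentiable_avg (smooth_on_iter (map liftxt vs) sF) Up)).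
near=> q; apply/esym/iter_derive_avg => //; near: q; exact: open_nbhs_nbhs.
Unshelve. all: by end_near. Qed.

End mean_derivative.

(** * Behaviour of nu and tau at zero, and the value of rhoc *)

Section coefficients.
Context {R : realType}.
Variables (n : nat) (nu tau : R -> R) (rhoc : R).
Hypothesis n_gt0 : (0 < n)%N.
Hypothesis nu_derivable : forall r, derivable nu r 1.
Hypothesis tau_derivable : forall r, derivable tau r 1.
Hypothesis nu_ge0 : forall r, 0 <= r -> 0 <= nu r.
Hypothesis tau_gt0 : forall r, 0 <= r -> 0 < tau r.
Hypothesis nu_slope_lipschitz : [lipschitz nu r / r | r in `]0, +oo[].
Hypothesis nu_slope_bounded : [bounded nu r / r | r in `]0, +oo[].
Hypothesis tau_lipschitz : [lipschitz tau r | r in `[0, +oo[].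
Hypothesis k_increasing :
  forall r s, 0 <= r -> r < s -> nu r / tau r < nu s / tau s.
Hypothesis rhoc_lim : n%:R * r / (nu r / tau r) @[r --> 0^'+] --> rhoc.

Lemma derivable_right_cvg (g : R -> R) : derivable g 0 1 -> g x @[x --> 0^'+] --> g 0.
Proof.
move=> dg; apply: cvg_at_right_filter.
by apply: differentiable_continuous; apply/derivable1_diffP.
Qed.

(** Boundedness of nu(r) / r forces nu to tend to 0 at 0+, and nu is continuous at 0. *)
Lemma nu_0 : nu 0 = 0.
Proof.
have [M [_ hM]] := nu_slope_bounded.
have c0 : nu x @[x --> 0^'+] --> (0 : R).
  apply/cvgrPdist_le => e e0; near=> x.
  have x0 : 0 < x by near: x; exact: nbhs_right_gt.
  have := hM (`|M| + 1) _ x; rewrite (le_lt_trans (ler_norm M)) ?ltrDl // => /(_ isT).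
  rewrite /= in_itv /= x0 /= => /(_ isT).
  rewrite normrM normfV (gtr0_norm x0) ler_pdivrMr // sub0r normrN => h.
  apply: (le_trans h); rewrite mulrC -ler_pdivlMr; last by rewrite ltr_wpDl.
  near: x; apply: nbhs_right_le; rewrite divr_gt0 // ltr_wpDl //.
have dn : derivable nu 0 1 by exact: nu_derivable.
exact: (cvg_unique _ (derivable_right_cvg dn) c0).
Unshelve. all: by end_near. Qed.

Lemma nu_gt0 r : 0 < r -> 0 < nu r.
Proof.
move=> r0; have := k_increasing (lexx 0) r0; rewrite nu_0 mul0r.
by rewrite pmulr_lgt0 // invr_gt0 tau_gt0 // ltW.
Qed.

Lemma slope_cvg : nu r / r @[r --> 0^'+] --> derive1 nu 0.
Proof.
have dn : derivable nu 0 1 by exact: nu_derivable.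
rewrite derive1E.
have : (h^-1 *: (nu (h *: 1 + 0) - nu 0)) @[h --> 0^'+] --> 'D_1 nu 0.
  by apply: cvg_dnbhs_at_right; exact: dn.
apply: cvg_trans; apply: near_eq_cvg; near=> h.
by rewrite nu_0 subr0 addr0 /GRing.scale /= mulr1 mulrC.
Unshelve. all: by end_near. Qed.

(** For r > 0 the product of n r / k(r) and nu(r) / r is n tau(r); pass to the limit. The product
    form is proved first because nu'(0) is only known to be nonzero thanks to it. *)
Lemma rhoc_derive : rhoc * derive1 nu 0 = n%:R * tau 0.
Proof.
have c1 : (n%:R * r / (nu r / tau r)) * (nu r / r) @[r --> 0^'+] --> rhoc * derive1 nu 0.
  exact: cvgM rhoc_lim slope_cvg.
have c2 : n%:R * tau r @[r --> 0^'+] --> n%:R * tau 0.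
  by apply: cvgMr; exact: derivable_right_cvg.
apply: (cvg_unique _ c1) => //.
apply: cvg_trans c2; apply: near_eq_cvg; near=> r.
have r0 : 0 < r by near: r; exact: nbhs_right_gt.
have nr := nu_gt0 r0; have tr := tau_gt0 (ltW r0).
by field; rewrite !gt_eqF.
Unshelve. all: by end_near. Qed.

Lemma derive_nu_gt0 : 0 < derive1 nu 0.
Proof.
have d0 : 0 <= derive1 nu 0.
  apply: (cvgr_to_ge slope_cvg); near=> r.
  have r0 : 0 < r by near: r; exact: nbhs_right_gt.
  by rewrite divr_ge0 ?nu_ge0 // ltW.
rewrite lt_neqAle d0 andbT; apply/eqP => e0; have := rhoc_derive.
rewrite -e0 mulr0 => /eqP; rewrite eq_sym mulf_eq0 pnatr_eq0 => /orP[/eqP n0|].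
  by move: n_gt0; rewrite n0.
by rewrite gt_eqF // tau_gt0.
Unshelve. all: by end_near. Qed.

Lemma rhoc_gt0 : 0 < rhoc.
Proof.
have : 0 < rhoc * derive1 nu 0 by rewrite rhoc_derive mulr_gt0 ?tau_gt0 ?ltr0n.
by rewrite pmulr_lgt0 // derive_nu_gt0.
Qed.

Lemma derive_nuE : derive1 nu 0 = n%:R * tau 0 / rhoc.
Proof. by rewrite -rhoc_derive mulrAC divff ?mul1r // gt_eqF // rhoc_gt0. Qed.

(** The Lipschitz bound between r and s > 0 passes to the limit s -> 0+, where the slope tends to
    nu'(0). *)
Lemma slope_lipschitz0 : exists2 L, 0 <= L &
  forall r, 0 <= r -> `|slope nu r - derive1 nu 0| <= L * r.
Proof.
have [M [_ hM]] := nu_slope_lipschitz.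
have ML : M < `|M| + 1 by rewrite (le_lt_trans (ler_norm M)) ?ltrDl.
exists (`|M| + 1) => [|r]; first by rewrite addr_ge0.
rewrite le_eqVlt => /predU1P[<-|r0].
  by rewrite /slope eqxx subrr normr0 mulr0.
rewrite /slope gt_eqF //.
have c : `|nu r / r - nu s / s| @[s --> 0^'+] --> `|nu r / r - derive1 nu 0|.
  by apply: cvg_norm; apply: cvgB; [exact: cvg_cst | exact: slope_cvg].
apply: (cvgr_to_le c); near=> s.
have s0 : 0 < s by near: s; exact: nbhs_right_gt.
have sr : s <= r by near: s; exact: nbhs_right_le.
have := hM _ ML (r, s); rewrite /= !in_itv /= r0 s0 => /(_ (conj isT isT)) h.
apply: (le_trans h); apply: ler_wpM2l; first by rewrite addr_ge0.
by rewrite ger0_norm ?subr_ge0 // gerBl ltW.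
Unshelve. all: by end_near. Qed.

Lemma tau_lipschitz0 : exists2 L, 0 <= L &
  forall r, 0 <= r -> `|tau r - tau 0| <= L * r.
Proof.
have [M [_ hM]] := tau_lipschitz.
have ML : M < `|M| + 1 by rewrite (le_lt_trans (ler_norm M)) ?ltrDl.
exists (`|M| + 1) => [|r r0]; first by rewrite addr_ge0.
have := hM _ ML (r, 0); rewrite /= !in_itv /= r0 lexx => /(_ (conj isT isT)) h.
by apply: (le_trans h); rewrite subr0 [X in _ * X]ger0_norm.
Qed.

End coefficients.

(** * Calculus of uniform O-estimates *)

Section bigO_calculus.
Context {R : realType} {V : normedModType R}.
Implicit Types (D : set V) (g h : R -> V -> R) (b c : R -> R).

Lemma unifO_near D g h b :
  (\forall e \near 0^'+, forall p, D p -> g e p = h e p) ->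
  unifO D g b -> unifO D h b.
Proof.
move=> gh [C hC]; exists C; near=> e => p Dp.
have <- : g e p = h e p by move: p Dp; near: e.
by move: p Dp; near: e.
Unshelve. all: by end_near. Qed.

Lemma unifO_add D g h b : unifO D g b -> unifO D h b ->
  unifO D (fun e p => g e p + h e p) b.
Proof.
move=> [C hC] [C' hC']; exists (C + C'); near=> e => p Dp.
rewrite mulrDl (le_trans (ler_normD _ _)) // lerD //; move: p Dp; near: e; assumption.
Unshelve. all: by end_near. Qed.

Lemma unifO_opp D g b : unifO D g b -> unifO D (fun e p => - g e p) b.
Proof.
move=> [C hC]; exists C; near=> e => p Dp; rewrite normrN; move: p Dp; near: e.
exact: hC.
Unshelve. all: by end_near. Qed.

Lemma unifO_sub D g h b : unifO D g b -> unifO D h b ->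
  unifO D (fun e p => g e p - h e p) b.
Proof. by move=> hg hh; apply: unifO_add => //; exact: unifO_opp. Qed.

Lemma unifO_mul D g h b c : unifO D g b -> unifO D h c ->
  unifO D (fun e p => g e p * h e p) (fun e => b e * c e).
Proof.
move=> [C hC] [C' hC']; exists (C * C'); near=> e => p Dp.
rewrite normrM mulrACA; apply: ler_pM => //; move: p Dp; near: e; assumption.
Unshelve. all: by end_near. Qed.

Lemma unifO_eq D g b c : (\forall e \near 0^'+, b e = c e) ->
  unifO D g b -> unifO D g c.
Proof.
move=> bc [C hC]; exists C; near=> e => p Dp.
have <- : b e = c e by near: e.
by move: p Dp; near: e.
Unshelve. all: by end_near. Qed.

(** The constant in [unifO] has no prescribed sign, hence the absolute values. *)
Lemma unifO_le D g b c (K : R) : (\forall e \near 0^'+, `|b e| <= K * c e) ->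
  unifO D g b -> unifO D g c.
Proof.
move=> bc [C hC]; exists (`|C| * K); near=> e => p Dp.
have h1 : `|b e| <= K * c e by near: e.
have h2 : `|g e p| <= C * b e by move: p Dp; near: e.
rewrite (le_trans h2) // (le_trans (ler_norm _)) // normrM -mulrA.
by apply: ler_wpM2l.
Unshelve. all: by end_near. Qed.

Lemma unifO_cst D (k : R) : unifO D (fun _ _ => k) (fun=> 1).
Proof. by exists `|k|; near=> e => p Dp; rewrite mulr1. Unshelve. all: by end_near. Qed.

Lemma unifO_fun D b : (\forall e \near 0^'+, 0 <= b e) -> unifO D (fun e _ => b e) b.
Proof.
move=> b0; exists 1; near=> e => p Dp; rewrite mul1r ger0_norm //; near: e; exact: b0.
Unshelve. all: by end_near. Qed.

Lemma unifO_sum D m (G : 'I_m -> R -> V -> R) b :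
  (\forall e \near 0^'+, 0 <= b e) -> (forall i, unifO D (G i) b) ->
  unifO D (fun e p => \sum_i G i e p) b.
Proof.
move=> b0 hG; rewrite (_ : (fun e p => _) = fun e p => \sum_(i <- index_enum 'I_m) G i e p) //.
elim: (index_enum _) => [|i s IH].
  exists 0; near=> e => p Dp; rewrite big_nil normr0 mul0r //.
apply: (@unifO_near _ (fun e p => G i e p + \sum_(j <- s) G j e p)).
  by near=> e => p Dp; rewrite big_cons.
exact: unifO_add.
Unshelve. all: by end_near. Qed.

Lemma unifO_norm_sum D m (G : 'I_m -> R -> V -> R) b :
  (\forall e \near 0^'+, 0 <= b e) -> (forall i, unifO D (G i) b) ->
  unifO D (fun e p => \sum_i `|G i e p|) b.
Proof.
move=> b0 hG; apply: unifO_sum => // i.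
have [C hC] := hG i; exists C; near=> e => p Dp; rewrite normr_id.
by move: p Dp; near: e.
Unshelve. all: by end_near. Qed.

Lemma unifO_bound D g h b : (\forall e \near 0^'+, forall p, D p -> `|g e p| <= `|h e p|) ->
  unifO D h b -> unifO D g b.
Proof.
move=> gh [C hC]; exists C; near=> e => p Dp.
have h1 : `|h e p| <= C * b e by move: p Dp; near: e.
by apply: le_trans h1; move: p Dp; near: e.
Unshelve. all: by end_near. Qed.

Lemma unifO_mul1 D g h b : unifO D g (fun=> 1) -> unifO D h b ->
  unifO D (fun e p => g e p * h e p) b.
Proof.
move=> hg hh; apply: unifO_eq (unifO_mul hg hh).
by near=> e; rewrite mul1r.
Unshelve. all: by end_near. Qed.

Lemma unifO_scale D g b (k : R) : unifO D g b -> unifO D (fun e p => k * g e p) b.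
Proof. exact: unifO_mul1 (unifO_cst D k). Qed.

Lemma near0_gt0 : \forall e \near (0 : R)^'+, 0 < e.
Proof. exact: nbhs_right_gt. Qed.

Lemma near0_ge0 : \forall e \near (0 : R)^'+, 0 <= e.
Proof. by apply: filterS near0_gt0 => e /ltW. Qed.

Lemma unifO_emul D g b : unifO D g b ->
  unifO D (fun e p => e * g e p) (fun e => e * b e).
Proof. by apply: unifO_mul; apply: unifO_fun; exact: near0_ge0. Qed.

Lemma unifO_e1 D g : unifO D g (fun=> 1) -> unifO D (fun e p => e * g e p) id.
Proof.
move=> hg; apply: unifO_eq (unifO_emul hg); by near=> e; rewrite mulr1.
Unshelve. all: by end_near. Qed.

Lemma unifO_id1 D g : unifO D g id -> unifO D g (fun=> 1).
Proof.
apply: (@unifO_le _ _ _ _ 1); near=> e; rewrite mulr1 ger0_norm; last first.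
  by near: e; exact: near0_ge0.
by near: e; exact: nbhs_right_le.
Unshelve. all: by end_near. Qed.

(** g = O(e) is eventually in the neighbourhood of 0 where phi is within 1 of phi 0. It bounds nu'
    and tau' at the flux norm. *)
Lemma unifO_comp D (phi : R -> R) g : {for 0, continuous phi} -> unifO D g id ->
  unifO D (fun e p => phi (g e p)) (fun=> 1).
Proof.
move=> /cvgrPdist_le/(_ _ ltr01) /(nbhs_ballP (0 : R))[d /= d0 hd] [C hC].
exists (`|phi 0| + 1); near=> e => p Dp.
have h : `|g e p| <= C * e by move: p Dp; near: e.
have small : C * e < d.
  apply: (@le_lt_trans _ _ (`|C| * e)); last first.
    apply: (@le_lt_trans _ _ ((`|C| + 1) * e)).
      by rewrite mulrDl lerDl mul1r; near: e; exact: near0_ge0.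
    rewrite mulrC -ltr_pdivlMr ?ltr_wpDl //; near: e.
    by apply: nbhs_right_lt; rewrite divr_gt0 // ltr_wpDl.
  by apply: ler_wpM2r; [near: e; exact: near0_ge0 | exact: ler_norm].
have gd : ball (0 : R) d (g e p).
  by rewrite -ball_normE /= sub0r normrN; exact: le_lt_trans small.
have := hd _ gd; rewrite mulr1 /= => h1.
have -> : phi (g e p) = phi 0 - (phi 0 - phi (g e p)) by ring.
by rewrite (le_trans (ler_normB _ _)) // lerD2l.
Unshelve. all: by end_near. Qed.

End bigO_calculus.

Lemma unifO_pull (R : realType) (V V' : normedModType R) (D : set V) (D' : set V')
    (pi : V' -> V) (g : R -> V -> R) (b : R -> R) :
  (forall p, D' p -> D (pi p)) -> unifO D g b -> unifO D' (fun e p => g e (pi p)) b.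
Proof.
move=> h [C hC]; exists C; near=> e => p Dp.
have : D (pi p) by exact: h.
by move: (pi p); near: e.
Unshelve. all: by end_near. Qed.

(** * Linear combinations, with identities valid off the origin only *)

Section perturbation.
Context {R : realType} {n : nat}.
Implicit Types (f g h : 'rV[R]_n -> R) (w : 'rV[R]_n) (i j k : 'I_n).

Lemma C1_0_near g h : (forall w, w != 0 -> g w = h w) -> C1_0 h -> C1_0 g.
Proof.
move=> gh ch.
have nh w : w != 0 -> \forall y \near w, h y = g y.
  by move=> w0; near=> y; apply/esym/gh; near: y; exact: near_neq0.
apply: C1_0_intro => [w w0|i].
  exact: near_eq_differentiable (nh w w0) (C1_0_diff ch w0).
have cp : cont0 (partial i g).
  have ci : cont0 (partial i h) by exact: C1_0_partial.
  apply: (cont0_near _ ci) => w w0.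
  exact: near_eq_partial (nh w w0).
exact: (proj1 (cont0P _) cp).
Unshelve. all: by end_near. Qed.

Lemma partial_addZ f g (c : R) i w : C1_0 f -> C1_0 g -> w != 0 ->
  partial i (fun y => f y + c * g y) w = partial i f w + c * partial i g w.
Proof.
move=> cf cg w0; have dg := C1_0_diff cg w0.
rewrite partialD; [|exact: C1_0_diff cf w0|exact: differentiableM].
by rewrite partialM // partial_cst mulr0 addr0.
Qed.

Lemma C1_0_partial_addZ f g (c : R) i : C1_0 f -> C1_0 g ->
  C1_0 (partial i f) -> C1_0 (partial i g) -> C1_0 (partial i (fun y => f y + c * g y)).
Proof.
move=> cf cg cpf cpg.
apply: (C1_0_near (h := fun w => partial i f w + c * partial i g w)).
  by move=> w; exact: partial_addZ.
by apply: C1_0D; [exact: cpf | apply: C1_0Z; exact: cpg].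
Qed.

Lemma angular2_addZ f g (c : R) w : C1_0 f -> C1_0 g ->
  (forall i j, C1_0 (angular i j f)) -> (forall i j, C1_0 (angular i j g)) -> w != 0 ->
  angular2 (fun y => f y + c * g y) w = angular2 f w + c * angular2 g w.
Proof.
move=> cf cg cff cgg w0.
have aE u v i j y : C1_0 u -> C1_0 v -> y != 0 ->
    angular i j (fun y => u y + c * v y) y = angular i j u y + c * angular i j v y.
  move=> cu cv y0; have dv := C1_0_diff cv y0.
  rewrite angularD; [|exact: C1_0_diff cu y0|exact: differentiableM].
  by rewrite angularZ.
rewrite !angular2E mulr_sumr -big_split; apply: eq_bigr => i _ /=.
rewrite mulr_sumr -big_split; apply: eq_bigr => j _ /=.
rewrite -(aE _ _ i j w (cff i j) (cgg i j) w0).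
have pE k : partial k (angular i j (fun y => f y + c * g y)) w =
    partial k (fun y => angular i j f y + c * angular i j g y) w.
  apply: near_eq_partial; near=> y.
  by apply: (aE f g i j y cf cg); near: y; exact: near_neq0.
by rewrite (angularE _ _ (angular i j _)) !pE -angularE.
Unshelve. all: by end_near. Qed.

End perturbation.

(** * Exact identities at fixed e *)

Section expansion.
Context {R : realType} {n : nat} (sigma : probability (rVborel R n) R).
Hypothesis n_ge2 : (2 <= n)%N.
Hypothesis sigma_uniform : uniform_on_sphere sigma.
Local Notation E := 'rV[R]_n.
Local Notation mean := (mean sigma).
Variable U : set (E * R).
Hypothesis U_open : open U.
Variables (e : R) (f : E -> E -> R -> R).
Hypothesis e_neq0 : e != 0.
Hypothesis f_smooth : smooth_on (region_punctured U) (deg0 f).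
Implicit Types (x w v : E) (t : R) (i k : 'I_n).

Definition rhof (p : E * R) : R := density sigma f p.1 p.2.
(** Taken as a function on the product space, since the hypothesis on f_1 bounds the derivatives of
    this very extension. *)
Definition corr : E * E * R -> R := deg0 (corrector sigma e f).
Definition cflux k : E * R -> R := avg sigma (fun w => w 0 k) corr.
Definition cfluxv (p : E * R) : E := \row_k cflux k p.

Definition dx i : E * E * R := ('e_i, 0, 0).
Definition dw i : E * E * R := (0, 'e_i, 0).
Definition dt : E * E * R := (0, 0, 1).

Lemma rhofE : rhof = avg sigma (fun=> 1) (deg0 f).
Proof.
apply/funext => p; rewrite /rhof densityE; apply: eq_mean => w wS.
by rewrite /deg0 /= normalize_id // mulr1.
Qed.

Lemma smooth_rhof : smooth_on U rhof.
Proof.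
rewrite rhofE; apply: smooth_on_avg => //; exact: cont0_cst.
Qed.

Lemma corrE q : corr q = e^-1 * deg0 f q + (- e^-1) * (rhof \o base) q.
Proof. by rewrite /corr /deg0 /corrector /rhof /base /= mulNr -mulrBr mulrC. Qed.

Lemma deg0E q : deg0 f q = rhof (base q) + e * corr q.
Proof. by rewrite corrE /=; field. Qed.

Lemma smooth_corr : smooth_on (region_punctured U) corr.
Proof.
rewrite (_ : corr = fun q => e^-1 * deg0 f q + (- e^-1) * (rhof \o base) q).
  apply: smooth_on_lin => //; first exact: open_region_punctured.
  exact/smooth_on_base/smooth_rhof.
by apply/funext => q; rewrite corrE.
Qed.

Lemma smooth_cflux k : smooth_on U (cflux k).
Proof.
apply: smooth_on_avg => //; [exact: cont0_coord | exact: smooth_corr].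
Qed.

Lemma f_sphereE x w t : sphere w -> f x w t = rhof (x, t) + e * corr (x, w, t).
Proof.
by move=> wS; rewrite -[rhof _]/(rhof (base (x, w, t))) -deg0E /deg0 /= normalize_id.
Qed.

Lemma cont0_corr x t : U (x, t) -> cont0 (fun w => corr (x, w, t)).
Proof. by move=> Uxt; apply: C1_0_cont; exact: C1_0_slice smooth_corr Uxt. Qed.

Lemma mean_corr x t : U (x, t) -> mean (fun w => corr (x, w, t)) = 0.
Proof.
move=> Uxt; apply: (mulfI e_neq0); rewrite mulr0 -meanZ; last exact: cont0_corr.
apply: (addrI (rhof (x, t))); rewrite addr0.
rewrite -{1}(mean_cst sigma_uniform (rhof (x, t))) -meanD; last 2 first.
- exact: cont0_cst.
- exact/cont0Z/cont0_corr.
by rewrite /rhof densityE; apply: eq_mean => w wS; rewrite [in RHS]f_sphereE.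
Qed.

(** The part [rhof], constant in w, has no flux because w has mean 0. *)
Lemma flux_corr x t : U (x, t) -> flux sigma f x t = e *: cfluxv (x, t).
Proof.
move=> Uxt; apply/rowP => i; rewrite fluxE !mxE /cflux /avg /=.
have cc : cont0 (fun w => corr (x, w, t) * w 0 i).
  by apply: cont0M; [exact: cont0_corr | exact: cont0_coord].
transitivity (mean (fun w => rhof (x, t) * w 0 i + e * (corr (x, w, t) * w 0 i))).
  by apply: eq_mean => w wS; rewrite f_sphereE // mulrDl mulrA.
rewrite meanD; [|exact/cont0Z/cont0_coord|exact: cont0Z].
rewrite meanZ; last exact: cont0_coord.
by rewrite (mean_coord0 sigma_uniform) mulr0 add0r meanZ.
Qed.

Lemma iter_cflux k vs p : U p ->
  iter_derive vs (cflux k) p = avg sigma (fun w => w 0 k) (iter_derive (map liftxt vs) corr) p.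
Proof.
move=> Up; apply: (iter_derive_avg sigma_uniform U_open) => //.
  exact: cont0_coord.
exact: smooth_corr.
Qed.

(** The flux is e J on a whole neighbourhood, so its Laplacian also carries the factor e; written as
    an average of derivatives of the corrector, the other factor is O(1). *)
Lemma flux_laplacianE x t i : U (x, t) -> flux_laplacian sigma f x t 0 i =
  e * \sum_j avg sigma (fun w => w 0 i) ('D_(dx j) ('D_(dx j) corr)) (x, t).
Proof.
have near_slice y : U (y, t) -> \forall z \near y, U (z, t).
  move=> Uy; have cy : {for y, continuous (fun z : E => (z, t))}.
    by apply: differentiable_continuous; exact: differentiable_pair.
  by apply: cy; exact: open_nbhs_nbhs.
have dP y : U (y, t) -> forall vs, differentiable (fun z => iter_derive vs (cflux i) (z, t)) y.
  move=> Uy vs; apply: differentiable_slice_x; exact: smooth_cflux.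
have d1 y j : U (y, t) -> partial j (fun z => flux sigma f z t 0 i) y =
    e * 'D_(('e_j, 0) : E * R) (cflux i) (y, t).
  move=> Uy; transitivity (partial j (fun z => e * cflux i (z, t)) y).
    apply: near_eq_partial; near=> z.
    have Uz : U (z, t) by near: z; exact: near_slice.
    by rewrite flux_corr // !mxE.
  rewrite partialM //; last exact: (dP y Uy [::]).
  by rewrite partial_cst mulr0 addr0 partial_slice.
move=> Uxt; rewrite mxE /laplacian mulr_sumr; apply: eq_bigr => j _.
transitivity (partial j (fun z => e * 'D_(('e_j, 0) : E * R) (cflux i) (z, t)) x).
  by apply: near_eq_partial; near=> z; apply: d1; near: z; exact: near_slice.
rewrite partialM //; last exact: (dP x Uxt [:: ('e_j, 0)]).
rewrite partial_cst mulr0 addr0; congr (_ * _).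
apply: (etrans (partial_slice ('D_(('e_j, 0) : E * R) (cflux i)) x t j)).
exact: (iter_cflux i [:: ('e_j, 0); ('e_j, 0)] Uxt).
Unshelve. all: by end_near. Qed.

(** * The terms of the model at a point of the region *)

Section at_point.
Variables (x : E) (t : R).
Hypothesis Uxt : U (x, t).

Let C w : R := corr (x, w, t).
Let g := (fun w => f x w t) \o @normalize R n.

Lemma sliceE w : g w = rhof (x, t) + e * C w.
Proof. by rewrite /g /C -[rhof _]/(rhof (base (x, w, t))) -deg0E. Qed.

Lemma C1_0_C : C1_0 C.
Proof. exact: C1_0_slice smooth_corr Uxt. Qed.

Lemma C1_0_partial_C i : C1_0 (partial i C).
Proof. exact: C1_0_partial_slice smooth_corr Uxt. Qed.

Lemma C1_0_g : C1_0 g.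
Proof.
rewrite (_ : g = fun w => rhof (x, t) + e * C w); last by apply/funext => w; exact: sliceE.
by apply: C1_0D; [exact: C1_0_cst | apply: C1_0Z; exact: C1_0_C].
Qed.

Lemma partial_g i w : w != 0 -> partial i g w = e * partial i C w.
Proof.
move=> w0; have dC := C1_0_diff C1_0_C w0.
rewrite (_ : g = fun w => rhof (x, t) + e * C w); last by apply/funext => y; exact: sliceE.
rewrite partialD //; last exact: differentiableM.
by rewrite partial_cst add0r partialM // partial_cst mulr0 addr0.
Qed.

Lemma laplacian_g w : w != 0 -> laplacian g w = e * laplacian C w.
Proof.
move=> w0; rewrite /laplacian mulr_sumr; apply: eq_bigr => i _.
have dC := C1_0_diff (C1_0_partial_C i) w0.
transitivity (partial i (fun y => e * partial i C y) w).
  apply: near_eq_partial; near=> y; apply: partial_g; near: y; exact: near_neq0.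
by rewrite partialM // partial_cst mulr0 addr0.
Unshelve. all: by end_near. Qed.

Lemma homogeneous_g : homogeneous0 g.
Proof. by move=> y c c0; rewrite /g /= normalizeZ. Qed.

Lemma homogeneous_C : homogeneous0 C.
Proof. by move=> y c c0; rewrite /C /corr /deg0 /= normalizeZ. Qed.

Lemma C1_0_partial_g i : C1_0 (partial i g).
Proof.
have -> : partial i g = fun w => 'D_((0, 'e_i, 0) : E * E * R) (deg0 f) (x, w, t).
  exact: (partial_slice_w (deg0 f) x t i).
exact: C1_0_slice (smooth_on_derive _ f_smooth) Uxt.
Qed.

Lemma angular2_C w : sphere w -> angular2 C w = 2 * laplacian C w.
Proof.
move=> wS; apply: angular2_homogeneous => //; first exact: homogeneous_C.
- by move=> y; exact: C1_0_diff C1_0_C.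
- by move=> i y; exact: C1_0_diff (C1_0_partial_C i).
Qed.

Lemma cont0_laplacian_g : cont0 (laplacian g).
Proof.
by apply: cont0_sum => i; apply: C1_0_partial; exact: C1_0_partial_g.
Qed.

Lemma mean_laplacian_g : mean (laplacian g) = 0.
Proof.
have cgg i j : C1_0 (angular i j g).
  by apply: C1_0_angular; [exact: C1_0_g | exact: C1_0_partial_g].
have := mean_angular2 sigma_uniform cgg.
rewrite (@eq_mean _ _ _ _ (fun w => 2 * laplacian g w)).
  rewrite meanZ; last exact: cont0_laplacian_g.
  by move/eqP; rewrite mulf_eq0 pnatr_eq0 => /eqP.
move=> w wS; apply: angular2_homogeneous => //; first exact: homogeneous_g.
- by move=> y; exact: C1_0_diff C1_0_g.
- by move=> i y; exact: C1_0_diff (C1_0_partial_g i).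
Qed.

Lemma sdiv_g v w : sphere w -> sdiv (fun w => f x w t *: perp w v) w =
  dot v (grad g w) - (n%:R - 1) * (g w * dot w v).
Proof.
move=> wS; rewrite (sdiv_perp (phi := fun w => f x w t)) //.
  by rewrite /g /= normalize_id.
exact: C1_0_diff C1_0_g (sphere_neq0 wS).
Qed.

Lemma dot_grad_g v w : sphere w -> dot v (grad g w) = e * dot v (grad C w).
Proof.
move=> wS; rewrite -dotZr; congr dot; apply/rowP => i; rewrite !mxE.
exact: partial_g (sphere_neq0 wS).
Qed.

Lemma cont0_perp_g v :
  cont0 (fun w => dot v (grad g w) - (n%:R - 1) * (g w * dot w v)).
Proof.
apply: cont0B.
  rewrite (_ : (fun w => _) = fun w => \sum_i v 0 i * partial i g w).
    by apply: cont0_sum => i; apply: cont0Z; exact: C1_0_partial C1_0_g.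
  by apply/funext => w; apply: eq_bigr => i _; rewrite mxE.
by apply: cont0Z; apply: cont0M; [exact: C1_0_cont C1_0_g | exact: cont0_dot].
Qed.

Lemma collision_meanE (nu tau : R -> R) :
  mean (fun w => collision sigma nu tau f x w t) = 0.
Proof.
set v := direction sigma f x t; set J := enorm (flux sigma f x t).
transitivity (mean (fun w =>
   - nu J * (dot v (grad g w) - (n%:R - 1) * (g w * dot w v)) - (- tau J) * laplacian g w)).
  by apply: eq_mean => w wS; rewrite /collision sdiv_g // [- tau J * _]mulNr opprK.
rewrite mean_BZ; [|exact/cont0_perp_g|exact/cont0_laplacian_g].
rewrite mean_perp0 //; [|exact: homogeneous_g|exact: C1_0_g].
by rewrite mean_laplacian_g !mulr0 subr0.
Qed.

Lemma nonlocal_meanE (nu tau : R -> R) :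
  mean (fun w => nonlocal sigma nu tau f x w t) = 0.
Proof.
set v := ell sigma nu f x t; set m := mcoef sigma tau f x t.
transitivity (mean (fun w =>
   1 * (dot v (grad g w) - (n%:R - 1) * (g w * dot w v)) - m * laplacian g w)).
  by apply: eq_mean => w wS; rewrite mul1r /nonlocal sdiv_g.
rewrite mean_BZ; [|exact/cont0_perp_g|exact/cont0_laplacian_g].
rewrite mean_perp0 //; [|exact: homogeneous_g|exact: C1_0_g].
by rewrite mean_laplacian_g !mulr0 subr0.
Qed.

(** nu(|J_f|) Omega_f is rewritten as [slope] times the flux, which removes the singular direction.
    The flux supplies a factor e, and the Laplacian another since [rhof] is constant in w. *)
Lemma collisionE (nu tau : R -> R) w : nu 0 = 0 -> sphere w ->
  let s := slope nu (enorm (flux sigma f x t)) in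
  collision sigma nu tau f x w t =
  e * (- s * (e * dot (cfluxv (x, t)) (grad C w)
         - (n%:R - 1) * ((rhof (x, t) + e * C w) * dot w (cfluxv (x, t))))
       + tau (enorm (flux sigma f x t)) * laplacian C w).
Proof.
move=> nu0 wS s; rewrite /collision sdiv_g // dot_grad_g // sliceE.
rewrite -[slaplacian _ _]/(laplacian g w) laplacian_g; last exact: sphere_neq0.
rewrite [RHS]mulrDr; congr (_ + _); last by rewrite mulrCA.
have nuE v' : nu (enorm (flux sigma f x t)) * dot (direction sigma f x t) v' =
    s * e * dot (cfluxv (x, t)) v'.
  have sE : nu (enorm (flux sigma f x t)) = s * enorm (flux sigma f x t).
    rewrite /s /slope; case: eqVneq => [->|h]; first by rewrite nu0 mulr0.
    by rewrite divfK.
  have JE : dot (flux sigma f x t) v' = e * dot (cfluxv (x, t)) v'.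
    by rewrite flux_corr // dotZl.
  rewrite -[s * e * _]mulrA -JE sE /direction /normalize dotZl -mulrA.
  (* Where the flux vanishes, the default value of [normalize] makes both sides 0. *)
  have [J0|J0] := eqVneq (enorm (flux sigma f x t)) 0; last by rewrite mulVKf.
  move/eqP: (J0); rewrite enorm_eq0 => /eqP ->.
  by rewrite dotC dot0r !mulr0.
transitivity (- (e * (nu (enorm (flux sigma f x t)) * dot (direction sigma f x t) (grad C w))
    - (n%:R - 1) * ((rhof (x, t) + e * C w) *
       (nu (enorm (flux sigma f x t)) * dot (direction sigma f x t) w)))).
  rewrite (dotC w); move: (nu _) (dot _ _) (dot _ _) (rhof _) (C w) => *; ring.
rewrite !nuE (dotC w); move: (dot _ _) (dot _ _) (rhof _) (C w) => *; ring.
Qed.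

Lemma nonlocalE (nu tau : R -> R) w : sphere w ->
  nonlocal sigma nu tau f x w t =
  e * dot (ell sigma nu f x t) (grad C w)
  - (n%:R - 1) * ((rhof (x, t) + e * C w) * dot w (ell sigma nu f x t))
  - mcoef sigma tau f x t * (e * laplacian C w).
Proof.
move=> wS; rewrite /nonlocal sdiv_g // dot_grad_g // sliceE.
by rewrite -[slaplacian _ _]/(laplacian g w) laplacian_g //; exact: sphere_neq0.
Qed.

Lemma derive_deg0 (v : E * E * R) w : w != 0 -> 'D_v (deg0 f) (x, w, t) =
  'D_(base v) rhof (x, t) + e * 'D_v corr (x, w, t).
Proof.
move=> w0; have dC : differentiable corr (x, w, t) by apply: (smooth_on_diff smooth_corr); split.
have dR : differentiable (rhof \o base) (x, w, t).
  by apply: (smooth_on_diff (smooth_on_base smooth_rhof)); split.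
rewrite (_ : deg0 f = fun q => (rhof \o base) q + e * corr q); last first.
  by apply/funext => q; rewrite deg0E.
rewrite deriveD; [|exact: diff_derivable|by apply: diff_derivable; apply: differentiableM].
rewrite derive_base; congr (_ + _); apply: deriveZ; exact: diff_derivable.
Qed.

Lemma transportE w : sphere w -> transport f x w t =
  derive1 (fun s => rhof (x, s)) t + dot w (grad (fun y => rhof (y, t)) x)
  + e * ('D_dt corr (x, w, t) + \sum_i w 0 i * 'D_(dx i) corr (x, w, t)).
Proof.
move=> wS; have w0 := sphere_neq0 wS.
have h1 : derive1 (fun s => f x w s) t = 'D_dt (deg0 f) (x, w, t).
  rewrite (_ : (fun s => f x w s) = deg0 f \o (fun s => (x, w, s))); last first.
    by apply/funext => s; rewrite /deg0 /= normalize_id.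
  rewrite derive1E; apply: derive_affine => h.
  by rewrite /dt; congr (_, _, _); rewrite /= ?scaler0 ?add0r.
have h2 i : partial i (fun y => f y w t) x = 'D_(dx i) (deg0 f) (x, w, t).
  rewrite (_ : (fun y => f y w t) = deg0 f \o (fun y => (y, w, t))); last first.
    by apply/funext => s; rewrite /deg0 /= normalize_id.
  apply: derive_affine => h.
  by rewrite /dx; congr (_, _, _); rewrite /= ?scaler0 ?add0r.
rewrite /transport h1 derive_deg0 // derive1_slice -!addrA; congr (_ + _).
rewrite mulrDr [RHS]addrCA; congr (_ + _).
rewrite mulr_sumr -big_split; apply: eq_bigr => i _ /=.
rewrite !mxE h2 derive_deg0 // mulrDr partial_slice; congr (_ + _); exact: mulrCA.
Qed.

Lemma derive_cflux k (v : E * R) : 'D_v (cflux k) (x, t) =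
  mean (fun w => 'D_(liftxt v) corr (x, w, t) * w 0 k).
Proof.
have := differentiable_avg sigma_uniform U_open (@cont0_coord _ _ k) smooth_corr Uxt.
by case=> _ ->.
Qed.

(** The identity that f_1 has mean 0 holds near the point and may be differentiated under the
    integral. *)
Lemma mean_derive_corr (v : E * R) : mean (fun w => 'D_(liftxt v) corr (x, w, t)) = 0.
Proof.
have := differentiable_avg sigma_uniform U_open (@cont0_cst _ _ 1) smooth_corr Uxt.
case=> _ /(_ v) h.
transitivity (avg sigma (fun=> 1) ('D_(liftxt v) corr) (x, t)).
  by apply: eq_mean => w _; rewrite mulr1.
rewrite -h -[RHS](derive_cst (0 : R) (x, t) v); apply: near_eq_derive.
have avg0 (p : E * R) : U p -> avg sigma (fun=> 1) corr p = 0.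
  case: p => y s Up; rewrite -(mean_corr Up).
  by apply: eq_mean => w _; rewrite mulr1.
by near=> p; apply: avg0; near: p; exact: open_nbhs_nbhs.
Unshelve. all: by end_near. Qed.

Lemma cont0_derive_corr (v : E * E * R) : cont0 (fun w => 'D_v corr (x, w, t)).
Proof. by apply: C1_0_cont; exact: C1_0_slice (smooth_on_derive _ smooth_corr) Uxt. Qed.

Lemma transport_meanE : mean (fun w => transport f x w t) =
  derive1 (fun s => rhof (x, s)) t + e * \sum_i 'D_(('e_i, 0) : E * R) (cflux i) (x, t).
Proof.
set a := derive1 _ _; set b := grad (fun y => rhof (y, t)) x.
have cs i : cont0 (fun w => w 0 i * 'D_(dx i) corr (x, w, t)).
  by apply: cont0M; [exact: cont0_coord | exact: cont0_derive_corr].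
have cS : cont0 (fun w => \sum_i w 0 i * 'D_(dx i) corr (x, w, t)) by exact: cont0_sum.
have cT : cont0 (fun w => 'D_dt corr (x, w, t)) by exact: cont0_derive_corr.
transitivity (mean (fun w => a + dot w b
   + e * ('D_dt corr (x, w, t) + \sum_i w 0 i * 'D_(dx i) corr (x, w, t)))).
  by apply: eq_mean => w wS; rewrite transportE.
have cab : cont0 (fun w => a + dot w b).
  by apply: cont0D; [exact: cont0_cst | exact: cont0_dot].
rewrite meanD //; last by apply: cont0Z; exact: cont0D.
rewrite meanD; [|exact: cont0_cst|exact: cont0_dot].
rewrite (mean_cst sigma_uniform) meanZ; last exact: cont0D.
have -> : mean (fun w => dot w b) = 0.
  transitivity (mean (fun w => \sum_i b 0 i * w 0 i)).
    by apply: eq_mean => w _; apply: eq_bigr => i _; rewrite mulrC.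
  rewrite mean_sum; last by move=> i; exact/cont0Z/cont0_coord.
  rewrite big1 // => i _; rewrite meanZ; last exact: cont0_coord.
  by rewrite (mean_coord0 sigma_uniform) mulr0.
rewrite addr0 meanD //; have -> : mean (fun w => 'D_dt corr (x, w, t)) = 0.
  exact: (mean_derive_corr (0, 1)).
rewrite add0r mean_sum //; congr (_ + _ * _); apply: eq_bigr => i _.
by rewrite derive_cflux; apply: eq_mean => w _; rewrite mulrC.
Qed.

(** [f] itself is only controlled at unit vectors; averaging needs a function continuous off the
    origin with the same values there. *)
Lemma cont0_transport : exists2 h, cont0 h & forall w, sphere w -> transport f x w t = h w.
Proof.
eexists; last by move=> w wS; exact: transportE.
apply: cont0D; first by apply: cont0D; [exact: cont0_cst | exact: cont0_dot].
apply: cont0Z; apply: cont0D; first exact: cont0_derive_corr.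
by apply: cont0_sum => i; apply: cont0M; [exact: cont0_coord | exact: cont0_derive_corr].
Qed.

(** Average the model: the collision and nonlocal terms are tangential divergences, hence of mean 0,
    and e can be divided out. *)
Lemma mass_conservation (nu tau : R -> R) (r : E -> R) (K : R) :
  (forall w, sphere w -> e * transport f x w t + K * nonlocal sigma nu tau f x w t
     = collision sigma nu tau f x w t + r w) ->
  mean r = 0 ->
  derive1 (fun s => rhof (x, s)) t =
  - (e * \sum_i 'D_(('e_i, 0) : E * R) (cflux i) (x, t)).
Proof.
move=> model r0.
have [hT cT hTE] := cont0_transport.
have [hN cN hNE] : exists2 h, cont0 h & forall w, sphere w -> nonlocal sigma nu tau f x w t = h w.
  set v := ell sigma nu f x t; set m := mcoef sigma tau f x t.
  exists (fun w => dot v (grad g w) - (n%:R - 1) * (g w * dot w v) - m * laplacian g w).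
    by apply: cont0B; [exact: cont0_perp_g | exact/cont0Z/cont0_laplacian_g].
  by move=> w wS; rewrite /nonlocal sdiv_g.
have [hC cC hCE] : exists2 h, cont0 h & forall w, sphere w -> collision sigma nu tau f x w t = h w.
  set v := direction sigma f x t; set J := enorm (flux sigma f x t).
  exists (fun w => - nu J * (dot v (grad g w) - (n%:R - 1) * (g w * dot w v)) + tau J * laplacian g w).
    by apply: cont0D; apply: cont0Z; [exact: cont0_perp_g | exact: cont0_laplacian_g].
  by move=> w wS; rewrite /collision sdiv_g.
have mT : mean hT = mean (fun w => transport f x w t) by apply: eq_mean => w wS; rewrite hTE.
have mN : mean hN = 0 by rewrite -(nonlocal_meanE nu tau); apply: eq_mean => w wS; rewrite hNE.
have mC : mean hC = 0 by rewrite -(collision_meanE nu tau); apply: eq_mean => w wS; rewrite hCE.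
(* The remainder carries no regularity of its own; the model equates it on the sphere with
   continuous functions, for which [mean] is linear. *)
have : mean r = mean (fun w => e * hT w + (K * hN w - hC w)).
  apply: eq_mean => w wS; have := model w wS; rewrite -hTE // -hNE // -hCE //.
  by move=> h; rewrite addrA h addrAC subrr add0r.
rewrite r0 meanD; [|exact: cont0Z|by apply: cont0B => //; exact: cont0Z].
rewrite meanB //; last exact: cont0Z.
rewrite !meanZ // mN mC mulr0 subr0 addr0 mT transport_meanE => /esym/eqP.
by rewrite mulf_eq0 (negPf e_neq0) /= addr_eq0 => /eqP.
Qed.

(** The coefficient of w . B cancels it in the Laplacian, leaving (tau0 Lap C - w . B) / tau0;
    [sup_estimate] applies with M / tau0, as the combination has mean 0. *)
Lemma corrector_estimate (tau0 M : R) (B : E) : 0 < tau0 ->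
  (forall w, sphere w -> `|tau0 * laplacian C w - dot w B| <= M) ->
  forall w, sphere w ->
  `|C w + ((n%:R - 1) * tau0)^-1 * dot w B| <= 2 * (M / tau0).
Proof.
move=> tau0_gt0 hM.
have n1 : 0 < n%:R - 1 :> R by rewrite subr_gt0 ltr1n.
pose c := ((n%:R - 1) * tau0)^-1; pose D w := dot w B.
have cD : C1_0 D by exact: C1_0_dotr.
have cpD k : C1_0 (partial k D).
  apply: (C1_0_near (h := fun=> B 0 k)); last exact: C1_0_cst.
  by move=> w w0; rewrite partial_dotr.
have caD i j : C1_0 (angular i j D) by exact: C1_0_angular.
have caC i j : C1_0 (angular i j C).
  by apply: C1_0_angular; [exact: C1_0_C | exact: C1_0_partial_C].
have cC := C1_0_C.
have cDc : C1_0 (fun w => c * D w) by apply: C1_0Z; exact: cD.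
have ch : C1_0 (fun w => C w + c * D w) by apply: C1_0D; [exact: cC | exact: cDc].
have chh i j : C1_0 (angular i j (fun w => C w + c * D w)).
  apply: C1_0_angular; first exact: ch.
  by move=> k; apply: C1_0_partial_addZ;
    [exact: cC | exact: cD | exact: C1_0_partial_C | exact: cpD].
have h2 w : sphere w -> `|angular2 (fun w => C w + c * D w) w| <= 2 * (M / tau0).
  move=> wS; rewrite (angular2_addZ c cC cD caC caD (sphere_neq0 wS)).
  rewrite angular2_C // angular2_dotr.
  have -> : 2 * laplacian C w + c * (2 * (1 - n%:R) * dot w B) =
      2 / tau0 * (tau0 * laplacian C w - dot w B).
    by rewrite /c; field; rewrite !gt_eqF.
  have t2 : 0 <= 2 / tau0 by rewrite divr_ge0 // ltW.
  rewrite normrM (ger0_norm t2) mulrA [X in _ <= X]mulrAC.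
  by apply: ler_wpM2l => //; exact: hM.
have h0 : mean (fun w => C w + c * D w) = 0.
  rewrite meanD; [|exact: cont0_corr|exact/cont0Z/cont0_dot].
  rewrite mean_corr // add0r meanZ; last exact: cont0_dot.
  rewrite (_ : mean D = 0) ?mulr0 //.
  transitivity (mean (fun w => \sum_i B 0 i * w 0 i)).
    by apply: eq_mean => w _; apply: eq_bigr => i _; rewrite mulrC.
  rewrite mean_sum; last by move=> i; exact/cont0Z/cont0_coord.
  rewrite big1 // => i _; rewrite meanZ; last exact: cont0_coord.
  by rewrite (mean_coord0 sigma_uniform) mulr0.
move=> w wS; exact: (@sup_estimate R n sigma n_ge2 sigma_uniform _ _ w ch chh h2 h0 wS).
Qed.

(** Average the preceding bound against w_k: |w_k| <= 1, and the second moments give B_k / n. *)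
Lemma cflux_estimate (tau0 M : R) (B : E) k : 0 < tau0 ->
  (forall w, sphere w -> `|tau0 * laplacian C w - dot w B| <= M) ->
  `|cflux k (x, t) + ((n%:R - 1) * tau0)^-1 * (B 0 k / n%:R)| <= 2 * (M / tau0).
Proof.
move=> tau0_gt0 hM; set c := (_ * tau0)^-1.
have cCk : cont0 (fun w => C w * w 0 k).
  by apply: cont0M; [exact: cont0_corr | exact: cont0_coord].
have cDk : cont0 (fun w => dot w B * w 0 k).
  by apply: cont0M; [exact: cont0_dot | exact: cont0_coord].
have -> : cflux k (x, t) + c * (B 0 k / n%:R) =
    mean (fun w => C w * w 0 k + c * (dot w B * w 0 k)).
  rewrite meanD //; last exact: cont0Z.
  by rewrite meanZ // (mean_dot_coord sigma_uniform).
apply: (mean_norm_le sigma_uniform); first by apply: cont0D => //; exact: cont0Z.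
move=> w wS.
have -> : C w * w 0 k + c * (dot w B * w 0 k) = (C w + c * dot w B) * w 0 k.
  by rewrite mulrDl mulrA.
rewrite normrM -[leRHS]mulr1.
apply: ler_pM => //; first exact: corrector_estimate.
exact: coord_sphere_le1.
Qed.

End at_point.
End expansion.

(** * Uniform estimates as e tends to 0 *)

Section asymptotics.
Context {R : realType} {n : nat} (sigma : probability (rVborel R n) R).
Hypothesis n_ge2 : (2 <= n)%N.
Hypothesis sigma_uniform : uniform_on_sphere sigma.
Local Notation E := 'rV[R]_n.
Local Notation mean := (mean sigma).
Variables (nu tau : R -> R) (rhoc K2 delta : R) (eta : R -> R).
Hypothesis nu_C1 : continuous (derive1 nu).
Hypothesis tau_C1 : continuous (derive1 tau).
Hypothesis nu0 : nu 0 = 0.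
Hypothesis tau0_gt0 : 0 < tau 0.
Hypothesis rhoc_gt0 : 0 < rhoc.
Hypothesis nu'0 : derive1 nu 0 = n%:R * tau 0 / rhoc.
Hypothesis slope_lip : exists2 L, 0 <= L &
  forall r, 0 <= r -> `|slope nu r - derive1 nu 0| <= L * r.
Hypothesis tau_lip : exists2 L, 0 <= L &
  forall r, 0 <= r -> `|tau r - tau 0| <= L * r.
Hypothesis eta_sqr : exists C, \forall e \near 0^'+, eta e ^+ 2 <= C * e.
Variable U : set (E * R).
Hypothesis U_open : open U.
Variables f rem : R -> E -> E -> R -> R.
Hypothesis f_smooth : \forall e \near 0^'+,
  smooth_on (region_punctured U) (deg0 (f e)).
Hypothesis f_model : \forall e \near 0^'+, forall x w t, U (x, t) -> sphere w ->
  e * transport (f e) x w t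
  + K2 * eta e ^+ 2 * nonlocal sigma nu tau (f e) x w t
  = collision sigma nu tau (f e) x w t + rem e x w t.
Hypothesis rem_bigO : unifO (region_sphere U)
  (fun e p => rem e p.1.1 p.1.2 p.2) (fun e => eta e ^+ 4).
Hypothesis rem_mean0 : \forall e \near 0^'+, forall x t, U (x, t) ->
  density sigma (rem e) x t = 0.
Hypothesis f1_bigO : unifO1_derivatives (region_sphere U)
  (fun e => deg0 (corrector sigma e (f e))).
Hypothesis rho_bigO : unifO1_derivatives U
  (fun e p => density sigma (f e) p.1 p.2).
Hypothesis delta_gt0 : 0 < delta.
Hypothesis rho_subcritical : \forall e \near 0^'+, forall x t, U (x, t) ->
  density sigma (f e) x t <= rhoc - delta.

Local Notation D := (region_sphere U).
Local Notation cf e := (corr sigma e (f e)).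
Local Notation rh e := (rhof sigma (f e)).
Local Notation J k e := (cflux sigma e (f e) k).

Lemma near_good : \forall e \near (0 : R)^'+, 0 < e /\ smooth_on (region_punctured U) (deg0 (f e)).
Proof. by near=> e; split; near: e; [exact: near0_gt0 | exact: f_smooth].
Unshelve. all: by end_near. Qed.

Lemma D_base q : D q -> U (base q).
Proof. by case. Qed.

Lemma unifO_base (g : R -> E * R -> R) b : unifO U g b ->
  unifO D (fun e q => g e (base q)) b.
Proof. exact/unifO_pull/D_base. Qed.

Lemma unifO_corr vs : unifO D (fun e => iter_derive vs (cf e)) (fun=> 1).
Proof. exact: f1_bigO. Qed.

Lemma unifO_rho : unifO U (fun e => rh e) (fun=> 1).
Proof. exact: (rho_bigO [::]). Qed.

Lemma unifO_w k : unifO D (fun _ q => q.1.2 0 k) (fun=> 1).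
Proof.
by exists 1; near=> e => q [_ wS]; rewrite mulr1; exact: coord_sphere_le1.
Unshelve. all: by end_near. Qed.

Lemma unifO_avg (F : R -> E * E * R -> R) b k :
  (\forall e \near 0^'+, smooth_on (region_punctured U) (F e)) ->
  unifO D F b -> unifO U (fun e => avg sigma (fun w => w 0 k) (F e)) b.
Proof.
move=> sF [C hC]; exists C; near=> e => -[x t] Uxt.
have sFe : smooth_on (region_punctured U) (F e) by near: e.
have hCe : forall p, D p -> `|F e p| <= C * b e by near: e.
apply: (mean_norm_le sigma_uniform).
  exact: (cont0_slice_c (@cont0_coord _ _ k) sFe Uxt).
move=> w wS; rewrite normrM -[leRHS]mulr1; apply: ler_pM => //.
  exact: (hCe (x, w, t)).
exact: coord_sphere_le1.
Unshelve. all: by end_near. Qed.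

Lemma near_smooth_iter vs : \forall e \near 0^'+,
  smooth_on (region_punctured U) (iter_derive vs (cf e)).
Proof.
near=> e; have [e0 se] : 0 < e /\ smooth_on (region_punctured U) (deg0 (f e)).
  by near: e; exact: near_good.
apply: smooth_on_iter; apply: smooth_corr => //.
Unshelve. all: by end_near. Qed.

Lemma unifO_cflux k : unifO U (fun e => J k e) (fun=> 1).
Proof. exact: unifO_avg (near_smooth_iter [::]) (unifO_corr [::]). Qed.

Lemma near0_ge01 : \forall e \near (0 : R)^'+, 0 <= (1 : R).
Proof. by near=> e. Unshelve. all: by end_near. Qed.

Let nJ e (p : E * R) : R := enorm (flux sigma (f e) p.1 p.2).

(** The flux is e J with J bounded; this freezes the coefficients nu and tau at 0 up to O(e). *)
Lemma unifO_nJ : unifO U nJ id.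
Proof.
apply: (@unifO_bound _ _ _ _ (fun e p => e * \sum_k `|J k e p|)); last first.
  apply: unifO_e1; apply: unifO_norm_sum; first exact: near0_ge01.
  by move=> k; exact: unifO_cflux.
near=> e => -[x t] Uxt.
have [e0 se] : 0 < e /\ smooth_on (region_punctured U) (deg0 (f e)).
  by near: e; exact: near_good.
have en0 : e != 0 by rewrite gt_eqF.
rewrite /nJ (flux_corr sigma_uniform U_open en0 se Uxt).
rewrite enormZ !normrM normr_id; apply: ler_wpM2l => //.
rewrite !ger0_norm ?enorm_ge0 ?sumr_ge0 //; apply: (le_trans (enorm_le_sum _)).
by apply: ler_sum => k _; rewrite mxE.
Unshelve. all: by end_near. Qed.

Lemma unifO_lip (g : R -> R) (c : R) :
  (exists2 L, 0 <= L & forall r, 0 <= r -> `|g r - c| <= L * r) ->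
  unifO U (fun e p => g (nJ e p) - c) id.
Proof.
move=> [L L0 hL]; apply: (@unifO_bound _ _ _ _ (fun e p => L * nJ e p)).
  near=> e => p Up; rewrite [leRHS]ger0_norm ?mulr_ge0 ?enorm_ge0 //.
  exact/hL/enorm_ge0.
exact: unifO_scale unifO_nJ.
Unshelve. all: by end_near. Qed.

Lemma unifO_slope : unifO U (fun e p => slope nu (nJ e p)) (fun=> 1).
Proof.
apply: (@unifO_near _ _ _ (fun e p => (slope nu (nJ e p) - derive1 nu 0) + derive1 nu 0)).
  by near=> e => p _; rewrite subrK.
apply: unifO_add; last exact: unifO_cst.
exact/unifO_id1/unifO_lip.
Unshelve. all: by end_near. Qed.

Let om k e (p : E * R) : R := direction sigma (f e) p.1 p.2 0 k.

Lemma unifO_om k : unifO U (om k) (fun=> 1).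
Proof.
exists 1; near=> e => p _; rewrite mulr1 /om /direction.
have [->|v0] := eqVneq (flux sigma (f e) p.1 p.2) 0.
  by rewrite /normalize scaler0 mxE normr0.
by apply: coord_sphere_le1; exact: normalize_sphere.
Unshelve. all: by end_near. Qed.

Let lapJ k e (p : E * R) : R := flux_laplacian sigma (f e) p.1 p.2 0 k.

Lemma unifO_lapJ k : unifO U (lapJ k) id.
Proof.
apply: (@unifO_near _ _ _ (fun e p =>
  e * \sum_j avg sigma (fun w => w 0 k) ('D_(dx j) ('D_(dx j) (cf e))) p)).
  near=> e => -[x t] Uxt.
  have [e0 se] : 0 < e /\ smooth_on (region_punctured U) (deg0 (f e)).
    by near: e; exact: near_good.
  have en0 : e != 0 by rewrite gt_eqF.
  by rewrite /lapJ (flux_laplacianE sigma_uniform U_open en0 se k Uxt).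
apply: unifO_e1; apply: unifO_sum; first exact: near0_ge01.
move=> j; apply: (@unifO_avg (fun e => iter_derive [:: dx j; dx j] (cf e))).
  exact: near_smooth_iter.
exact: unifO_corr.
Unshelve. all: by end_near. Qed.

Let dotOL e p : R := \sum_k om k e p * lapJ k e p.

Lemma unifO_dotOL : unifO U dotOL id.
Proof.
apply: unifO_sum; first exact: near0_ge0.
by move=> k; apply: unifO_mul1; [exact: unifO_om | exact: unifO_lapJ].
Qed.

Lemma perp_combination (a b : R) (v D : E) k :
  (a *: perp v D + (dot v D * b) *: v) 0 k =
  a * (D 0 k - v 0 k * dot v D) + b * v 0 k * dot v D.
Proof. by rewrite !mxE -/(dot v D); move: (dot v D) => d; ring. Qed.

Lemma unifO_ell k : unifO U (fun e p => ell sigma nu (f e) p.1 p.2 0 k) id.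
Proof.
apply: (@unifO_near _ _ _ (fun e p =>
   slope nu (nJ e p) * (lapJ k e p - om k e p * dotOL e p)
   + (derive1 nu (nJ e p) * om k e p) * dotOL e p)).
  near=> e => p _; rewrite perp_combination -/(lapJ k e p) -/(om k e p) -/(nJ e p).
  rewrite -[dot _ _]/(dotOL e p).
  move: (dotOL e p) (om k e p) (lapJ k e p) => *; ring.
have o := unifO_om k; have d := unifO_dotOL.
apply: unifO_add.
  apply: unifO_mul1; first exact: unifO_slope.
  by apply: unifO_sub; [exact: unifO_lapJ | exact: unifO_mul1].
apply: unifO_mul1 => //; apply: unifO_mul1 => //.
by apply: unifO_comp; [exact: nu_C1 | exact: unifO_nJ].
Unshelve. all: by end_near. Qed.

Lemma unifO_mcoef : unifO U (fun e p => mcoef sigma tau (f e) p.1 p.2) id.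
Proof.
apply: (@unifO_near _ _ _ (fun e p => derive1 tau (nJ e p) * dotOL e p)).
  by near=> e => p _; rewrite /mcoef mulrC.
apply: unifO_mul1; last exact: unifO_dotOL.
by apply: unifO_comp; [exact: tau_C1 | exact: unifO_nJ].
Unshelve. all: by end_near. Qed.

Let lapC e q : R := \sum_i 'D_(dw i) ('D_(dw i) (cf e)) q.

Lemma unifO_lapC : unifO D lapC (fun=> 1).
Proof.
apply: unifO_sum; first exact: near0_ge01.
by move=> i; exact: (unifO_corr [:: dw i; dw i]).
Qed.

Lemma laplacian_corr e x w t :
  laplacian (fun y => cf e (x, y, t)) w = lapC e (x, w, t).
Proof.
apply: eq_bigr => i _; rewrite partial_slice_w.
by rewrite (partial_slice_w ('D_(dw i) (cf e)) x t i).
Qed.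

Lemma dot_grad_corr e x w t v :
  dot v (grad (fun y => cf e (x, y, t)) w) =
  \sum_k v 0 k * 'D_(dw k) (cf e) (x, w, t).
Proof. by apply: eq_bigr => k _; rewrite mxE partial_slice_w. Qed.

Let ellk k e (q : E * E * R) : R := ell sigma nu (f e) q.1.1 q.2 0 k.
Let NL e (q : E * E * R) : R := nonlocal sigma nu tau (f e) q.1.1 q.1.2 q.2.

(** The leading part is rho times w . ell, which is O(e) through ell; the other terms have a further
    factor e. *)
Lemma unifO_nonlocal : unifO D NL id.
Proof.
have oe k : unifO D (ellk k) id by exact: (unifO_base (unifO_ell k)).
have om_ : unifO D (fun e q => mcoef sigma tau (f e) q.1.1 q.2) id.
  exact: (unifO_base unifO_mcoef).
apply: (@unifO_near _ _ _ (fun e q =>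
    e * \sum_k ellk k e q * 'D_(dw k) (cf e) q
  - (n%:R - 1) * ((rh e (base q) + e * cf e q) * \sum_k q.1.2 0 k * ellk k e q)
  - (e * lapC e q) * mcoef sigma tau (f e) q.1.1 q.2)).
  near=> e => -[[x w] t] [/= Uxt wS].
  have [e0 se] : 0 < e /\ smooth_on (region_punctured U) (deg0 (f e)).
    by near: e; exact: near_good.
  have en0 : e != 0 by rewrite gt_eqF.
  rewrite /NL (nonlocalE sigma_uniform U_open en0 se Uxt nu tau wS).
  by rewrite laplacian_corr dot_grad_corr [X in _ = _ - X]mulrC.
have sume (G : 'I_n -> R -> E * E * R -> R) : (forall k, unifO D (G k) id) ->
    unifO D (fun e q => \sum_k G k e q) id.
  by apply: unifO_sum; exact: near0_ge0.
apply: unifO_sub; last first.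
  by apply: unifO_mul1 => //; apply/unifO_id1/unifO_e1/unifO_lapC.
apply: unifO_sub.
  apply: unifO_mul1; first by apply: unifO_id1; apply: unifO_fun; exact: near0_ge0.
  apply: sume => k.
  apply: (@unifO_near _ _ _ (fun e q => 'D_(dw k) (cf e) q * ellk k e q)).
    by near=> e => q _; rewrite mulrC.
  by apply: unifO_mul1 => //; exact: (unifO_corr [:: dw k]).
apply: unifO_scale; apply: unifO_mul1.
  apply: unifO_add; first exact: (unifO_base unifO_rho).
  by apply/unifO_id1/unifO_e1; exact: (unifO_corr [::]).
by apply: sume => k; apply: unifO_mul1 => //; exact: unifO_w.
Unshelve. all: by end_near. Qed.

Lemma near_sqr : exists2 C, 0 <= C & \forall e \near 0^'+, eta e ^+ 2 <= C * e.
Proof.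
have [C hC] := eta_sqr; exists `|C| => //; near=> e.
have h : eta e ^+ 2 <= C * e by near: e.
by apply: (le_trans h); apply: ler_wpM2r; [near: e; exact: near0_ge0 | exact: ler_norm].
Unshelve. all: by end_near. Qed.

Lemma unifO_nonlocal_term :
  unifO D (fun e q => e^-1 * (K2 * eta e ^+ 2 * NL e q)) id.
Proof.
have [C C0 hC] := near_sqr.
apply: (@unifO_near _ _ _ (fun e q => (K2 * (e^-1 * eta e ^+ 2)) * NL e q)).
  by near=> e => q _; move: (eta e ^+ 2) (NL e q) (e^-1) => *; ring.
apply: unifO_mul1; last exact: unifO_nonlocal.
apply: unifO_scale; exists C; near=> e => q _.
have e0 : 0 < e by near: e; exact: near0_gt0.
have h : eta e ^+ 2 <= C * e by near: e.
rewrite mulr1 ger0_norm; last by rewrite mulr_ge0 ?sqr_ge0 // invr_ge0 ltW.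
by rewrite mulrC ler_pdivrMr.
Unshelve. all: by end_near. Qed.

Lemma unifO_rem_term :
  unifO D (fun e q => e^-1 * rem e q.1.1 q.1.2 q.2) id.
Proof.
have [C C0 hC] := near_sqr.
apply: (@unifO_le _ _ _ _ (fun e => e^-1 * eta e ^+ 4) _ (C ^+ 2)).
  near=> e.
  have e0 : 0 < e by near: e; exact: near0_gt0.
  have h : eta e ^+ 2 <= C * e by near: e.
  have h4 : eta e ^+ 4 <= (C * e) ^+ 2.
    by rewrite (_ : 4 = 2 * 2)%N // exprM ler_pXn2r // nnegrE ?sqr_ge0 // mulr_ge0 // ltW.
  have p4 : 0 <= eta e ^+ 4 by rewrite (_ : 4 = 2 * 2)%N // exprM sqr_ge0.
  rewrite ger0_norm; last by rewrite mulr_ge0 // invr_ge0 ltW.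
  rewrite mulrC ler_pdivrMr //; apply: (le_trans h4).
  by rewrite exprMn [e ^+ 2]expr2 mulrA.
apply: unifO_mul => //; apply: unifO_fun; near=> e.
by rewrite invr_ge0; near: e; exact: near0_ge0.
Unshelve. all: by end_near. Qed.

Let dtrho e (p : E * R) : R := derive1 (fun s => rh e (p.1, s)) p.2.

Lemma dtrhoE : \forall e \near 0^'+, forall p, U p ->
  dtrho e p = - (e * \sum_i 'D_(('e_i, 0) : E * R) (J i e) p).
Proof.
near=> e => -[x t] Uxt.
have [e0 se] : 0 < e /\ smooth_on (region_punctured U) (deg0 (f e)).
  by near: e; exact: near_good.
have r0 : forall x t, U (x, t) -> density sigma (rem e) x t = 0.
  by near: e; exact: rem_mean0.
have md : forall x w t, U (x, t) -> sphere w ->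
  e * transport (f e) x w t + K2 * eta e ^+ 2 * nonlocal sigma nu tau (f e) x w t
  = collision sigma nu tau (f e) x w t + rem e x w t by near: e; exact: f_model.
apply: (@mass_conservation _ _ sigma sigma_uniform U U_open e (f e) _ se x t Uxt
  nu tau (fun w => rem e x w t) (K2 * eta e ^+ 2)).
- by rewrite gt_eqF.
- by move=> w wS; exact: md.
- by rewrite -densityE; exact: r0.
Unshelve. all: by end_near. Qed.

(** The hypothesis on rho only gives O(1); mass conservation gains the factor e that removes the
    time derivative from the leading order. *)
Lemma unifO_dtrho : unifO U dtrho id.
Proof.
apply: (@unifO_near _ _ _ (fun e p => - (e * \sum_i 'D_(('e_i, 0) : E * R) (J i e) p))).
  near=> e => p Up; apply/esym; move: p Up; near: e; exact: dtrhoE.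
apply: unifO_opp; apply: unifO_e1; apply: unifO_sum; first exact: near0_ge01.
move=> i; apply: (@unifO_near _ _ _ (fun e => avg sigma (fun w => w 0 i) ('D_(dx i) (cf e)))).
  near=> e => p Up.
  have [e0 se] : 0 < e /\ smooth_on (region_punctured U) (deg0 (f e)).
    by near: e; exact: near_good.
  apply/esym/(iter_cflux sigma_uniform U_open _ se i [:: ('e_i, 0)] Up).
apply: (@unifO_avg (fun e => iter_derive [:: dx i] (cf e))).
  exact: near_smooth_iter.
exact: unifO_corr.
Unshelve. all: by end_near. Qed.

Let wJ e (q : E * E * R) : R := \sum_k q.1.2 0 k * J k e (base q).

Lemma unifO_wJ : unifO D wJ (fun=> 1).
Proof.
apply: unifO_sum; first exact: near0_ge01.
by move=> k; apply: unifO_mul1; [exact: unifO_w | exact: (unifO_base (unifO_cflux k))].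
Qed.

Let Jgrad e (q : E * E * R) : R := \sum_k J k e (base q) * 'D_(dw k) (cf e) q.

(* The terms of the model, divided by e, that are not of leading order:
   [leading_order] below reads tau 0 Lap f_1 = w . B + Err. *)
Let Err e q : R :=
  dtrho e (base q) + e * ('D_dt (cf e) q + \sum_i q.1.2 0 i * 'D_(dx i) (cf e) q)
  + e^-1 * (K2 * eta e ^+ 2 * NL e q) - e^-1 * rem e q.1.1 q.1.2 q.2
  - (tau (nJ e (base q)) - tau 0) * lapC e q
  - (n%:R - 1) * ((slope nu (nJ e (base q)) - derive1 nu 0) * (rh e (base q) * wJ e q))
  + e * (slope nu (nJ e (base q)) * (Jgrad e q - (n%:R - 1) * (cf e q * wJ e q))).

Lemma unifO_Err : unifO D Err id.
Proof.
have mulr1O (g h : R -> E * E * R -> R) : unifO D g id -> unifO D h (fun=> 1) ->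
    unifO D (fun e q => g e q * h e q) id.
  move=> hg hh; apply: (@unifO_near _ _ _ (fun e q => h e q * g e q)).
    by near=> e => q _; rewrite mulrC.
  exact: unifO_mul1.
have o1 := unifO_wJ; have oc := unifO_corr [::].
apply: unifO_add; last first.
  apply: unifO_e1; apply: unifO_mul1; first exact: (unifO_base unifO_slope).
  apply: unifO_sub; last by apply: unifO_scale; exact: unifO_mul1.
  apply: unifO_sum; first exact: near0_ge01.
  move=> k; apply: unifO_mul1; first exact: (unifO_base (unifO_cflux k)).
  exact: (unifO_corr [:: dw k]).
apply: unifO_sub; last first.
  apply: unifO_scale; apply: mulr1O; first exact: (unifO_base (unifO_lip slope_lip)).
  by apply: unifO_mul1 => //; exact: (unifO_base unifO_rho).
apply: unifO_sub; last first.
  by apply: mulr1O; [exact: (unifO_base (unifO_lip tau_lip)) | exact: unifO_lapC].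
apply: unifO_sub; last exact: unifO_rem_term.
apply: unifO_add; last exact: unifO_nonlocal_term.
apply: unifO_add; first exact: (unifO_base unifO_dtrho).
apply: unifO_e1; apply: unifO_add; first exact: (unifO_corr [:: dt]).
apply: unifO_sum; first exact: near0_ge01.
by move=> i; apply: unifO_mul1; [exact: unifO_w | exact: (unifO_corr [:: dx i])].
Unshelve. all: by end_near. Qed.

Let gradrho e (p : E * R) : E := grad (fun y => rh e (y, p.2)) p.1.

Let B e (p : E * R) : E :=
  gradrho e p + (- ((n%:R - 1) * derive1 nu 0 * rh e p)) *: cfluxv sigma e (f e) p.

Lemma leading_order : \forall e \near 0^'+, forall x w t, U (x, t) -> sphere w ->
  tau 0 * laplacian (fun y => cf e (x, y, t)) w - dot w (B e (x, t)) = Err e (x, w, t).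
Proof.
near=> e => x w t Uxt wS.
have [e0 se] : 0 < e /\ smooth_on (region_punctured U) (deg0 (f e)).
  by near: e; exact: near_good.
have en0 : e != 0 by rewrite gt_eqF.
have md : forall x w t, U (x, t) -> sphere w ->
  e * transport (f e) x w t + K2 * eta e ^+ 2 * nonlocal sigma nu tau (f e) x w t
  = collision sigma nu tau (f e) x w t + rem e x w t by near: e; exact: f_model.
have := md x w t Uxt wS.
rewrite (transportE sigma_uniform U_open en0 se Uxt wS).
rewrite (collisionE sigma_uniform U_open en0 se Uxt tau nu0 wS).
have wjE : dot w (cfluxv sigma e (f e) (x, t)) = wJ e (x, w, t).
  by apply: eq_bigr => k _; rewrite mxE.
have jgE : dot (cfluxv sigma e (f e) (x, t)) (grad (fun y => cf e (x, y, t)) w)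
    = Jgrad e (x, w, t).
  by rewrite dot_grad_corr; apply: eq_bigr => k _; rewrite mxE.
rewrite /B dotDr dotZr wjE jgE laplacian_corr.
rewrite /Err -/(gradrho e (x, t)) -/(NL e (x, w, t)) -/(dtrho e (x, t)) -/(nJ e (x, t)).
rewrite /base /=.
set r := rem e x w t; set N := NL e _; set d := dtrho e _; set G := dot w _.
set T := 'D_dt _ _ + _; set s := slope nu _; set L := lapC e _; set jg := Jgrad e _.
set wj := wJ e _; set rr := rh e _; set cc := cf e _; set t1 := tau _.
set H := K2 * eta e ^+ 2.
move=> h.
(* Eliminating the remainder through the model reduces the claim to algebra in e, e != 0. *)
have rE : r = e * (d + G + e * T) + H * N
   - e * (- s * (e * jg - (n%:R - 1) * ((rr + e * cc) * wj)) + t1 * L).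
  by rewrite h addrC addKr.
rewrite rE; move: (derive1 nu 0) (tau 0) => n0 t0; field.
Unshelve. all: by end_near. Qed.


Let c0 : R := ((n%:R - 1) * tau 0)^-1.
(** This is c0 / n: c0 inverts tau 0 times the Laplacian on linear forms, up to sign, and 1 / n is
    the second moment of a coordinate. *)
Let kappa : R := ((n%:R - 1) * n%:R * tau 0)^-1.

Lemma n_gt0R : 0 < n%:R :> R.
Proof. by rewrite ltr0n (leq_trans _ n_ge2). Qed.

Lemma n_gt1R : 0 < n%:R - 1 :> R.
Proof. by rewrite subr_gt0 ltr1n. Qed.

Lemma near_leading_order : exists2 C, 0 <= C & \forall e \near 0^'+,
  forall x w t, U (x, t) -> sphere w ->
  `|tau 0 * laplacian (fun y => cf e (x, y, t)) w - dot w (B e (x, t))| <= C * e.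
Proof.
have [C hC] := unifO_Err; exists `|C| => //; near=> e => x w t Uxt wS.
have lo : forall x w t, U (x, t) -> sphere w ->
  tau 0 * laplacian (fun y => cf e (x, y, t)) w - dot w (B e (x, t)) = Err e (x, w, t).
  by near: e; exact: leading_order.
have hCe : forall q, D q -> `|Err e q| <= C * e by near: e.
rewrite lo //; apply: (le_trans (hCe (x, w, t) (conj Uxt wS))).
by apply: ler_wpM2r; [near: e; exact: near0_ge0 | exact: ler_norm].
Unshelve. all: by end_near. Qed.

Lemma unifO_corr_dot :
  unifO D (fun e q => cf e q + c0 * dot q.1.2 (B e (base q))) id.
Proof.
have [C _ hC] := near_leading_order; exists (2 * (C / tau 0)).
near=> e => -[[x w] t] [/= Uxt wS].
have [e0 se] : 0 < e /\ smooth_on (region_punctured U) (deg0 (f e)).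
  by near: e; exact: near_good.
have en0 : e != 0 by rewrite gt_eqF.
have hCe : forall x w t, U (x, t) -> sphere w ->
  `|tau 0 * laplacian (fun y => cf e (x, y, t)) w - dot w (B e (x, t))| <= C * e.
  by near: e.
have -> : 2 * (C / tau 0) * e = 2 * (C * e / tau 0).
  by rewrite -mulrA; congr (_ * _); exact: mulrAC.
exact: (corrector_estimate n_ge2 sigma_uniform U_open en0 se Uxt tau0_gt0
  (fun w wS => hCe x w t Uxt wS)).
Unshelve. all: by end_near. Qed.

Lemma unifO_cflux_B k :
  unifO U (fun e p => J k e p + c0 * (B e p 0 k / n%:R)) id.
Proof.
have [C _ hC] := near_leading_order; exists (2 * (C / tau 0)).
near=> e => -[x t] Uxt.
have [e0 se] : 0 < e /\ smooth_on (region_punctured U) (deg0 (f e)).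
  by near: e; exact: near_good.
have en0 : e != 0 by rewrite gt_eqF.
have hCe : forall x w t, U (x, t) -> sphere w ->
  `|tau 0 * laplacian (fun y => cf e (x, y, t)) w - dot w (B e (x, t))| <= C * e.
  by near: e.
have -> : 2 * (C / tau 0) * e = 2 * (C * e / tau 0).
  by rewrite -mulrA; congr (_ * _); exact: mulrAC.
exact: (cflux_estimate n_ge2 sigma_uniform U_open en0 se Uxt k tau0_gt0
  (fun w wS => hCe x w t Uxt wS)).
Unshelve. all: by end_near. Qed.

Lemma near_denominator : \forall e \near 0^'+, forall p, U p ->
  delta / rhoc <= 1 - rh e p / rhoc.
Proof.
near=> e => -[x t] Uxt.
have h : forall x t, U (x, t) -> density sigma (f e) x t <= rhoc - delta by near: e.
have -> : 1 - rh e (x, t) / rhoc = (rhoc - density sigma (f e) x t) / rhoc.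
  by rewrite mulrBl divff // gt_eqF.
rewrite ler_pM2r ?invr_gt0 //; have := h x t Uxt; lra.
Unshelve. all: by end_near. Qed.

Let r k e (p : E * R) : R := kappa * ((1 - rh e p / rhoc)^-1 * gradrho e p 0 k).

(** Fick's law. With nu'(0) = n tau 0 / rhoc, the term c0 B / n equals kappa grad rho - (rho / rhoc)
    J, so the quantity of [unifO_cflux_B] is (1 - rho / rhoc) J + kappa grad rho; divide by the
    factor, bounded below by delta / rhoc. *)
Lemma unifO_flux_law k : unifO U (fun e p => J k e p + r k e p) id.
Proof.
have dr : 0 < delta / rhoc by rewrite divr_gt0.
apply: (@unifO_near _ _ _ (fun e p => (1 - rh e p / rhoc)^-1 *
    (J k e p + c0 * (B e p 0 k / n%:R)))).
  near=> e => p Up.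
  have h : forall p, U p -> delta / rhoc <= 1 - rh e p / rhoc.
    by near: e; exact: near_denominator.
  have a0 : 1 - rh e p / rhoc != 0 by rewrite gt_eqF // (lt_le_trans dr) // h.
  have BE : B e p 0 k = gradrho e p 0 k + - ((n%:R - 1) * derive1 nu 0 * rh e p) * J k e p.
    by rewrite /B [LHS]mxE [X in _ + X = _]mxE [cfluxv _ _ _ _ _ _]mxE.
  have n0 := n_gt0R; have n1 := n_gt1R.
  rewrite BE /r /c0 /kappa nu'0.
  (* [field] clears the inner quotient and asks for this form of the nonvanishing. *)
  have a1 : rhoc - rh e p != 0.
    by apply: contraNneq a0 => /eqP; rewrite subr_eq0 => /eqP <-; rewrite divff ?subrr // gt_eqF.
  move: (gradrho e p 0 k) (J k e p) (rh e p) a0 a1 => g j rr a0 a1.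
  by field; rewrite a1 !gt_eqF.
apply: unifO_mul1; last exact: unifO_cflux_B.
exists (delta / rhoc)^-1; near=> e => p Up.
have h : forall p, U p -> delta / rhoc <= 1 - rh e p / rhoc.
  by near: e; exact: near_denominator.
have a0 : 0 < 1 - rh e p / rhoc by rewrite (lt_le_trans dr) // h.
have v0 : 0 <= (1 - rh e p / rhoc)^-1 by rewrite invr_ge0 ltW.
by rewrite mulr1 (ger0_norm v0) lef_pV2 ?posrE //; exact: h.
Unshelve. all: by end_near. Qed.

Lemma first_order_expansion : unifO D
  (fun e p => let: (x, w, t) := p in
     f e x w t - (density sigma (f e) x t
       - e * (n%:R * dot w (grad (fun y => density sigma (f e) y t) x)
           / ((n%:R - 1) * n%:R * tau 0 * (1 - density sigma (f e) x t / rhoc)))))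
  (fun e => e ^+ 2).
Proof.
have dr : 0 < delta / rhoc by rewrite divr_gt0.
(* In f_1 = h - c0 w . B, the flux J inside B is replaced by -r, at the cost of the second summand.
   What is left, -c0 w . grad rho (1 + (rho / rhoc) / (1 - rho / rhoc)), is the announced
   corrector. *)
apply: (@unifO_near _ _ _ (fun e q => e * ((cf e q + c0 * dot q.1.2 (B e (base q)))
   + n%:R / rhoc * (rh e (base q) *
       \sum_k q.1.2 0 k * (J k e (base q) + r k e (base q)))))).
  near=> e => -[[x w] t] [/= Uxt wS].
  have [e0 se] : 0 < e /\ smooth_on (region_punctured U) (deg0 (f e)).
    by near: e; exact: near_good.
  have en0 : e != 0 by rewrite gt_eqF.
  rewrite (f_sphereE sigma (f e) en0 x t wS).
  have h : forall p, U p -> delta / rhoc <= 1 - rh e p / rhoc.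
    by near: e; exact: near_denominator.
  have a0 : 1 - rh e (x, t) / rhoc != 0 by rewrite gt_eqF // (lt_le_trans dr) // h.
  have wBE : dot w (B e (x, t)) = dot w (gradrho e (x, t))
      + - ((n%:R - 1) * derive1 nu 0 * rh e (x, t)) * wJ e (x, w, t).
    rewrite /B dotDr dotZr; congr (_ + _ * _).
    by apply: eq_bigr => k _; rewrite mxE.
  have sE : \sum_k w 0 k * (J k e (x, t) + r k e (x, t)) =
      wJ e (x, w, t) + kappa * ((1 - rh e (x, t) / rhoc)^-1 * dot w (gradrho e (x, t))).
    transitivity (wJ e (x, w, t) + \sum_k w 0 k * r k e (x, t)).
      by rewrite -big_split; apply: eq_bigr => k _; exact: mulrDr.
    congr (_ + _); rewrite /dot mulrA mulr_sumr; apply: eq_bigr => k _.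
    by rewrite /r [kappa * _]mulrA mulrCA.
  rewrite -[base _]/(x, t) wBE sE.
  rewrite -[density sigma (f e) x t]/(rh e (x, t)) -[grad _ x]/(gradrho e (x, t)).
  have n0 := n_gt0R; have n1 := n_gt1R.
  rewrite /c0 /kappa nu'0.
  have a1 : rhoc - rh e (x, t) != 0.
    by apply: contraNneq a0 => /eqP; rewrite subr_eq0 => /eqP <-; rewrite divff ?subrr // gt_eqF.
  move: (dot w _) (wJ e _) (rh e _) (cf e _) a0 a1 => g j rr c a0 a1.
  by field; rewrite a1 !gt_eqF.
apply: (@unifO_eq _ _ _ _ (fun e => e * e)); first by near=> e; rewrite expr2.
apply: unifO_emul; apply: unifO_add; first exact: unifO_corr_dot.
apply: unifO_scale; apply: unifO_mul1; first exact: (unifO_base unifO_rho).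
apply: unifO_sum; first exact: near0_ge0.
by move=> k; apply: unifO_mul1; [exact: unifO_w | exact: (unifO_base (unifO_flux_law k))].
Unshelve. all: by end_near. Qed.

(* The flux is e J; Z is the opposite of its deviation from Fick's law. *)
Let Z e (x : E) (t : R) : E := \row_k (- (e * (J k e (x, t) + r k e (x, t)))).

Lemma unifO_Z : unifO U (fun e p => enorm (Z e p.1 p.2)) (fun e => e ^+ 2).
Proof.
have n2 : \forall e \near (0 : R)^'+, 0 <= e ^+ 2 by near=> e; exact: sqr_ge0.
apply: (@unifO_bound _ _ _ _ (fun e p => \sum_k `|- (e * (J k e p + r k e p))|)).
  near=> e => -[x t] Uxt; rewrite ger0_norm ?enorm_ge0 // ger0_norm ?sumr_ge0 //.
  apply: (le_trans (enorm_le_sum _)); apply: ler_sum => k _.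
  by rewrite [Z _ _ _ _ _]mxE.
apply: unifO_norm_sum => // k; apply: unifO_opp.
apply: (@unifO_eq _ _ _ _ (fun e => e * e)); first by near=> e; rewrite expr2.
exact/unifO_emul/unifO_flux_law.
Unshelve. all: by end_near. Qed.

Lemma near_differentiable_flux : \forall e \near 0^'+, forall x t k, U (x, t) ->
  differentiable (fun y => J k e (y, t)) x /\
  differentiable (fun y => (1 - rh e (y, t) / rhoc)^-1 * gradrho e (y, t) 0 k) x.
Proof.
have dr : 0 < delta / rhoc by rewrite divr_gt0.
near=> e => x t k Uxt.
have [e0 se] : 0 < e /\ smooth_on (region_punctured U) (deg0 (f e)).
  by near: e; exact: near_good.
have en0 : e != 0 by rewrite gt_eqF.
have sr := smooth_rhof sigma_uniform U_open se.
split.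
  apply: differentiable_slice_x.
  have sJ := smooth_cflux sigma_uniform U_open e se k.
  exact: (smooth_on_diff sJ Uxt).
have h : forall p, U p -> delta / rhoc <= 1 - rh e p / rhoc.
  by near: e; exact: near_denominator.
have a0 : 1 - rh e (x, t) / rhoc != 0 by rewrite gt_eqF // (lt_le_trans dr) // h.
have dr0 : differentiable (fun y => rh e (y, t)) x.
  by apply: differentiable_slice_x; exact: (smooth_on_diff sr Uxt).
apply: differentiableM.
  apply: differentiableV => //; apply: differentiableB => //.
  exact: differentiableM.
rewrite (_ : (fun y => _) = fun y => 'D_(('e_k, 0) : E * R) (rh e) (y, t)).
  exact: differentiable_slice_x (sr [:: ('e_k, 0)] (x, t) Uxt).
by apply/funext => y; rewrite [LHS]mxE; exact: (partial_slice (rh e) y t k).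
Unshelve. all: by end_near. Qed.

Lemma differentiable_row m (G : 'I_m -> E -> R) (x : E) :
  (forall k, differentiable (G k) x) -> differentiable (fun y => \row_k G k y) x.
Proof.
move=> dG; rewrite (_ : (fun y => _) = \sum_k (fun y => G k y *: ('e_k : 'rV[R]_m))).
  by apply: differentiable_sum => k; exact: differentiableZl.
by apply/funext => y; rewrite fct_sumE [LHS]row_sum_delta; apply: eq_bigr => k _; rewrite mxE.
Qed.

Lemma differentiable_Z : \forall e \near 0^'+, forall x t, U (x, t) ->
  differentiable (fun y => Z e y t) x.
Proof.
near=> e => x t Uxt; apply: differentiable_row => k.
have dJr : forall x t k, U (x, t) -> differentiable (fun y => J k e (y, t)) x /\
  differentiable (fun y => (1 - rh e (y, t) / rhoc)^-1 * gradrho e (y, t) 0 k) x.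
  by near: e; exact: near_differentiable_flux.
have [dJ dR] := dJr x t k Uxt.
apply: differentiableN; apply: differentiableM => //; apply: differentiableD => //.
exact: differentiableM.
Unshelve. all: by end_near. Qed.

(** An exact identity: mass conservation reads d_t rho = - e div J, and [Z] is by construction what
    must be added to Fick's flux. Only the splitting of the divergence remains, by
    differentiability. *)
Lemma diffusion_equation : \forall e \near 0^'+, forall x t, U (x, t) ->
  derive1 (fun s => density sigma (f e) x s) t =
  e / ((n%:R - 1) * n%:R * tau 0) *
    div (fun y => (1 - density sigma (f e) y t / rhoc)^-1
                    *: grad (fun z => density sigma (f e) z t) y) x
  + div (fun y => Z e y t) x.
Proof.
near=> e => x t Uxt.
have dJr : forall x t k, U (x, t) -> differentiable (fun y => J k e (y, t)) x /\
  differentiable (fun y => (1 - rh e (y, t) / rhoc)^-1 * gradrho e (y, t) 0 k) x.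
  by near: e; exact: near_differentiable_flux.
have dt : forall p, U p -> dtrho e p = - (e * \sum_i 'D_(('e_i, 0) : E * R) (J i e) p).
  by near: e; exact: dtrhoE.
rewrite -[LHS]/(dtrho e (x, t)) (dt (x, t) Uxt) /div mulr_sumr -sumrN.
rewrite mulr_sumr -big_split; apply: eq_bigr => k _ /=.
have [dJ dR] := dJr x t k Uxt.
set S := fun y => (1 - rh e (y, t) / rhoc)^-1 * gradrho e (y, t) 0 k in dR.
have -> : (fun y => ((1 - density sigma (f e) y t / rhoc)^-1 *:
    grad (fun z => density sigma (f e) z t) y) 0 k) = S.
  by apply/funext => y; rewrite [LHS]mxE.
have -> : (fun y => Z e y t 0 k) = fun y => - (e * (J k e (y, t) + kappa * S y)).
  by apply/funext => y; rewrite [LHS]mxE.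
have dK : differentiable (fun y => kappa * S y) x by exact: differentiableM.
rewrite partialN; last by apply: differentiableM => //; exact: differentiableD.
rewrite partialM //; last exact: differentiableD.
rewrite partialD // partialM // !partial_cst !mulr0 !addr0 (partial_slice (J k e)) /kappa.
move: (partial k S x) ('D__ _ _) (_ * _ * tau 0)^-1 => *; ring.
Unshelve. all: by end_near. Qed.

End asymptotics.

(** If eta = O(sqrt e), square the bound; if eta = O(e), use in addition e^2 <= e for e <= 1. *)
Lemma bigO_sqr (R : realType) (eta : R -> R) :
  (eta =O_ (0^'+) (fun e : R => Num.sqrt e)) \/ (eta =O_ (0^'+) (fun e : R => e)) ->
  exists C, \forall e \near 0^'+, eta e ^+ 2 <= C * e.
Proof.
have sqr_le (k u v : R) : 0 <= v -> `|u| <= k * v -> u ^+ 2 <= k ^+ 2 * v ^+ 2.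
  by move=> v0 h; rewrite -exprMn -real_normK ?num_real // ler_pXn2r ?nnegrE // (le_trans _ h).
case=> /eqO_exP[k k0 hk]; exists (k ^+ 2); near=> e.
  have e0 : 0 <= e by near: e; exact: near0_ge0.
  have h : `|eta e| <= k * `|Num.sqrt e| by near: e.
  rewrite -[e in leRHS]sqr_sqrtr //; apply: sqr_le; first exact: sqrtr_ge0.
  by rewrite -[X in k * X](ger0_norm (sqrtr_ge0 e)).
have e0 : 0 <= e by near: e; exact: near0_ge0.
have e1 : e <= 1 by near: e; exact: nbhs_right_le.
have h : `|eta e| <= k * `|e| by near: e.
apply: (@le_trans _ _ (k ^+ 2 * e ^+ 2)).
  by apply: sqr_le => //; rewrite -[X in k * X](ger0_norm e0).
by rewrite ler_wpM2l ?sqr_ge0 // expr2 ger_pMl // .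
Unshelve. all: by end_near. Qed.

Theorem theorem3 (R : realType) (n : nat) (n_ge2 : (2 <= n)%N)
  (sigma : probability (rVborel R n) R)
  (sigma_uniform : uniform_on_sphere sigma)
  (lam : {measure set (rVborel R n) -> \bar R})
  (lam_lebesgue : is_lebesgue lam)
  (K : R -> R)
  (K_integrable : lam.-integrable setT (fun xi => (K (enorm xi))%:E))
  (K_mass : Rintegral lam setT (fun xi => K (enorm xi)) = 1)
  (K_moment_integrable :
     lam.-integrable setT (fun xi => (K (enorm xi) * enorm xi ^+ 2)%:E))
  (K2_gt0 : 0 < kernel_moment lam K)
  (nu tau : R -> R)
  (nu_derivable : forall r, derivable nu r 1)
  (nu_C1 : continuous (derive1 nu))
  (tau_derivable : forall r, derivable tau r 1)
  (tau_C1 : continuous (derive1 tau))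
  (nu_ge0 : forall r, 0 <= r -> 0 <= nu r)
  (tau_gt0 : forall r, 0 <= r -> 0 < tau r)
  (nu_slope_lipschitz : [lipschitz nu r / r | r in `]0, +oo[])
  (nu_slope_bounded : [bounded nu r / r | r in `]0, +oo[])
  (tau_lipschitz : [lipschitz tau r | r in `[0, +oo[])
  (tau_bounded : [bounded tau r | r in `[0, +oo[])
  (k_increasing : forall r s, 0 <= r -> r < s -> nu r / tau r < nu s / tau s)
  (rhoc : R)
  (rhoc_lim : n%:R * r / (nu r / tau r) @[r --> 0^'+] --> rhoc)
  (eta : R -> R)
  (eta_small : (eta =O_ (0^'+) (fun e : R => Num.sqrt e)) \/
               (eta =O_ (0^'+) (fun e : R => e)))
  (U : set ('rV[R]_n * R))
  (U_open : open U)
  (U_time : forall x t, U (x, t) -> 0 < t)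
  (f rem : R -> 'rV[R]_n -> 'rV[R]_n -> R -> R)
  (f_smooth : \forall e \near 0^'+,
     smooth_on (region_punctured U) (deg0 (f e)))
  (f_model : \forall e \near 0^'+, forall x w t, U (x, t) -> sphere w ->
     e * transport (f e) x w t
     + kernel_moment lam K * eta e ^+ 2 * nonlocal sigma nu tau (f e) x w t
     = collision sigma nu tau (f e) x w t + rem e x w t)
  (rem_bigO : unifO (region_sphere U)
     (fun e p => rem e p.1.1 p.1.2 p.2) (fun e => eta e ^+ 4))
  (rem_mean0 : \forall e \near 0^'+, forall x t, U (x, t) ->
     density sigma (rem e) x t = 0)
  (f1_bigO : unifO1_derivatives (region_sphere U)
     (fun e => deg0 (corrector sigma e (f e))))
  (rho_bigO : unifO1_derivatives U
     (fun e p => density sigma (f e) p.1 p.2))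
  (rho_subcritical : exists2 delta : R, 0 < delta &
     \forall e \near 0^'+, forall x t, U (x, t) ->
       density sigma (f e) x t <= rhoc - delta) :
  let rho e := density sigma (f e) in
  let tau0 := tau 0 in
  unifO (region_sphere U)
    (fun e p => let: (x, w, t) := p in
       f e x w t -
       (rho e x t - e * (n%:R * dot w (grad (fun y => rho e y t) x)
                         / ((n%:R - 1) * n%:R * tau0 * (1 - rho e x t / rhoc)))))
    (fun e => e ^+ 2)
  /\
  exists Z : R -> 'rV[R]_n -> R -> 'rV[R]_n,
    [/\ unifO U (fun e p => enorm (Z e p.1 p.2)) (fun e => e ^+ 2),
        \forall e \near 0^'+, forall x t, U (x, t) ->
          differentiable (fun y => Z e y t) x
      & \forall e \near 0^'+, forall x t, U (x, t) ->
          derive1 (fun s => rho e x s) t =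
          e / ((n%:R - 1) * n%:R * tau0) *
            div (fun y => (1 - rho e y t / rhoc)^-1
                            *: grad (fun z => rho e z t) y) x
          + div (fun y => Z e y t) x].

Proof.
have n_gt0 : (0 < n)%N by exact: leq_trans n_ge2.
have nu0 := nu_0 nu_derivable nu_slope_bounded.
have rc0 := rhoc_gt0 n_gt0 nu_derivable tau_derivable nu_ge0 tau_gt0
  nu_slope_bounded k_increasing rhoc_lim.
have nu'0 := derive_nuE n_gt0 nu_derivable tau_derivable nu_ge0 tau_gt0
  nu_slope_bounded k_increasing rhoc_lim.
have sl := slope_lipschitz0 nu_derivable nu_slope_lipschitz nu_slope_bounded.
have tl := tau_lipschitz0 tau_lipschitz.
have es := bigO_sqr eta_small.
have [delta d0 sub] := rho_subcritical.
move=> rho tau0; split.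
  exact: (first_order_expansion n_ge2 sigma_uniform nu_C1 tau_C1 nu0 (tau_gt0 0 (lexx 0))
    rc0 nu'0 sl tl es U_open f_smooth f_model rem_bigO rem_mean0 f1_bigO rho_bigO d0 sub).
 
(* The witness is fixed by unification with [unifO_Z]: it is -e times the deviation of J from Fick's
   law. *)
eexists; split.
- exact: (unifO_Z n_ge2 sigma_uniform nu_C1 tau_C1 nu0 (tau_gt0 0 (lexx 0))
    rc0 nu'0 sl tl es U_open f_smooth f_model rem_bigO rem_mean0 f1_bigO rho_bigO d0 sub).
- exact: (differentiable_Z sigma_uniform tau rc0 U_open f_smooth d0 sub).
- exact: (diffusion_equation sigma_uniform rc0 U_open f_smooth f_model rem_mean0 d0 sub).
Qed.
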